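(* Let $s>5/2$, let $u_0\in H_0^s(\mathbb T_L)$ be deterministic, let $\Phi\in\mathcal L_2(\mathcal U;H_0^{s-2}(\mathbb T_L))$, and let $(u,\tau_\infty)$ be the maximal pathwise solution of $$du+uu_x\,dt=-\Lambda\partial_x\Bigl(u^2+\tfrac12u_x^2\Bigr)dt+\Lambda\Phi\,dW(t),\qquad u(0)=u_0.$$ Let $T>0$ and suppose that $\mathbb P(\tau_\infty>T)=1$ and $\mathbb E\sup_{0\le t\le T}\|u(t)\|_{H^s}^2<\infty$. Then the energy $E(t):=\frac12\|u(t)\|_{H^1}^2$ satisfies, for every $0\le t\le T$, $$\mathbb E[E(t)]=\tfrac12\|u_0\|_{H^1}^2+\tfrac12C_\Phi\,t,\qquad C_\Phi:=\|\Lambda\Phi\|_{\mathcal L_2(\mathcal U;H^1(\mathbb T_L))}^2.$$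
   Context: $\mathbb T_L=\mathbb R/L\mathbb Z$ is identified with the periodic interval $[a,b)$, $L=b-a$, $\mu=2\pi/L$; all spatial operators are periodic. Fourier coefficients: $\widehat f(k)=\frac1L\int_a^bf(x)e^{-\mathrm ik\mu(x-a)}dx$; $\|f\|_{H^r}^2=\sum_{k}(1+|k\mu|^2)^r|\widehat f(k)|^2$; $H_0^r(\mathbb T_L)=\{f\in H^r(\mathbb T_L):\widehat f(0)=0\}$. $\Lambda:=(1-\partial_x^2)^{-1}$. $W$ is a cylindrical Wiener process on $\mathcal U=L_0^2(\mathbb T_L)$ (zero-mean $L^2$ functions); $\mathcal L_2$ denotes Hilbert--Schmidt operators. The maximal pathwise solution $(u,\tau_\infty)$ is the unique adapted process with $u\in C([0,\tau_\infty);H^s(\mathbb T_L))$ a.s. solving the equation on $[0,\tau_\infty)$, with $\tau_\infty$ the maximal existence time; it is known that it exists and that a.s. $\tau_\infty<\infty$ if and only if $\limsup_{t\uparrow\tau_\infty}\|u(t)\|_{W^{1,\infty}(\mathbb T_L)}=\infty$. *)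

(* Defs.v *)
From HB Require Import structures.
From mathcomp Require Import all_boot all_order all_algebra.
From mathcomp Require Import all_classical all_reals all_analysis.
From mathcomp Require Import complex.

Set Implicit Arguments.
Unset Strict Implicit.
Unset Printing Implicit Defensive.
Import Order.TTheory GRing.Theory Num.Theory.
Import numFieldNormedType.Exports.

Local Open Scope classical_set_scope.
Local Open Scope ring_scope.
Local Open Scope ereal_scope.

Section Torus.
Context {R : realType}.
Variables a b : R.

Local Notation leb := (@lebesgue_measure R).

(* Functions on the torus are L-periodic functions on the real line. *)
Definition period : R := (b - a)%R.
Definition wavenumber : R := (2 * pi / period)%R.
Definition periodic (f : R -> R) : Prop := forall x, f (x + period)%R = f x.

Definition fourier (f : R -> R) (k : int) : R[i] :=
  Complex
    (period^-1 *
       \int[leb]_(x in `[a, b]) (f x * cos (k%:~R * wavenumber * (x - a))))%R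
    (- (period^-1 *
       \int[leb]_(x in `[a, b]) (f x * sin (k%:~R * wavenumber * (x - a)))))%R.

(* The squared norm of H^r. *)
Definition Hnorm2 (r : R) (f : R -> R) : \bar R :=
  \esum_(k in [set: int])
    ((1 + (k%:~R * wavenumber) ^+ 2) `^ r * Normc.normc (fourier f k) ^+ 2)%:E.

(* H^r for r > 1/2 only: by the Sobolev embedding every class then has exactly
   one continuous representative, and that representative is the element. *)
Definition sobolev (r : R) (f : R -> R) : Prop :=
  [/\ periodic f, continuous f & Hnorm2 r f < +oo].

Definition sobolev0 (r : R) (f : R -> R) : Prop :=
  sobolev r f /\ fourier f 0 = 0%R.

(* Open subsets of H^r; they generate its Borel sigma-algebra. *)
Definition sobolev_open (r : R) (U : set (R -> R)) : Prop :=
  U `<=` sobolev r /\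
  forall f, U f -> exists2 eps : R, (0 < eps)%R &
    forall g, sobolev r g -> Hnorm2 r (g \- f)%R < eps%:E -> U g.

(* L^2_0; its elements are taken up to equality almost everywhere. *)
Definition L20 (f : R -> R) : Prop :=
  [/\ periodic f, measurable_fun [set: R] f,
      \int[leb]_(x in `[a, b]) ((f x) ^+ 2)%:E < +oo & fourier f 0 = 0%R].

Definition L2dot (f g : R -> R) : R := (\int[leb]_(x in `[a, b]) (f x * g x))%R.

Definition orthonormal_basis (e : nat -> R -> R) : Prop :=
  [/\ forall j, L20 (e j),
      forall i j, L2dot (e i) (e j) = (i == j)%:R &
      forall f, L20 f -> (forall j, L2dot f (e j) = 0%R) -> L2dot f f = 0%R].

(* Lam f is the periodic solution g of g - g'' = f; it exists and is unique for
   every continuous periodic f, which is the only case in which Lam is used. *)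
Definition Lam (f : R -> R) : R -> R :=
  xget (fun=> 0%R) [set g | [/\ periodic g,
    forall x, derivable g x 1%R,
    forall x, derivable (g^`())%classic x 1%R &
    forall x, (g x - (g^`())^`()%classic x)%R = f x]].

(* The squared Hilbert-Schmidt norm of Psi : L^2_0 -> H^r, computed in the
   orthonormal basis e. *)
Definition HSnorm2 (e : nat -> R -> R) (r : R) (Psi : (R -> R) -> R -> R)
    : \bar R :=
  \sum_(0 <= j <oo) Hnorm2 r (Psi (e j)).

(* Hilbert-Schmidt operators from L^2_0 to H^r_0, r > 1/2.  The values are
   continuous functions, so linearity is a pointwise identity; together with
   boundedness it makes Psi f depend only on the a.e. class of f. *)
Definition hilbert_schmidt (e : nat -> R -> R) (r : R)
    (Psi : (R -> R) -> R -> R) : Prop :=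
  [/\ forall f, L20 f -> sobolev0 r (Psi f),
      forall (c : R) f g, L20 f -> L20 g ->
        Psi (fun x => c * f x + g x)%R = (fun x => c * Psi f x + Psi g x)%R,
      exists C : R, forall f, L20 f -> Hnorm2 r (Psi f) <= (C * L2dot f f)%:E &
      HSnorm2 e r Psi < +oo].

(* - v v_x - Lambda d_x (v^2 + v_x^2 / 2) *)
Definition drift (v : R -> R) : R -> R := fun x =>
  (- (v x * (v^`())%classic x)
   - Lam ((fun y => v y ^+ 2 + 2^-1 * (v^`())%classic y ^+ 2)^`())%classic x)%R.

Section Stochastic.
Context {d : measure_display} {Omega : measurableType d}.
Variable P : probability Omega R.

(* Only the indices t >= 0 are meaningful. *)
Definition filtration (F : R -> set (set Omega)) : Prop :=
  [/\ forall t, (0 <= t)%R -> sigma_algebra [set: Omega] (F t),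
      forall t, (0 <= t)%R -> F t `<=` measurable &
      forall t1 t2, (0 <= t1)%R -> (t1 <= t2)%R -> F t1 `<=` F t2].

Definition stopping_time (F : R -> set (set Omega)) (tau : Omega -> \bar R) :=
  forall t, (0 <= t)%R -> F t [set w | tau w <= t%:E].

(* W = sum_j beta_j e_j for an orthonormal basis (e_j) of L^2_0, where the
   beta_j are independent standard Brownian motions relative to F.  The product
   formula says at once that the increments over [t1, t2] are independent of
   F t1, independent of one another, and of law N(0, t2 - t1); the second
   parameter of normal_prob is the standard deviation. *)
Definition cylindrical_wiener (F : R -> set (set Omega))
    (beta : nat -> R -> Omega -> R) : Prop :=
  [/\ forall j, {ae P, forall w, beta j 0%R w = 0%R},
      forall j t, (0 <= t)%R ->
        forall B : set R, measurable B -> F t (beta j t @^-1` B),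
      forall t1 t2, (0 <= t1)%R -> (t1 < t2)%R ->
        forall A, F t1 A ->
        forall (n : nat) (B : 'I_n -> set R), (forall j, measurable (B j)) ->
        P (A `&` [set w | forall j : 'I_n, B j (beta j t2 w - beta j t1 w)%R])
        = P A * \prod_(j < n) normal_prob 0%R (Num.sqrt (t2 - t1)) (B j) &
      forall j, {ae P, forall w,
        {within [set t | (0 <= t)%R], continuous (fun t => beta j t w)}}].

(* The H^r-valued process u, defined on [0, tau), is adapted. *)
Definition adapted (F : R -> set (set Omega)) (r : R) (tau : Omega -> \bar R)
    (u : R -> Omega -> R -> R) : Prop :=
  forall t, (0 <= t)%R -> forall U, sobolev_open r U ->
    F t [set w | t%:E < tau w /\ U (u t w)].

(* v belongs to C([0, sigma); H^r). *)
Definition sobolev_path (r : R) (sigma : \bar R) (v : R -> R -> R) : Prop :=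
  forall t, (0 <= t)%R -> t%:E < sigma ->
    sobolev r (v t) /\
    Hnorm2 r (v t' \- v t)%R @[t' --> within [set t' | (0 <= t')%R] (nbhs t)]
      --> 0.

(* M is the stochastic integral of Psi against W from 0 to t, as a continuous
   adapted H^r-valued process.  As Psi is deterministic and constant in time,
   this is the limit in L^2(Omega; H^r) of sum_(j < n) beta_j(t) Psi e_j. *)
Definition stochastic_integral (F : R -> set (set Omega)) (e : nat -> R -> R)
    (beta : nat -> R -> Omega -> R) (r : R) (Psi : (R -> R) -> R -> R)
    (M : R -> Omega -> R -> R) : Prop :=
  [/\ adapted F r (fun=> +oo) M,
      {ae P, forall w, sobolev_path r +oo (fun t => M t w)} &
      forall t, (0 <= t)%R ->
        (fun n => \int[P]_w Hnorm2 r (fun x =>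
           M t w x - \sum_(j < n) beta j t w * Psi (e j) x)%R) @ \oo --> 0].

(* The equation holds in integrated form, pointwise in x: for s > 5/2 every
   term is continuous in x, and continuous in time with values in H^(s-1). *)
Definition local_solution (F : R -> set (set Omega)) (e : nat -> R -> R)
    (beta : nat -> R -> Omega -> R) (s : R) (Phi : (R -> R) -> R -> R)
    (u0 : R -> R) (u : R -> Omega -> R -> R) (tau : Omega -> \bar R) : Prop :=
  [/\ stopping_time F tau, {ae P, forall w, 0 < tau w},
      adapted F s tau u,
      {ae P, forall w, sobolev_path s (tau w) (fun t => u t w)} &
      exists2 M, stochastic_integral F e beta s (Lam \o Phi) M &
        {ae P, forall w, forall t, (0 <= t)%R -> t%:E < tau w -> forall x,
          u t w x = (u0 x + \int[leb]_(t' in `[0%R, t]) drift (u t' w) x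
                     + M t w x)%R}].

(* Any other solution is dominated by, and agrees with, the maximal one. *)
Definition maximal_solution (F : R -> set (set Omega)) (e : nat -> R -> R)
    (beta : nat -> R -> Omega -> R) (s : R) (Phi : (R -> R) -> R -> R)
    (u0 : R -> R) (u : R -> Omega -> R -> R) (tau : Omega -> \bar R) : Prop :=
  local_solution F e beta s Phi u0 u tau /\
  forall v sigma, local_solution F e beta s Phi u0 v sigma ->
    {ae P, forall w, sigma w <= tau w /\
      forall t, (0 <= t)%R -> t%:E < sigma w -> v t w = u t w}.

Definition energy (u : R -> Omega -> R -> R) (t : R) (w : Omega) : \bar R :=
  (2^-1)%:E * Hnorm2 1 (u t w).

End Stochastic.
End Torus.

(* Main.v *)
(* Let <.,.> be the inner product of H^1, M the stochastic integral, psi_j = Lambda Phi e_j its modes, and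
   Y = u - M = u_0 + int drift.  Since <drift v, v> = 0 and since u and M are uniformly continuous with values
   in C^2, summing increments over a partition t_i = i t / N gives, for almost every path,
     |u(t)|^2 - |M(t)|^2 - |u_0|^2 = 2 lim_N sum_i <Y(t_i), M(t_(i+1)) - M(t_i)>.
   Keeping only the first n(N) modes of M turns the sum into J_N = sum_(i,j) <Y(t_i), psi_j> (beta_j(t_(i+1)) - beta_j(t_i)),
   for which E J_N = 0 and E J_N^2 is bounded in N, while the error made has expectation tending to 0 if n(N)
   grows fast enough.  Hence J_N is uniformly integrable and the left-hand side has mean zero; finally
   E |M(t)|^2 = t sum_j |psi_j|^2 = t C_Phi. *)
Require Import Defs.
From HB Require Import structures.
From mathcomp Require Import all_boot all_order all_algebra.
From mathcomp Require Import all_classical all_reals all_analysis.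
From mathcomp Require Import complex measurable_realfun ring lra.

Set Implicit Arguments.
Unset Strict Implicit.
Unset Printing Implicit Defensive.
Import Order.TTheory GRing.Theory Num.Theory.
Import numFieldNormedType.Exports.

Local Open Scope classical_set_scope.
Local Open Scope ring_scope.

(** * One-variable calculus on the real line *)

Section Calculus.
Context {R : realType}.
Implicit Types f g F G : R -> R.

(** Ito's formula is never invoked: subtracting [|M|^2] removes the quadratic variation. Indeed
    [|u|^2 - |M|^2 = |Y|^2 + 2 <Y, M>], whose increment is exactly [2 <Y(t1), M(t2) - M(t1)>] plus a
    pairing with [Y(t2) - Y(t1)], and [Y] is Lipschitz in time for the sup norm. In that pairing
    regularity is the obstacle. It is met by writing [<f, v>] as [1/L] times the integral of
    [f (v - v_xx)], so that [f] enters through its values only; sup bounds on the increments of [Y]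
    and C^2 bounds on [u] and [M] then suffice, and [s > 5/2] is the condition for H^s to embed into
    C^2. The pathwise error vanishes almost surely, without a rate and without an integrable bound,
    while the hypotheses give only second moments of [u]; hence the limit is taken after truncation,
    with the mode error treated apart because it is controlled in mean. The process [M] is known
    only as an adapted limit of finite mode sums. Moments are therefore computed on finite sums of
    Brownian increments, and the pairings of [u] and [M] with fixed functions are shown adapted
    through lower semicontinuity on H^s. *)

Definition der F f : Prop := forall x : R, is_derive x 1 F (f x).
Definition cts f : Prop := forall x : R, {for x, continuous f}.

Lemma der_cts F f : der F f -> cts F.
Proof.
by move=> dF x; apply: differentiable_continuous; apply/derivable1_diffP; apply: ex_derive.
Qed.

Lemma der_eq F f g : der F f -> f =1 g -> der F g.
Proof. by move=> dF fg x; rewrite -fg. Qed.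

Lemma der_cst c : der (fun=> c) (fun=> 0).
Proof. by move=> x; apply: is_derive_cst. Qed.

Lemma der_id : der (fun x => x) (fun=> 1).
Proof. by move=> x; apply: is_derive_id. Qed.

Lemma der_add F G f g : der F f -> der G g -> der (fun x => F x + G x) (fun x => f x + g x).
Proof. by move=> dF dG x; apply: is_deriveD. Qed.

Lemma der_opp F f : der F f -> der (fun x => - F x) (fun x => - f x).
Proof. by move=> dF x; apply: is_deriveN. Qed.

Lemma der_mul F G f g : der F f -> der G g ->
  der (fun x => F x * G x) (fun x => f x * G x + F x * g x).
Proof.
move=> dF dG x.
have -> : f x * G x + F x * g x = F x *: g x + G x *: f x by rewrite /GRing.scale /=; ring.
exact: is_deriveM.
Qed.

Lemma der_exp F f n : der F f -> der (fun x => F x ^+ n.+1) (fun x => n.+1%:R * F x ^+ n * f x).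
Proof.
move=> dF; elim: n => [|n ih].
  by apply: (der_eq dF) => x; rewrite expr0 !mul1r.
have h := der_mul dF ih.
have -> : (fun x => F x ^+ n.+2) = (fun x => F x * F x ^+ n.+1) by apply/funext => x; rewrite exprS.
apply: (der_eq h) => x; rewrite -[n.+2]addn1 natrD exprS; ring.
Qed.

Lemma der_comp F f G g : der F f -> der G g -> der (fun x => F (G x)) (fun x => f (G x) * g x).
Proof.
move=> dF dG x; have h := @is_derive1_comp _ F G x _ _ (dF (G x)) (dG x).
by apply: h.
Qed.

Lemma der_sin : der sin (fun x => cos x :> R).
Proof. by move=> x; apply: is_derive_sin. Qed.

Lemma der_cos : der cos (fun x => - sin x :> R).
Proof. by move=> x; apply: is_derive_cos. Qed.

Lemma der_expR : der expR (fun x => expR x :> R).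
Proof. by move=> x; apply: is_derive_expR. Qed.

Lemma der_unique F f g : der F f -> der F g -> f =1 g.
Proof.
move=> dF dG x; rewrite -(@derive_val _ _ _ x 1 F (f x) (dF x)).
by rewrite (@derive_val _ _ _ x 1 F (g x) (dG x)).
Qed.

Lemma der_derive1 F f : der F f -> (F^`())%classic = f.
Proof. by move=> dF; apply/funext => x; rewrite derive1E; apply: derive_val. Qed.

Lemma der_derivable F f x : der F f -> derivable F x 1.
Proof. by move=> dF; apply: ex_derive. Qed.

Lemma derivable_der F : (forall x, derivable F x 1) -> der F (F^`())%classic.
Proof. by move=> dF x; rewrite derive1E; apply: DeriveDef. Qed.

Lemma mvt F f x y : der F f -> x < y -> exists2 z, x < z < y & F y - F x = f z * (y - x).
Proof.
move=> dF xy; have [||z zxy ->] := @MVT R F f x y xy.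
- by move=> z _; apply: dF.
- apply: continuous_subspaceT => z; exact: (der_cts dF).
- by exists z; rewrite ?in_itv/= in zxy.
Qed.

Lemma der_lip F f K x y : der F f -> x <= y ->
  (forall z, x <= z <= y -> `|f z| <= K) -> `|F y - F x| <= K * (y - x).
Proof.
rewrite le_eqVlt => dF /predU1P[-> fK|xy fK]; first by rewrite !subrr normr0 mulr0.
have [z /andP[xz zy] ->] := mvt dF xy.
have xy0 : 0 <= y - x by rewrite subr_ge0 ltW.
by rewrite normrM [`|y - x|]ger0_norm// ler_wpM2r// fK// !ltW.
Qed.

Lemma der0_cst F x y : der F (fun=> 0) -> F x = F y.
Proof.
move=> dF; wlog xy : x y / x <= y.
  by move=> h; have [/h//|/ltW/h->] := leP x y.
apply/eqP; rewrite eq_sym -subr_eq0 -normr_le0.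
by rewrite (le_trans (@der_lip _ _ 0 _ _ dF xy _)) ?mul0r// => z _; rewrite normr0.
Qed.

Lemma der_ndecr F f x y : der F f -> x <= y ->
  (forall z, x <= z <= y -> 0 <= f z) -> F x <= F y.
Proof.
rewrite le_eqVlt => dF /predU1P[->//|xy f0].
have [z /andP[xz zy] e] := mvt dF xy.
by rewrite -subr_ge0 e mulr_ge0 ?subr_ge0 ?f0 ?ltW// xz ltW.
Qed.

Lemma cts_cst c : cts (fun=> c).
Proof. by move=> x; apply: cst_continuous. Qed.
Lemma cts_id : cts (fun x => x).
Proof. by move=> x; apply: cvg_id. Qed.
Lemma cts_add f g : cts f -> cts g -> cts (fun x => f x + g x).
Proof. by move=> cf cg x; apply: cvgD; [apply: cf|apply: cg]. Qed.
Lemma cts_opp f : cts f -> cts (fun x => - f x).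
Proof. by move=> cf x; apply: cvgN; apply: cf. Qed.
Lemma cts_mul f g : cts f -> cts g -> cts (fun x => f x * g x).
Proof. by move=> cf cg x; apply: cvgM; [apply: cf|apply: cg]. Qed.
Lemma cts_exp f n : cts f -> cts (fun x => f x ^+ n).
Proof.
move=> cf; elim: n => [|n ih].
  have -> : (fun x => f x ^+ 0) = (fun=> 1) by apply/funext => x; rewrite expr0.
  exact: cts_cst.
have -> : (fun x => f x ^+ n.+1) = (fun x => f x * f x ^+ n) by apply/funext => x; rewrite exprS.
exact: cts_mul.
Qed.

Lemma cts_within f x y : cts f -> {within `[x, y], continuous f}.
Proof. by move=> cf; apply: continuous_subspaceT => z; apply: cf. Qed.

Lemma cts_P f : cts f <-> forall x e, 0 < e -> exists2 d, 0 < d &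
  forall y, `|x - y| < d -> `|f x - f y| < e.
Proof.
split=> [cf x e e0|h x].
  have /cvgrPdist_lt/(_ e e0) := cf x.
  by rewrite -nbhs_nearE => /nbhs_ballP[d/= d0 hd]; exists d.
apply/cvgrPdist_lt => e e0; have [d d0 hd] := h x e e0.
by rewrite -nbhs_nearE; apply/nbhs_ballP; exists d.
Qed.

Lemma cts_bounded f x y : cts f -> exists2 K, 0 < K & forall z, x <= z <= y -> `|f z| <= K.
Proof.
move=> cf; have := continuous_compact (cts_within cf) (@segment_compact R x y).
move=> /compact_bounded[M [_ hM]]; exists (`|M| + 1); first by rewrite ltr_wpDl.
move=> z xzy; apply: (hM (`|M| + 1)).
  by rewrite (le_lt_trans (ler_norm M))// ltrDl.
by exists z => //=; rewrite in_itv.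
Qed.

Definition RI x y f : R := \int[@lebesgue_measure R]_(z in `[x, y]) f z.

Lemma cts_integrable f x y : cts f ->
  (@lebesgue_measure R).-integrable `[x, y] (EFin \o f).
Proof.
move=> cf; apply: continuous_compact_integrable; first exact: segment_compact.
exact: cts_within.
Qed.

Lemma RI_chasles f x y z : cts f -> x <= y -> y <= z -> RI x z f = RI x y f + RI y z f.
Proof.
move=> cf xy yz.
have h := @Rintegral_itvB R f (BLeft x) (BRight z) y (cts_integrable _ _ cf).
rewrite /RI -(@Rintegral_itv_obnd_cbnd _ y).
  by rewrite -h ?bnd_simp// addrC subrK.
by apply: integrableS (cts_integrable y z cf) => //; apply: subset_itvr; rewrite bnd_simp.
Qed.

(** The integral from 0, with a sign for negative arguments, agrees near [x], up to a constant, with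
    an integral from a base point [c] to the left of both [x] and 0; there the fundamental theorem
    of calculus applies. *)
Lemma cts_primitive f : cts f -> exists F, der F f.
Proof.
move=> cf; pose F x := if 0 <= x then RI 0 x f else - RI x 0 f.
exists F => x; pose c := Num.min x 0 - 1.
have cx : c < x by rewrite /c; have : Num.min x 0 <= x by [rewrite ge_min lexx]; lra.
have c0 : c < 0 by rewrite /c; have : Num.min x 0 <= 0 by [rewrite ge_min lexx orbT]; lra.
have FE y : c < y -> F y = RI c y f - RI c 0 f.
  move=> cy; rewrite /F; case: ifPn => y0.
    by rewrite (@RI_chasles f c 0 y) ?(ltW c0)// addrC addKr.
  rewrite -ltNge in y0; rewrite (@RI_chasles f c y 0) ?ltW//; ring.
have xx1 : x < x + 1 by rewrite ltrDl.
have [dG GE] := continuous_FTC1_closed xx1 (cts_integrable c (x + 1) cf) cx (cf x).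
apply: (near_eq_is_derive (f := fun y => RI c y f - RI c 0 f)).
  near=> y; rewrite FE//; near: y; exact: lt_nbhsr.
rewrite -[f x]subr0; apply: is_deriveB.
by rewrite -GE derive1E; apply: DeriveDef.
Unshelve. all: by end_near.
Qed.

Lemma RI_FTC F f x y : x <= y -> der F f -> cts f -> RI x y f = F y - F x.
Proof.
rewrite le_eqVlt => /predU1P[->|xy] dF cf.
  by rewrite /RI set_itv1 Rintegral_set1 subrr.
rewrite /RI /Rintegral (@continuous_FTC2 _ f F)//.
- exact: cts_within.
- split.
  + by move=> z _; apply: der_derivable dF.
  + by apply: cvg_at_right_filter; apply: der_cts dF _.
  + by apply: cvg_at_left_filter; apply: der_cts dF _.
- by move=> z _; rewrite (der_derive1 dF).
Qed.

Lemma RI_lin x y c f g : x <= y -> cts f -> cts g ->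
  RI x y (fun z => c * f z + g z) = c * RI x y f + RI x y g.
Proof.
move=> xy cf cg; have [F dF] := cts_primitive cf; have [G dG] := cts_primitive cg.
rewrite (RI_FTC xy dF cf) (RI_FTC xy dG cg).
rewrite (@RI_FTC (fun z => c * F z + G z)); [ring|by []| |].
  apply: der_eq (der_add (der_mul (der_cst c) dF) dG) _ => z; ring.
by apply: cts_add => //; apply: cts_mul => //; apply: cts_cst.
Qed.

Lemma RI_scale x y c f : x <= y -> cts f -> RI x y (fun z => c * f z) = c * RI x y f.
Proof.
move=> xy cf; have h0 : RI x y (fun=> 0) = 0.
  by rewrite (RI_FTC xy (der_cst 0) (@cts_cst 0)) subrr.
rewrite -[RHS]addr0 -h0 -RI_lin//; last exact: cts_cst.
by congr RI; apply/funext => z; rewrite addr0.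
Qed.

Lemma RI_add x y f g : x <= y -> cts f -> cts g ->
  RI x y (fun z => f z + g z) = RI x y f + RI x y g.
Proof.
move=> xy cf cg; rewrite -[RI x y f]mul1r -RI_lin//.
by congr RI; apply/funext => z; rewrite mul1r.
Qed.

Lemma RI_cst x y c : x <= y -> RI x y (fun=> c) = c * (y - x).
Proof.
move=> xy; rewrite (@RI_FTC (fun z => c * z)) //; first by rewrite mulrBr.
  apply: der_eq (der_mul (der_cst c) der_id) _ => z; ring.
exact: cts_cst.
Qed.

Lemma RI_sub x y f g : x <= y -> cts f -> cts g ->
  RI x y (fun z => f z - g z) = RI x y f - RI x y g.
Proof.
move=> xy cf cg; rewrite -mulN1r addrC -RI_lin//.
by congr RI; apply/funext => z; rewrite mulN1r addrC.
Qed.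

Lemma RI_le x y f g : x <= y -> cts f -> cts g ->
  (forall z, x <= z <= y -> f z <= g z) -> RI x y f <= RI x y g.
Proof.
move=> xy cf cg fg; apply: le_Rintegral; [by []|exact: cts_integrable|exact: cts_integrable|].
by move=> z; rewrite /= in_itv/=; apply: fg.

Qed.

Lemma RI_bound x y f K : x <= y -> cts f ->
  (forall z, x <= z <= y -> `|f z| <= K) -> `|RI x y f| <= K * (y - x).
Proof.
move=> xy cf fK; have [F dF] := cts_primitive cf.
by rewrite (RI_FTC xy dF cf); apply: der_lip dF xy fK.
Qed.

(** A primitive is nondecreasing with equal values at both ends; a point where [f] is positive would
    make it increase strictly nearby. *)
Lemma RI_ge0_eq0 x y f : x < y -> cts f -> (forall z, x <= z <= y -> 0 <= f z) ->
  RI x y f = 0 -> forall z, x <= z <= y -> f z = 0.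
Proof.
move=> xy cf f0; have [F dF] := cts_primitive cf.
rewrite (RI_FTC (ltW xy) dF cf) => /eqP; rewrite subr_eq0 => /eqP Fyx z /andP[xz zy].
apply: contrapT => /eqP fz.
have fz0 : 0 < f z by rewrite lt_def fz f0// xz.
have [d d0 hd] := (cts_P f).1 cf z (f z) fz0.
(* The window around [z] is clipped to [[x, y]], since [z] may be an endpoint. *)
pose u := Num.max x (z - d / 2); pose v := Num.min y (z + d / 2).
have uv : u < v.
  by rewrite /u /v lt_min !gt_max xy/=; apply/andP; split; [|apply/andP; split]; lra.
have [w /andP[uw wv] e] := mvt dF uv.
have [ux uz] : x <= u /\ z - d / 2 <= u by split; rewrite /u le_max lexx ?orbT.
have [vy vz] : v <= y /\ v <= z + d / 2 by split; rewrite /v ge_min lexx ?orbT.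
have fw : 0 < f w.
  have zw : `|z - w| < d by rewrite ltr_norml; apply/andP; split; lra.
  by have := hd w zw; rewrite ltr_norml => /andP[h1 h2]; lra.
have h1 : F x <= F u.
  by apply: (der_ndecr dF ux) => t /andP[xt tu]; apply: f0; rewrite xt/=; lra.
have h2 : F v <= F y.
  by apply: (der_ndecr dF vy) => t /andP[vt ty]; apply: f0; rewrite ty andbT; lra.
have : 0 < f w * (v - u) by rewrite mulr_gt0// subr_gt0.
by rewrite -e; lra.
Qed.
End Calculus.

(* Unification is prohibitively slow when it unfolds these predicates. *)
#[global] Opaque der cts.
Ltac der_step := first [ eassumption | exact: der_cst | exact: der_id | exact: der_sin
  | exact: der_cos | exact: der_expR | apply: der_add | apply: der_opp | apply: der_mul
  | apply: der_exp ].
Ltac der_auto := apply: der_eq; [repeat der_step | let t := fresh "t" in intro t; simpl].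
Ltac cts_auto := repeat lazymatch goal with
  | |- cts (fun _ => ?c) => exact (@cts_cst _ c)
  | |- cts (fun x => x) => exact (@cts_id _)
  | |- cts (fun x => - @?f x) => apply (@cts_opp _ f)
  | |- cts (fun x => @?f x + @?g x) => apply (@cts_add _ f g)
  | |- cts (fun x => @?f x * @?g x) => apply (@cts_mul _ f g)
  | |- cts (fun x => @?f x ^+ ?n) => apply (@cts_exp _ f n)
  | |- cts (fun x => ?f x) => change (cts f)
  | H : cts ?f |- cts ?f => exact H
  | H : der ?f _ |- cts ?f => exact (der_cts H)
  end.

(** * Periodic functions, the operator [Lam] and the drift *)

Section PeriodicCalculus.
Context {R : realType}.
Variables a b : R.
Hypothesis hab : a < b.
Implicit Types f g h v w : R -> R.

Local Notation L := (b - a).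
Local Notation periodic := (Defs.periodic a b).
Local Notation Lam := (Lam a b).

Lemma periodic_int f (n : int) x : periodic f -> f (x + n%:~R * L) = f x.
Proof.
move=> pf; have pn (m : nat) y : f (y + m%:R * L) = f y.
  elim: m y => [|m ih] y; first by rewrite mul0r addr0.
  by rewrite -[in LHS]addn1 natrD mulrDl mul1r addrA -[_ + (b - a)]/(_ + period a b) pf.
case: n => m; first exact: pn.
have e : (- m.+1%:Z)%:~R = - m.+1%:R :> R by rewrite mulrNz.
by rewrite NegzE -[LHS](pn m.+1) e mulNr subrK.
Qed.

Lemma periodic_reduce x : exists2 n : int, a <= x + n%:~R * L <= b & True.
Proof.
have L0 : 0 < L by rewrite subr_gt0.
pose m := Num.floor ((x - a) / L); exists (- m) => //.
have h1 : m%:~R <= (x - a) / L := Num.Theory.floor_le_tmp _.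
have h2 : (x - a) / L < (m + 1)%:~R := Num.Theory.floorD1_gt _.
move: h1 h2; rewrite ler_pdivlMr// ltr_pdivrMr// intrD mulrDl mul1r => h1 h2.
by rewrite mulrNz mulNr; apply/andP; split; lra.
Qed.

Lemma periodic_bound f K : periodic f -> (forall x, a <= x <= b -> f x <= K) ->
  forall x, f x <= K.
Proof.
by move=> pf fK x; have [n hn _] := periodic_reduce x; rewrite -(periodic_int n x pf) fK.
Qed.

Lemma der_periodic f f1 : periodic f -> der f f1 -> periodic f1.
Proof.
move=> pf df; have dL : der (fun x => f (x + period a b)) (fun x => f1 (x + period a b)).
  have dx : der (fun x => x + period a b) (fun=> 1) by der_auto; rewrite addr0.
  by apply: der_eq (der_comp df dx) _ => x; rewrite mulr1.
have e : (fun x => f (x + period a b)) = f by apply/funext => x; rewrite pf.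
by rewrite e in dL; move=> x; apply: (esym (der_unique df dL x)).
Qed.

(** Periodicity makes a maximum over [[a, b]] global, so the derivative vanishes there even when it
    is attained at an endpoint. *)
Lemma der_max h h1 : periodic h -> der h h1 ->
  exists2 x, h1 x = 0 & forall y, h y <= h x.
Proof.
move=> ph dh; have [c] := EVT_max (ltW hab) (cts_within (der_cts dh)).
rewrite in_itv/= => cab hc.
have hc' : forall y, h y <= h c.
  by apply: periodic_bound => // x xab; apply: hc; rewrite in_itv.
exists c => //.
have cI : c \in `]c - 1, c + 1[ by rewrite in_itv/=; apply/andP; split; lra.
have ltc : c - 1 <= c + 1 by lra.
have := @derive1_at_max R h (c - 1) (c + 1) c ltc _ cI _.
move=> /(_ (fun t _ => @der_derivable R h h1 t dh) (fun t _ => hc' t)) d0.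
by rewrite -(@derive_val _ _ _ c 1 h (h1 c) (dh c)); apply: derive_val.
Qed.

(* At a maximum of [h] the derivative vanishes and the equation gives the value of [h]. *)
Lemma ode_bound (e : R) h f K : (e == 1) || (e == -1) -> periodic h ->
  der h (fun x => e * (h x - f x)) -> (forall x, `|f x| <= K) -> forall x, `|h x| <= K.
Proof.
move=> he ph dh fK.
have e0 : e != 0 by case/orP: he => /eqP->; rewrite ?oppr_eq0 oner_eq0.
have up g k : periodic g -> der g (fun x => e * (g x - k x)) ->
    (forall x, k x <= K) -> forall x, g x <= K.
  move=> pg dg kK x; have [c e1 gc] := der_max pg dg.
  move/eqP: e1; rewrite mulf_eq0 (negbTE e0)/= subr_eq0 => /eqP gk.
  by rewrite (le_trans (gc x))// gk.
move=> x; rewrite ler_norml; apply/andP; split.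
  rewrite lerNl; apply: (up (fun x => - h x) (fun x => - f x)).
  - by move=> y; rewrite ph.
  - by der_auto; ring.
  - by move=> y; have := fK y; rewrite ler_norml => /andP[]; lra.
apply: (up h f) => // y; have := fK y; rewrite ler_norml => /andP[]; lra.
Qed.

(** Variation of constants: a primitive [P] plus a constant, times [expR (e * x)], the constant
    being dictated by periodicity. *)
Lemma ode_exists (e : R) f : (e == 1) || (e == -1) -> cts f -> periodic f ->
  exists2 h, periodic h & der h (fun x => e * (h x - f x)).
Proof.
move=> he cf pf.
have e0 : e != 0 by case/orP: he => /eqP->; rewrite ?oppr_eq0 oner_eq0.
have dE (c : R) : der (fun x : R => expR (c * x)) (fun x => c * expR (c * x)).
  have dc : der (fun x : R => c * x) (fun=> c) by der_auto; rewrite mul0r mulr1 add0r.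
  by apply: der_eq (der_comp der_expR dc) _ => x; rewrite mulrC.
have [P dP] : exists P, der P (fun x => expR (- e * x) * (- e * f x)).
  by apply: cts_primitive; have cE := der_cts (dE (- e)); cts_auto.
pose ea := expR (e * a); pose eb := expR (e * b).
have eab : ea - eb != 0.
  rewrite subr_eq0; apply/eqP => /expR_inj /(mulfI e0) ab.
  by move: hab; rewrite ab ltxx.
(* The only value with [h b = h a]; the denominator is nonzero because [e] is nonzero and
   [a < b]. *)
pose c := (eb * P b - ea * P a) / (ea - eb).
pose h x := expR (e * x) * (c + P x).
have dh : der h (fun x => e * (h x - f x)).
  apply: der_eq (der_mul (dE e) (der_add (der_cst c) dP)) _ => x.
  have -> : expR (- e * x) = (expR (e * x))^-1 by rewrite mulNr expRN.
  have := expR_gt0 (e * x); rewrite /h; move: (expR _) => y y0; field; lra.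
exists h => // x.
(* A translate by one period solves the same equation, so the difference is a multiple of the
   exponential. [D] is that multiple, and it vanishes at [a]. *)
pose D y := expR (- e * y) * (h (y + period a b) - h y).
have dD : der D (fun=> 0).
  have dL : der (fun x => h (x + period a b)) (fun x => e * (h (x + period a b) - f x)).
    have dx : der (fun x => x + period a b) (fun=> 1) by der_auto; rewrite addr0.
    by apply: der_eq (der_comp dh dx) _ => y; rewrite mulr1 pf.
  apply: der_eq (der_mul (dE (- e)) (der_add dL (der_opp dh))) _ => y; ring.
have : D x = 0.
  have ab : a + period a b = b by rewrite /period; ring.
  rewrite (der0_cst x a dD) /D ab /h -/ea -/eb.
  have -> : eb * (c + P b) - ea * (c + P a) = 0.
    rewrite /c; move: eab; set u := ea - eb => u0.
    have -> : eb = ea - u by rewrite /u; ring.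
    by field.
  by rewrite mulr0.
move/eqP; rewrite mulf_eq0 gt_eqF ?expR_gt0//= subr_eq0 => /eqP.
by [].
Qed.

(* [1 - d_x^2 = (1 - d_x) (1 + d_x)], so two periodic first-order equations suffice. *)
Lemma Lam_exists f : cts f -> periodic f ->
  exists g g1, [/\ periodic g, der g g1 & der g1 (fun x => g x - f x)].
Proof.
move=> cf pf; have he : ((1 : R) == 1) || ((1 : R) == -1) by rewrite eqxx.
have he' : ((-1 : R) == 1) || ((-1 : R) == -1) by rewrite eqxx orbT.
have [h ph dh] := ode_exists he cf pf.
have [g pg dg] := ode_exists he' (der_cts dh) ph.
exists g, (fun x => -1 * (g x - h x)); split => //.
by apply: der_eq (der_mul (der_cst (-1)) (der_add dg (der_opp dh))) _ => x; ring.
Qed.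

(** With [h = g + g1] the equation splits into [h' = h - f] and [g' = - (g - h)]; the first-order
    maximum principle applies to each and loses no constant. *)
Lemma elliptic_bound g g1 f K : periodic g -> der g g1 -> der g1 (fun x => g x - f x) ->
  (forall x, `|f x| <= K) -> forall x, `|g x| <= K.
Proof.
move=> pg dg dg1 fK.
have he : ((1 : R) == 1) || ((1 : R) == -1) by rewrite eqxx.
have he' : ((-1 : R) == 1) || ((-1 : R) == -1) by rewrite eqxx orbT.
have pg1 := der_periodic pg dg.
have hK : forall x, `|g x + g1 x| <= K.
  apply: (ode_bound he (f := f)) => //; first by move=> x; rewrite pg pg1.
  by der_auto; ring.
apply: (ode_bound he' pg _ hK).
by apply: der_eq dg _ => x; ring.
Qed.

(** Two solutions differ by a solution with zero right-hand side, which [elliptic_bound] forces to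
    vanish. The default value of [xget] is excluded because [g] is itself a witness. *)
Lemma Lam_eq f g g1 : periodic g -> der g g1 -> der g1 (fun x => g x - f x) -> Lam f = g.
Proof.
move=> pg dg dg1; rewrite /Defs.Lam; case: xgetP => [k _ [pk dk dk1 ke]|/(_ g)[]]; last first.
  split => //; first by move=> x; apply: der_derivable dg.
    by rewrite (der_derive1 dg) => x; apply: der_derivable dg1.
  by rewrite (der_derive1 dg) (der_derive1 dg1) => x; ring.
have {}dk := derivable_der dk; have {}dk1 := derivable_der dk1.
set k1 := (k^`())%classic in dk dk1 ke *.
set k2 := (k1^`())%classic in dk1 ke *.
apply/funext => x; apply/eqP; rewrite -subr_eq0 -normr_le0.
apply: (@elliptic_bound (fun y => k y - g y) (fun y => k1 y - g1 y) (fun=> 0) 0).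
- by move=> y; rewrite pk pg.
- by der_auto; ring.
- by der_auto; have := ke t; lra.
- by move=> y; rewrite normr0.
Qed.

Lemma Lam_spec f : cts f -> periodic f ->
  exists g1, [/\ periodic (Lam f), der (Lam f) g1 & der g1 (fun x => Lam f x - f x)].
Proof.
move=> cf pf; have [g [g1 [pg dg dg1]]] := Lam_exists cf pf.
by rewrite (Lam_eq pg dg dg1); exists g1.
Qed.

Lemma Lam_sub_bound f g K : cts f -> periodic f -> cts g -> periodic g ->
  (forall x, `|f x - g x| <= K) -> forall x, `|Lam f x - Lam g x| <= K.
Proof.
move=> cf pf cg pg fgK.
have [F1 [pF dF dF1]] := Lam_spec cf pf; have [G1 [pG dG dG1]] := Lam_spec cg pg.
apply: (@elliptic_bound (fun y => Lam f y - Lam g y) (fun y => F1 y - G1 y)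
  (fun y => f y - g y)) => //.
- by move=> y; rewrite pF pG.
- by der_auto; ring.
- by der_auto; ring.
Qed.

Lemma Lam_bound f K : cts f -> periodic f ->
  (forall x, `|f x| <= K) -> forall x, `|Lam f x| <= K.
Proof.
move=> cf pf fK; have [F1 [pF dF dF1]] := Lam_spec cf pf.
exact: elliptic_bound dF1 fK.
Qed.

Definition C2p f f1 f2 := [/\ periodic f, der f f1, der f1 f2 & cts f2].

Lemma C2p_uniq f f1 f2 g1 g2 : C2p f f1 f2 -> C2p f g1 g2 -> f1 = g1 /\ f2 = g2.
Proof.
move=> [_ d1 d2 _] [_ e1 e2 _].
have e : f1 = g1 by apply/funext/(der_unique d1 e1).
by subst g1; split => //; apply/funext/(der_unique d2 e2).
Qed.

Lemma C2p_lin c f f1 f2 g g1 g2 : C2p f f1 f2 -> C2p g g1 g2 ->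
  C2p (fun x => c * f x + g x) (fun x => c * f1 x + g1 x) (fun x => c * f2 x + g2 x).
Proof.
move=> [pf df df1 cf2] [pg dg dg1 cg2]; split.
- by move=> x; rewrite pf pg.
- by der_auto; ring.
- by der_auto; ring.
- cts_auto.
Qed.

(** The expanded form of [d_x (v^2 + v_x^2 / 2)], the argument of [Lam] in the drift. *)
Definition drift_source v v1 v2 : R -> R := fun x => 2 * (v x * v1 x) + v1 x * v2 x.

Lemma drift_source_cts v v1 v2 : C2p v v1 v2 -> cts (drift_source v v1 v2).
Proof. by move=> [_ dv dv1 cv2]; rewrite /drift_source; cts_auto. Qed.

Lemma drift_source_periodic v v1 v2 : C2p v v1 v2 -> periodic (drift_source v v1 v2).
Proof.
move=> [pv dv dv1 cv2] x; have pv1 := der_periodic pv dv; have pv2 := der_periodic pv1 dv1.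
by rewrite /drift_source pv pv1 pv2.
Qed.

Lemma drift_eq v v1 v2 : C2p v v1 v2 ->
  drift a b v = fun x => - (v x * v1 x) - Lam (drift_source v v1 v2) x.
Proof.
move=> [pv dv dv1 cv2]; rewrite /drift (der_derive1 dv).
have -> : ((fun y => v y ^+ 2 + 2^-1 * v1 y ^+ 2)^`())%classic = drift_source v v1 v2.
  by apply: der_derive1; der_auto; rewrite /drift_source; field.
by [].
Qed.

Lemma drift_cts v v1 v2 : C2p v v1 v2 -> cts (drift a b v).
Proof.
move=> C2v; rewrite (drift_eq C2v).
have [g1 [_ dg _]] := Lam_spec (drift_source_cts C2v) (drift_source_periodic C2v).
by case: C2v => [_ dv dv1 _]; cts_auto.
Qed.

(** With [g] the image of the source under [Lam], the integrand is the derivative of the periodic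
    function [g v1 - g1 v - v^3]. By parts, the integral is [L <drift v, v>] for the inner product
    of H^1, so this is the conservation of energy by the deterministic flow. *)
Lemma drift_energy v v1 v2 : C2p v v1 v2 -> RI a b (fun x => drift a b v x * (v x - v2 x)) = 0.
Proof.
move=> C2v; have cd := drift_cts C2v; rewrite (drift_eq C2v) in cd *.
have [g1 [pg dg dg1]] := Lam_spec (drift_source_cts C2v) (drift_source_periodic C2v).
set g := Lam _ in pg dg dg1 cd *; case: C2v => [pv dv dv1 cv2].
have pg1 := der_periodic pg dg; have pv1 := der_periodic pv dv.
rewrite (@RI_FTC _ (fun x => g x * v1 x - g1 x * v x - v x ^+ 3)) ?(ltW hab)//.
- have per f : periodic f -> f b = f a.
    by move=> pf; rewrite -(pf a) /period addrC subrK.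
  by rewrite (per _ pg) (per _ pg1) (per _ pv) (per _ pv1) subrr.
- by der_auto; rewrite /drift_source; ring.
- by apply: cts_mul => //; cts_auto.
Qed.

(** Each difference of products costs [2 K d]: one from [v v1], and [2 + 1] from the source, which
    [Lam] does not enlarge. The product [v1 * v2] in the source is what requires closeness of second
    derivatives. *)
Lemma drift_lip v v1 v2 w w1 w2 K d : C2p v v1 v2 -> C2p w w1 w2 ->
  (forall x, [/\ `|v x| <= K, `|v1 x| <= K & `|v2 x| <= K]) ->
  (forall x, [/\ `|w x| <= K, `|w1 x| <= K & `|w2 x| <= K]) ->
  (forall x, [/\ `|v x - w x| <= d, `|v1 x - w1 x| <= d & `|v2 x - w2 x| <= d]) ->
  forall x, `|drift a b v x - drift a b w x| <= 8 * K * d.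
Proof.
move=> Cv Cw bv bw bd.
have pr p q r t : `|p| <= K -> `|t| <= K -> `|p - r| <= d -> `|q - t| <= d ->
    `|p * q - r * t| <= 2 * K * d.
  move=> hp ht hpr hqt; have -> : p * q - r * t = p * (q - t) + (p - r) * t by ring.
  rewrite (le_trans (ler_normD _ _))// !normrM.
  have := ler_pM (normr_ge0 _) (normr_ge0 _) hp hqt.
  have := ler_pM (normr_ge0 _) (normr_ge0 _) hpr ht; lra.
have hLam : forall x, `|Lam (drift_source v v1 v2) x - Lam (drift_source w w1 w2) x| <= 6 * K * d.
  apply: Lam_sub_bound; [exact: drift_source_cts|exact: drift_source_periodic|
    exact: drift_source_cts|exact: drift_source_periodic|move=> x].
  have [v0 v1' v2'] := bv x; have [w0 w1' w2'] := bw x; have [d0 d1 d2] := bd x.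
  have h1 := pr _ _ _ _ v0 w1' d0 d1; have h2 := pr _ _ _ _ v1' w2' d1 d2.
  rewrite /drift_source.
  have -> : 2 * (v x * v1 x) + v1 x * v2 x - (2 * (w x * w1 x) + w1 x * w2 x) =
    2 * (v x * v1 x - w x * w1 x) + (v1 x * v2 x - w1 x * w2 x) by ring.
  rewrite (le_trans (ler_normD _ _))// normrM ger0_norm//; lra.
move=> x; rewrite (drift_eq Cv) (drift_eq Cw).
have [v0 v1' v2'] := bv x; have [w0 w1' w2'] := bw x; have [d0 d1 d2] := bd x.
have h1 := pr _ _ _ _ v0 w1' d0 d1.
have h2 := hLam x.
have E p q l l' : - p - l - (- q - l') = - (p - q) - (l - l') :> R by ring.
rewrite E (le_trans (ler_normB _ _))// normrN; lra.
Qed.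

Lemma drift_bound v v1 v2 K : C2p v v1 v2 ->
  (forall x, [/\ `|v x| <= K, `|v1 x| <= K & `|v2 x| <= K]) ->
  forall x, `|drift a b v x| <= 4 * K ^+ 2.
Proof.
move=> Cv bv.
have pr p q : `|p| <= K -> `|q| <= K -> `|p * q| <= K ^+ 2.
  by move=> hp hq; rewrite normrM expr2 ler_pM.
have hLam : forall x, `|Lam (drift_source v v1 v2) x| <= 3 * K ^+ 2.
  apply: Lam_bound; [exact: drift_source_cts|exact: drift_source_periodic|move=> x].
  have [v0 v1' v2'] := bv x; have h1 := pr _ _ v0 v1'; have h2 := pr _ _ v1' v2'.
  rewrite /drift_source (le_trans (ler_normD _ _))// [`|2 * _|]normrM ger0_norm//; lra.
move=> x; rewrite (drift_eq Cv); have [v0 v1' v2'] := bv x.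
have h1 := pr _ _ v0 v1'; have h2 := hLam x.
rewrite (le_trans (ler_normB _ _))// normrN; lra.
Qed.
End PeriodicCalculus.

(** * Series of functions dominated by a summable sequence *)

Section FunctionSeries.
Context {R : realType}.
Implicit Types (u v : nat -> R -> R) (M : nat -> R).

Definition fser u : R -> R := fun x => limn (series (fun n => u n x)).

Lemma cts_sum u n : (forall k, cts (u k)) -> cts (fun x => \sum_(0 <= k < n) u k x).
Proof.
move=> cu; elim: n => [|n ih].
  by rewrite (_ : (fun x => _) = (fun=> 0)) ?funeqE => [|x]; [exact: cts_cst|rewrite big_geq].
rewrite (_ : (fun x => _) = (fun x => \sum_(0 <= k < n) u k x + u n x)); last first.
  by apply/funext => x; rewrite big_nat_recr.
exact: cts_add.
Qed.

Lemma RI_sum u n x y : x <= y -> (forall k, cts (u k)) ->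
  RI x y (fun z => \sum_(0 <= k < n) u k z) = \sum_(0 <= k < n) RI x y (u k).
Proof.
move=> xy cu; elim: n => [|n ih].
  rewrite big_geq// (_ : (fun x => _) = (fun=> 0)) ?RI_cst ?mul0r// funeqE => z.
  by rewrite big_geq.
rewrite big_nat_recr//= -ih -RI_add//; last exact: cts_sum.
by congr RI; apply/funext => z; rewrite big_nat_recr.
Qed.

Lemma nnseries_real (w : nat -> R) : (forall n, 0 <= w n) ->
  (\sum_(0 <= n <oo) (w n)%:E < +oo)%E ->
  cvgn (series w) /\ (\sum_(0 <= n <oo) (w n)%:E)%E = (limn (series w))%:E.
Proof.
move=> w0 wfin.
have nd : {homo series w : n m / (n <= m)%N >-> n <= m}.
  by apply/nondecreasing_seqP => n; rewrite !seriesEnat/= big_nat_recr//= lerDl.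
have cw : cvgn (series w).
  apply: nondecreasing_is_cvgn => //.
  exists (fine (\sum_(0 <= n <oo) (w n)%:E)%E) => _ [n _ <-].
  rewrite -lee_fin fineK; last first.
    by rewrite ge0_fin_numE// nneseries_ge0// => k _ _; rewrite lee_fin.
  rewrite seriesEnat /= -sumEFin; apply: nneseries_lim_ge => k _ _.
  by rewrite lee_fin.
split => //; rewrite -EFin_lim//; congr (lim (_ @ \oo)).
by apply/funext => n; rewrite /= seriesEnat /= sumEFin.
Qed.

Lemma nnseries_EFin (w : nat -> R) : cvgn (series w) ->
  (\sum_(0 <= n <oo) (w n)%:E)%E = (limn (series w))%:E.
Proof.
move=> cw; rewrite -EFin_lim//; congr (lim (_ @ \oo)).
by apply/funext => n; rewrite /= seriesEnat /= sumEFin.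
Qed.

Section Dominated.
Variables (u : nat -> R -> R) (M : nat -> R).
Hypothesis uM : forall n x, `|u n x| <= M n.
Hypothesis cM : cvgn (series M).

Let M0 n : 0 <= M n. Proof. by rewrite (le_trans _ (uM n 0)). Qed.

Lemma fser_cvg x : series (fun n => u n x) @ \oo --> fser u x.
Proof.
apply: normed_cvg; apply: series_le_cvg cM => [n|n|n]; rewrite ?normr_ge0//.
exact: uM.
Qed.

Lemma fser_tail n x : `|fser u x - series (fun n => u n x) n| <= limn (series M) - series M n.
Proof.
have h1 : (fun m => `|series (fun n => u n x) m - series (fun n => u n x) n|) @ \oo -->
    `|fser u x - series (fun n => u n x) n|.
  by apply: cvg_norm; apply: cvgB; [exact: fser_cvg|exact: cvg_cst].
have h2 : (fun m => series M m - series M n) @ \oo --> limn (series M) - series M n.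
  by apply: cvgB; [exact: cM|exact: cvg_cst].
apply: ler_cvg_to h1 h2 _; near=> m.
have nm : (n <= m)%N by near: m; exact: nbhs_infty_ge.
rewrite !sub_series_geq//.
by rewrite (le_trans (ler_norm_sum _ _ _))// ler_sum.
Unshelve. all: by end_near.
Qed.

Lemma fser_unif e : 0 < e -> exists N, forall n x, (N <= n)%N ->
  `|fser u x - series (fun n => u n x) n| <= e.
Proof.
move=> e0; have /cvgrPdist_le/(_ e e0)[N _ hN] := cM.
exists N => n x Nn; apply: le_trans (fser_tail n x) _.
by apply: le_trans (ler_norm _) _; apply: hN.
Qed.

Lemma fser_bound x : `|fser u x| <= limn (series M).
Proof.
have s0 (f : nat -> R) : series f 0 = 0 by rewrite /series /= big_geq.
by have := fser_tail 0 x; rewrite !s0 !subr0.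
Qed.

Hypothesis cu : forall n, cts (u n).

Lemma cts_series n : cts (fun x => series (fun n => u n x) n).
Proof.
have -> : (fun x => series (fun n => u n x) n) = (fun x => \sum_(0 <= k < n) u k x) by [].
exact: cts_sum.
Qed.

Lemma cts_fser : cts (fser u).
Proof.
apply/cts_P => x e e0; have e3 : 0 < e / 4 by lra.
have [N hN] := fser_unif e3; have [d d0 hd] := (cts_P _).1 (@cts_series N) x _ e3.
exists d => // y xy; have := hd y xy; have := hN N x (leqnn _); have := hN N y (leqnn _).
move: (fser u x) (fser u y) (series _ _) (series _ _) => p q r t.
rewrite !ltr_norml !ler_norml => /andP[a1 a2] /andP[b1 b2] /andP[c1 c2].
by apply/andP; split; lra.
Qed.

Lemma RI_fser x y w : x <= y -> cts w ->
  series (fun n => RI x y (fun z => u n z * w z)) @ \oo --> RI x y (fun z => fser u z * w z).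
Proof.
move=> xy cw; have [K K0 wK] := cts_bounded x y cw.
apply/cvgrPdist_le => e e0.
have h0 : 0 < K * (y - x) + 1 by rewrite ltr_wpDl// mulr_ge0 ?subr_ge0// ltW.
(* The added 1 keeps the denominator positive when [x = y]. *)
pose d := e / (K * (y - x) + 1); have d0 : 0 < d by rewrite divr_gt0.
have [N hN] := fser_unif d0; exists N => // n /= Nn.
have -> : series (fun n => RI x y (fun z => u n z * w z)) n =
    RI x y (fun z => series (fun n => u n z) n * w z).
  rewrite seriesEnat /= -RI_sum//; last by move=> k; apply: cts_mul.
  by congr RI; apply/funext => z; rewrite seriesEnat mulr_suml.
have cs := @cts_series n; have cf := cts_fser.
rewrite -RI_sub//; [|exact: cts_mul|exact: cts_mul].
apply: le_trans (_ : (d * K) * (y - x) <= _).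
  apply: RI_bound => //; first by cts_auto.
  by move=> z zxy; rewrite -mulrBl normrM ler_pM// ?hN// wK.
rewrite -mulrA /d mulrAC ler_pdivrMr// ler_pM2l//; lra.
Qed.

End Dominated.

(** Termwise integration of the derivatives shows that [fser u] and a primitive of [fser v] have the
    same increments, hence differ by a constant. *)
Lemma der_fser u v M M' : (forall n x, `|u n x| <= M n) -> cvgn (series M) ->
  (forall n x, `|v n x| <= M' n) -> cvgn (series M') ->
  (forall n, der (u n) (v n)) -> (forall n, cts (v n)) ->
  der (fser u) (fser v).
Proof.
move=> uM cM vM cM' duv cv; have cf := cts_fser vM cM' cv.
have [P dP] := cts_primitive cf.
have key x y : x <= y -> fser u y - fser u x = P y - P x.
  move=> xy; have h := RI_fser vM cM' cv xy (@cts_cst R 1).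
  have e1 : (fun n => RI x y (fun z => v n z * 1)) = (fun n => u n y - u n x).
    apply/funext => n; rewrite -(RI_FTC xy (duv n) (cv n)).
    by congr RI; apply/funext => z; rewrite mulr1.
  have e2 : RI x y (fun z => fser v z * 1) = P y - P x.
    by rewrite -(RI_FTC xy dP cf); congr RI; apply/funext => z; rewrite mulr1.
  rewrite e1 e2 in h.
  have h' : series (fun n => u n y - u n x) @ \oo --> fser u y - fser u x.
    rewrite (_ : series _ = (fun n => series (fun n => u n y) n - series (fun n => u n x) n)).
      by apply: cvgB; exact: fser_cvg uM cM _.
    by apply/funext => n; rewrite !seriesEnat /= sumrB.
  exact: cvg_unique h' h.
have -> : fser u = (fun x => P x + (fser u 0 - P 0)).
  apply/funext => x; have [x0|/ltW x0] := leP 0 x; have := key _ _ x0; lra.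
by der_auto; rewrite addr0.
Qed.

Lemma cvg_series_lin c (f g : nat -> R) (l m : R) : series f @ \oo --> l -> series g @ \oo --> m ->
  series (fun n => c * f n + g n) @ \oo --> c * l + m.
Proof.
move=> cf cg; rewrite (_ : series _ = (fun n => c * series f n + series g n)); last first.
  by apply/funext => n; rewrite !seriesEnat /= big_split/= mulr_sumr.
by apply: cvgD => //; apply: cvgM => //; apply: cvg_cst.
Qed.
End FunctionSeries.

(** * The trigonometric system and the uniqueness of Fourier coefficients *)

Section Fourier.
Context {R : realType}.
Variables a b : R.
Hypothesis hab : a < b.
Implicit Types f g h : R -> R.

Local Notation L := (b - a).
Local Notation periodic := (Defs.periodic a b).

Definition freq (n : nat) : R := n%:R * wavenumber a b.
Definition fcos n (x : R) : R := cos (freq n * (x - a)).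
Definition fsin n (x : R) : R := sin (freq n * (x - a)).
Definition cosc f n : R := L^-1 * RI a b (fun x => f x * fcos n x).
Definition sinc f n : R := L^-1 * RI a b (fun x => f x * fsin n x).
(* The frequencies [n] and [-n] are grouped. *)
Definition mult (n : nat) : R := if n is 0%N then 1 else 2.

Lemma L_gt0 : 0 < L. Proof. by rewrite subr_gt0. Qed.

Lemma wavenumber_gt0 : 0 < wavenumber a b.
Proof. by rewrite /wavenumber /period divr_gt0 ?L_gt0 ?mulr_gt0 ?pi_gt0. Qed.

Lemma wavenumberL : wavenumber a b * L = 2 * pi.
Proof. by rewrite /wavenumber /period mulfVK// gt_eqF ?L_gt0. Qed.

Lemma freq_inj n k : freq n ^+ 2 = freq k ^+ 2 -> n = k.
Proof.
have mu0 := wavenumber_gt0.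
have f0 m : 0 <= freq m by rewrite mulr_ge0// ltW.
move=> /eqP; rewrite eqrXn2// => /eqP /(mulIf (lt0r_neq0 mu0)) /eqP.
by rewrite eqr_nat => /eqP.
Qed.

Lemma der_freq (c d : R) : der (fun x : R => c * (x - d)) (fun=> c).
Proof. by der_auto; ring. Qed.

Lemma der_fcos n : der (fcos n) (fun x => - freq n * fsin n x).
Proof.
by apply: der_eq (der_comp der_cos (der_freq _ _)) _ => x; rewrite /fsin; ring.
Qed.

Lemma der_fsin n : der (fsin n) (fun x => freq n * fcos n x).
Proof.
by apply: der_eq (der_comp der_sin (der_freq _ _)) _ => x; rewrite /fcos; ring.
Qed.

Lemma cts_fcos n : cts (fcos n). Proof. exact: der_cts (der_fcos n). Qed.
Lemma cts_fsin n : cts (fsin n). Proof. exact: der_cts (der_fsin n). Qed.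

Lemma freq_period n x : freq n * (x + period a b - a) = freq n * (x - a) + (pi *+ 2) *+ n.
Proof.
rewrite -[x + _ - a]addrAC mulrDr; congr (_ + _).
by rewrite /freq /period -mulrA wavenumberL !mulr_natl.
Qed.

Lemma fcos_periodic n : periodic (fcos n).
Proof. by move=> x; rewrite /fcos freq_period (periodicn (@cosD2pi R)). Qed.

Lemma fsin_periodic n : periodic (fsin n).
Proof. by move=> x; rewrite /fsin freq_period (periodicn (@sinD2pi R)). Qed.

Lemma fcos_le1 n x : `|fcos n x| <= 1. Proof. exact: cos_max. Qed.
Lemma fsin_le1 n x : `|fsin n x| <= 1. Proof. exact: sin_max. Qed.

Lemma periodic_ends f : periodic f -> f b = f a.
Proof. by move=> pf; rewrite -(pf a) /period addrC subrK. Qed.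

Lemma RI_der_periodic F f : periodic F -> der F f -> cts f -> RI a b f = 0.
Proof. by move=> pF dF cf; rewrite (RI_FTC (ltW hab) dF cf) (periodic_ends pF) subrr. Qed.

(** Green's identity: the Wronskian [p q1 - p1 q] is periodic with derivative [(al - be) p q]. *)
Lemma eigen_orthogonal p p1 q q1 (al be : R) : periodic p -> periodic q ->
  der p p1 -> der p1 (fun x => - al * p x) -> der q q1 -> der q1 (fun x => - be * q x) ->
  al != be -> RI a b (fun x => p x * q x) = 0.
Proof.
move=> pp pq dp dp1 dq dq1 ne; have pp1 := der_periodic pp dp; have pq1 := der_periodic pq dq.
have cpq : cts (fun x => p x * q x) by cts_auto.
have : RI a b (fun x => (al - be) * (p x * q x)) = 0.
  apply: (RI_der_periodic (F := fun x => p x * q1 x - p1 x * q x)).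
  - by move=> x; rewrite pp pq pp1 pq1.
  - by der_auto; ring.
  - by cts_auto.
rewrite RI_scale ?(ltW hab)// => /eqP; rewrite mulf_eq0 subr_eq0 (negbTE ne)/= => /eqP //.
Qed.

Lemma der_fcos1 n : der (fun x => - freq n * fsin n x) (fun x => - freq n ^+ 2 * fcos n x).
Proof. by have d := der_fsin n; der_auto; ring. Qed.

Lemma der_fsin1 n : der (fun x => freq n * fcos n x) (fun x => - freq n ^+ 2 * fsin n x).
Proof. by have d := der_fcos n; der_auto; ring. Qed.

Lemma RI_ortho n k : n <> k ->
  [/\ RI a b (fun x => fcos n x * fcos k x) = 0, RI a b (fun x => fcos n x * fsin k x) = 0,
      RI a b (fun x => fsin n x * fcos k x) = 0 & RI a b (fun x => fsin n x * fsin k x) = 0].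
Proof.
move=> nk; have ne : freq n ^+ 2 != freq k ^+ 2 by apply/eqP => /freq_inj.
have := (der_fcos n, der_fsin n, der_fcos k, der_fsin k).
move=> [[[dcn dsn] dck] dsk].
have := (der_fcos1 n, der_fsin1 n, der_fcos1 k, der_fsin1 k).
move=> [[[dcn1 dsn1] dck1] dsk1].
have [pcn psn] := (fcos_periodic n, fsin_periodic n).
have [pck psk] := (fcos_periodic k, fsin_periodic k).
split.
- exact: eigen_orthogonal dcn dcn1 dck dck1 ne.
- exact: eigen_orthogonal dcn dcn1 dsk dsk1 ne.
- exact: eigen_orthogonal dsn dsn1 dck dck1 ne.
- exact: eigen_orthogonal dsn dsn1 dsk dsk1 ne.
Qed.

Lemma fsin0 : fsin 0 = fun=> 0.
Proof. by apply/funext => x; rewrite /fsin /freq !mul0r sin0. Qed.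
Lemma fcos0 : fcos 0 = fun=> 1.
Proof. by apply/funext => x; rewrite /fcos /freq !mul0r cos0. Qed.

Lemma RI_fsin_fcos n : RI a b (fun x => fsin n x * fcos n x) = 0.
Proof.
case: (posnP n) => [->|n0].
  by rewrite (_ : (fun x => _) = fun=> 0) ?RI_cst ?mul0r ?(ltW hab)//; apply/funext => x; rewrite fsin0 mul0r.
have f0 : freq n != 0 by rewrite mulf_neq0 ?pnatr_eq0 -?lt0n// gt_eqF// wavenumber_gt0.
have := (@cts_fsin n, @cts_fcos n); move=> [cs cc].
have : RI a b (fun x => (2 * freq n) * (fsin n x * fcos n x)) = 0.
  apply: (RI_der_periodic (F := fun x => fsin n x * fsin n x)).
  - by move=> x; rewrite fsin_periodic.
  - by have d := der_fsin n; der_auto; ring.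
  - by cts_auto.
rewrite RI_scale ?(ltW hab)//; last by cts_auto.
by move: (freq n) f0 => fr f0 /eqP; rewrite !mulf_eq0 (negbTE f0) pnatr_eq0 /= => /eqP.
Qed.

(** For positive [n] the two integrals add up to [L], and they are equal because [cos^2 - sin^2] is,
    up to the frequency, the derivative of [sin cos]. The value 2 of [mult] compensates the
    resulting one half; the sine of frequency 0 vanishes and must be excluded. *)
Lemma RI_sq n : mult n * RI a b (fun x => fcos n x * fcos n x) = L /\
  (n != 0%N -> mult n * RI a b (fun x => fsin n x * fsin n x) = L).
Proof.
case: n => [|n].
  have e : (fun x => fcos 0 x * fcos 0 x) = fun=> 1 by apply/funext => x; rewrite fcos0 mul1r.
  by split=> //; rewrite e RI_cst ?(ltW hab)// !mul1r.
have f0 : freq n.+1 != 0 by rewrite mulf_neq0 ?pnatr_eq0// gt_eqF// wavenumber_gt0.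
have := (@cts_fsin n.+1, @cts_fcos n.+1); move=> [cs cc].
have e1 : RI a b (fun x => fcos n.+1 x * fcos n.+1 x) + RI a b (fun x => fsin n.+1 x * fsin n.+1 x) = L.
  rewrite -RI_add ?(ltW hab)//; [|by cts_auto|by cts_auto].
  have e : (fun x => fcos n.+1 x * fcos n.+1 x + fsin n.+1 x * fsin n.+1 x) = fun=> 1.
    by apply/funext => x; rewrite -!expr2 /fcos /fsin cos2Dsin2.
  by rewrite e RI_cst ?(ltW hab)// mul1r.
have e2 : RI a b (fun x => fcos n.+1 x * fcos n.+1 x) = RI a b (fun x => fsin n.+1 x * fsin n.+1 x).
  apply/eqP; rewrite -subr_eq0 -RI_sub ?(ltW hab)//; [|by cts_auto|by cts_auto].
  apply/eqP; have : RI a b (fun x => freq n.+1 * (fcos n.+1 x * fcos n.+1 x - fsin n.+1 x * fsin n.+1 x)) = 0.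
    apply: (RI_der_periodic (F := fun x => fsin n.+1 x * fcos n.+1 x)).
    - by move=> x; rewrite fsin_periodic fcos_periodic.
    - by have d := der_fsin n.+1; have d' := der_fcos n.+1; der_auto; ring.
    - by cts_auto.
  rewrite RI_scale ?(ltW hab)//; last by cts_auto.
  by move=> /eqP; rewrite mulf_eq0 (negbTE f0)/= => /eqP.
by split => [|_]; rewrite /mult; lra.
Qed.

Lemma cosc_sub f g n : cts f -> cts g -> cosc (fun x => f x - g x) n = cosc f n - cosc g n.
Proof.
move=> cf cg; have cc := @cts_fcos n; rewrite /cosc -mulrBr -RI_sub ?(ltW hab)//; [|by cts_auto|by cts_auto].
by congr (_ * RI _ _ _); apply/funext => x; ring.
Qed.

Lemma sinc_sub f g n : cts f -> cts g -> sinc (fun x => f x - g x) n = sinc f n - sinc g n.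
Proof.
move=> cf cg; have cc := @cts_fsin n; rewrite /sinc -mulrBr -RI_sub ?(ltW hab)//; [|by cts_auto|by cts_auto].
by congr (_ * RI _ _ _); apply/funext => x; ring.
Qed.

(* A phase makes the family closed under multiplication by [cos (mu (x - x0))]. *)
Definition trig_orthogonal h := forall n (phi : R),
  RI a b (fun x => h x * cos (freq n * (x - a) + phi)) = 0.

Lemma cts_phase n phi : cts (fun x : R => cos (freq n * (x - a) + phi)).
Proof.
have d : der (fun x : R => freq n * (x - a) + phi) (fun=> freq n) by der_auto; ring.
exact: der_cts (der_comp der_cos d).
Qed.

Lemma trig_orthogonal_coef h : cts h -> (forall n, cosc h n = 0) -> (forall n, sinc h n = 0) ->
  trig_orthogonal h.
Proof.
move=> ch hc hs n phi; have cc := @cts_fcos n; have cs := @cts_fsin n.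
have L0 := lt0r_neq0 L_gt0.
have {}hc : RI a b (fun x => h x * fcos n x) = 0.
  by move/eqP: (hc n); rewrite mulf_eq0 invr_eq0 (negbTE L0)/= => /eqP.
have {}hs : RI a b (fun x => h x * fsin n x) = 0.
  by move/eqP: (hs n); rewrite mulf_eq0 invr_eq0 (negbTE L0)/= => /eqP.
rewrite (_ : (fun x => _) = fun x => cos phi * (h x * fcos n x) + (- sin phi) * (h x * fsin n x)).
  rewrite RI_lin ?(ltW hab)//; [|by cts_auto|by cts_auto].
  by rewrite RI_scale ?(ltW hab)//; [rewrite hc hs !mulr0 addr0|by cts_auto].
by apply/funext => x; rewrite cosD /fcos /fsin; ring.
Qed.

(** The product-to-sum formula shifts the frequency by one up and down and only changes the
    phase. *)
Lemma trig_orthogonal_mul h x0 c : cts h -> trig_orthogonal h ->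
  trig_orthogonal (fun x => h x * (c + cos (wavenumber a b * (x - x0)))).
Proof.
move=> ch th n phi; pose psi := wavenumber a b * (a - x0).
have E x : cos (wavenumber a b * (x - x0)) = cos (freq 1 * (x - a) + psi).
  by congr cos; rewrite /freq /psi; ring.
have pr (u v : R) : cos u * cos v = 2^-1 * cos (u + v) + 2^-1 * cos (u - v).
  by rewrite cosB cosD; field.
have cp k p := @cts_phase k p.
have c1 := cp n phi.
(* At [n = 0] shifting down would need frequency -1; but the cosine is then the constant [cos phi],
   and no splitting is necessary. *)
case: n c1 => [|n] c1.
  rewrite (_ : (fun x => _) = fun x => c * (h x * cos (freq 0 * (x - a) + phi)) +
     cos phi * (h x * cos (freq 1 * (x - a) + psi))).
    have c2 := cp 1%N psi.
    rewrite RI_lin ?RI_scale ?(ltW hab)//; try by cts_auto.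
    by rewrite !th !mulr0 addr0.
  by apply/funext => x; rewrite E /freq !mul0r !add0r; ring.
rewrite (_ : (fun x => _) = fun x => c * (h x * cos (freq n.+1 * (x - a) + phi)) +
   (2^-1 * (h x * cos (freq n.+2 * (x - a) + (phi + psi))) +
    2^-1 * (h x * cos (freq n * (x - a) + (phi - psi))))).
  have c2 := cp n.+2 (phi + psi); have c3 := cp n (phi - psi).
  rewrite RI_lin ?RI_scale ?(ltW hab)//; try by cts_auto.
  rewrite RI_lin ?RI_scale ?(ltW hab)//; try by cts_auto.
  by rewrite !th !mulr0 !addr0.
apply/funext => x; rewrite E.
have -> : freq n.+2 * (x - a) + (phi + psi) = (freq n.+1 * (x - a) + phi) + (freq 1 * (x - a) + psi).
  by rewrite /freq -[n.+2]addn1 natrD; ring.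
have -> : freq n * (x - a) + (phi - psi) = (freq n.+1 * (x - a) + phi) - (freq 1 * (x - a) + psi).
  by rewrite /freq -[n.+1]addn1 natrD; ring.
have E' (y C1 C2 : R) : y * (c + C2) * C1 = c * (y * C1) + y * (C1 * C2) by ring.
by rewrite E' pr; ring.
Qed.

Lemma cos_lt (y z : R) : 0 <= y -> y < z -> z <= pi -> cos z < cos y.
Proof.
move=> y0 yz zp; have yI : y \in `[0, pi] by rewrite in_itv/= y0 (le_trans (ltW yz)).
have zI : z \in `[0, pi] by rewrite in_itv/= zp (le_trans y0 (ltW yz)).
by rewrite (ltr_cos yI zI).
Qed.

Lemma cos_le (y z : R) : 0 <= y -> y <= z -> z <= pi -> cos z <= cos y.
Proof.
move=> y0; rewrite le_eqVlt => /predU1P[->//|yz] zp.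
by apply/ltW/cos_lt.
Qed.

(** The angle [mu |x - x0|] lies between [mu dl] and [2 pi - mu dl], and the cosine decreases on
    [[0, pi]] and is symmetric about [pi]. *)
Lemma cos_far x0 x dl : 0 < dl -> a <= x0 - dl -> x0 + dl <= b -> a <= x <= b -> dl <= `|x - x0| ->
  cos (wavenumber a b * (x - x0)) <= cos (wavenumber a b * dl).
Proof.
move=> dl0 ax xb /andP[ax' xb'] dx; have mu0 := wavenumber_gt0; have muL := wavenumberL.
have -> : cos (wavenumber a b * (x - x0)) = cos (wavenumber a b * `|x - x0|).
  have [_|_] := ger0P (x - x0); first by [].
  by rewrite mulrN cosN.
have ub : `|x - x0| <= L - dl by rewrite ler_norml; apply/andP; split; lra.
move: (`|x - x0|) dx ub => t dt tL; set mu := wavenumber a b in mu0 muL *.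
have h1 : mu * dl <= mu * t by rewrite ler_pM2l.
have h2 : mu * t <= mu * L - mu * dl by rewrite -mulrBr ler_pM2l.
have h3 : 0 < mu * dl by rewrite mulr_gt0.
have pi0 := @pi_gt0 R.
have [tp|pt] := leP (mu * t) pi; first by apply: cos_le; lra.
have -> : cos (mu * t) = cos (pi *+ 2 - mu * t).
  by rewrite -[LHS]cosN -(cosD2pi (- (mu * t))) addrC.
by apply: cos_le; lra.
Qed.

(* If [h x0 > 0], the powers of [c + cos (mu (x - x0))], all orthogonal to [h], concentrate at [x0]. *)
Lemma trig_orthogonal_eq0 h : cts h -> trig_orthogonal h -> forall x, a < x < b -> h x <= 0.
Proof.
move=> ch th x0 /andP[ax0 x0b]; rewrite leNgt; apply/negP => h0.
have mu0 := wavenumber_gt0; have muL := wavenumberL; have pi0 := @pi_gt0 R.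
have e0 : 0 < h x0 / 2 by lra.
have [d' d'0 hd'] := (cts_P h).1 ch x0 _ e0.
(* Small enough for [h] to exceed [h x0 / 2] on the window, and for the window to stay inside
   [[a, b]]. *)
pose dl := Num.min (d' / 2) (Num.min (x0 - a) (b - x0)).
have [dl1 [dl2 dl3]] : dl <= d' / 2 /\ dl <= x0 - a /\ dl <= b - x0.
  by rewrite /dl !ge_min !lexx !orbT.
have dl0 : 0 < dl by rewrite /dl !lt_min; apply/and3P; split; lra.
pose mu := wavenumber a b.
pose k := cos (mu * dl); pose k' := cos (mu * (dl / 2)).
have mudl : mu * dl <= pi.
  have : mu * (2 * dl) <= mu * L by rewrite ler_pM2l//; lra.
  rewrite -/mu in muL; lra.
have mudl0 : 0 < mu * dl by rewrite mulr_gt0.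
have kk' : k < k'.
  by apply: cos_lt; lra.
have k1 : -1 <= k by have := cos_max (mu * dl); rewrite ler_norml => /andP[].
have k1' : k <= 1 by exact: cos_le1.
(* The shift [1 - k] puts the threshold 1 at distance [dl]: [|p| <= 1] outside the window, [p >= 1]
   inside it, and [p >= 1 + eta] on the half window. *)
pose p x := 1 - k + cos (mu * (x - x0)).
have cp : cts p by have := der_cts (der_comp der_cos (der_freq mu x0)) => cc; rewrite /p; cts_auto.
have zero n : RI a b (fun x => h x * p x ^+ n) = 0.
  suff [_ /(_ 0%N 0)] : cts (fun x => h x * p x ^+ n) /\ trig_orthogonal (fun x => h x * p x ^+ n).
    rewrite (_ : (fun x => _ * cos _) = (fun x => h x * p x ^+ n))//.
    by apply/funext => x; rewrite /freq !mul0r add0r cos0 mulr1.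
  elim: n => [|n [ic io]].
    by rewrite (_ : (fun x => _) = h)//; apply/funext => x; rewrite expr0 mulr1.
  split; first by cts_auto.
  rewrite (_ : (fun x => _) = (fun x => h x * p x ^+ n * p x)); first exact: trig_orthogonal_mul.
  by apply/funext => x; rewrite exprSr mulrA.
have [K K0 hK] := cts_bounded a b ch.
have hpos x : `|x - x0| <= dl -> h x0 / 2 <= h x.
  move=> hx; have : `|x0 - x| < d' by rewrite distrC; lra.
  by move/hd'; rewrite ltr_norml => /andP[]; lra.
have near_cos x r : 0 <= r -> r <= dl -> `|x - x0| <= r -> cos (mu * r) <= cos (mu * (x - x0)).
  move=> r0 rdl hx.
  have -> : cos (mu * (x - x0)) = cos (mu * `|x - x0|).
    by have [_|_] := ger0P (x - x0); rewrite ?mulrN ?cosN.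
  have h1 : mu * r <= mu * dl by rewrite ler_pM2l.
  apply: cos_le; [by rewrite mulr_ge0// ltW|by rewrite ler_pM2l|lra].
have low n x : a <= x <= b -> - K <= h x * p x ^+ n.
  move=> xab; have [far|near] := leP dl `|x - x0|.
    have pn : `|p x| <= 1.
      have h1 : cos (mu * (x - x0)) <= k by apply: cos_far => //; lra.
      have := cos_max (mu * (x - x0)); rewrite ler_norml => /andP[h2 _].
      by rewrite /p ler_norml; apply/andP; split; lra.
    have : `|h x * p x ^+ n| <= K.
      by rewrite normrM normrX -[K]mulr1 ler_pM ?exprn_ge0 ?hK ?exprn_ile1.
    by rewrite ler_norml => /andP[].
  have h1 := hpos _ (ltW near); have h2 : k <= cos (mu * (x - x0)).
    by apply: near_cos => //; apply: ltW.
  apply: (@le_trans _ _ 0); first by lra.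
  by rewrite mulr_ge0 ?exprn_ge0// /p; lra.
pose eta := k' - k.
have high n x : x0 - dl / 2 <= x <= x0 + dl / 2 -> (h x0 / 2) * (1 + n%:R * eta) <= h x * p x ^+ n.
  move=> /andP[x1 x2]; have hx : `|x - x0| <= dl / 2 by rewrite ler_norml; apply/andP; split; lra.
  have h1 : h x0 / 2 <= h x by apply: hpos; lra.
  have h2 : k' <= cos (mu * (x - x0)) by apply: near_cos => //; lra.
  have eta0 : 0 < eta by rewrite /eta; lra.
  have p1 : 1 + eta <= p x by rewrite /p /eta; lra.
  apply: ler_pM; [lra| |by []|].
    by rewrite addr_ge0// mulr_ge0// ltW.
  (* Bernoulli's inequality; linear growth in [n] is enough to contradict the fixed lower bound
     [- K * L]. *)
  apply: (@le_trans _ _ ((1 + eta) ^+ n)).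
    elim: n {low zero} => [|n ih]; first by rewrite mul0r addr0 expr0.
    rewrite exprS -natr1.
    have : (1 + eta) * (1 + n%:R * eta) <= (1 + eta) * (1 + eta) ^+ n by rewrite ler_pM2l//; lra.
    have : 0 <= n%:R * eta * eta by rewrite !mulr_ge0// ltW.
    lra.
  by rewrite lerXn2r// nnegrE; lra.
have tot n : - K * L + (h x0 / 2) * (1 + n%:R * eta) * dl <= 0.
  rewrite -(zero n); have cn : cts (fun x => h x * p x ^+ n) by cts_auto.
  rewrite (@RI_chasles _ _ a (x0 - dl / 2) b)//; [|lra|lra].
  rewrite (@RI_chasles _ _ (x0 - dl / 2) (x0 + dl / 2) b)//; [|lra|lra].
  have b1 : - K * (x0 - dl / 2 - a) <= RI a (x0 - dl / 2) (fun x => h x * p x ^+ n).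
    rewrite -RI_cst; [|lra]; apply: RI_le => //; [lra|exact: cts_cst|].
    by move=> z /andP[z1 z2]; apply: low; apply/andP; split; lra.
  have b2 : - K * (b - (x0 + dl / 2)) <= RI (x0 + dl / 2) b (fun x => h x * p x ^+ n).
    rewrite -RI_cst; [|lra]; apply: RI_le => //; [lra|exact: cts_cst|].
    by move=> z /andP[z1 z2]; apply: low; apply/andP; split; lra.
  have b3 : (h x0 / 2) * (1 + n%:R * eta) * (x0 + dl / 2 - (x0 - dl / 2)) <=
      RI (x0 - dl / 2) (x0 + dl / 2) (fun x => h x * p x ^+ n).
    rewrite -RI_cst; [|lra]; apply: RI_le => //; [lra|exact: cts_cst|].
    by move=> z hz; apply: high.
  have Kdl : 0 <= K * dl by rewrite mulr_ge0// ltW.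
  lra.
have q0 : 0 < (h x0 / 2) * eta * dl by rewrite !mulr_gt0// /eta; lra.
pose n := (Num.trunc (K * L / ((h x0 / 2) * eta * dl))).+1.
have : K * L / ((h x0 / 2) * eta * dl) < n%:R by exact: truncnS_gt.
rewrite ltr_pdivrMr// => h1; have := tot n.
have h2 : 0 < h x0 / 2 * dl by rewrite mulr_gt0.
lra.
Qed.

(** The sign lemma, applied to [h] and to [- h], gives zero in the open interval; continuity and
    periodicity do the rest. *)
Lemma fourier_unique h : cts h -> periodic h -> (forall n, cosc h n = 0) ->
  (forall n, sinc h n = 0) -> h = fun=> 0.
Proof.
move=> ch ph hc hs; have th := trig_orthogonal_coef ch hc hs.
have thN : trig_orthogonal (fun x => - h x).
  move=> n phi; have cp := @cts_phase n phi.
  rewrite (_ : (fun x => _) = fun x => (-1) * (h x * cos (freq n * (x - a) + phi))).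
    by rewrite RI_scale ?(ltW hab) ?th ?mulr0//; cts_auto.
  by apply/funext => x; ring.
have inner x : a < x < b -> h x = 0.
  move=> xab; apply/eqP; rewrite eq_le (trig_orthogonal_eq0 ch th xab)/= -oppr_le0.
  by apply: (trig_orthogonal_eq0 _ thN xab); cts_auto.
(* The endpoints are reached through the integral of [h^2], which does not see them. *)
have I0 : RI a b (fun x => h x * h x) = 0.
  rewrite /RI -(@Rintegral_itv_obnd_cbnd _ a (BRight b)); last first.
    apply: integrableS (@cts_integrable _ (fun x => h x * h x) a b _) => //.
      by apply: subset_itvr; rewrite bnd_simp.
    by cts_auto.
  rewrite -(@Rintegral_itv_bndo_bndc _ (BRight a) b); last first.
    apply: integrableS (@cts_integrable _ (fun x => h x * h x) a b _) => //.
      by apply: subset_itvW; rewrite bnd_simp.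
    by cts_auto.
  transitivity (\int[@lebesgue_measure R]_(x in `]a, b[) (0 : R)).
    by apply: eq_Rintegral => x; rewrite inE/= in_itv/= => xab; rewrite inner// mul0r.
  by rewrite Rintegral_cst// mul0r.
have hz : forall z, a <= z <= b -> h z * h z = 0.
  apply: RI_ge0_eq0 => //; first by cts_auto.
  by move=> z _; rewrite -expr2 sqr_ge0.
apply/funext => x; have [n hn _] := periodic_reduce hab x.
by rewrite -(periodic_int n x ph); have /eqP := hz _ hn; rewrite mulf_eq0 orbb => /eqP.
Qed.
End Fourier.

(** * Fourier inversion, Parseval's identity and the norms of H^r *)

Section FourierSeries.
Context {R : realType}.
Variables a b : R.
Hypothesis hab : a < b.
Implicit Types f g h : R -> R.

Local Notation L := (b - a).
Local Notation periodic := (Defs.periodic a b).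
Local Notation freq := (freq a b).
Local Notation fcos := (fcos a b).
Local Notation fsin := (fsin a b).
Local Notation cosc := (cosc a b).
Local Notation sinc := (sinc a b).
Local Notation C2p := (C2p a b).

Definition fterm f n x : R := mult n * (cosc f n * fcos n x + sinc f n * fsin n x).
Definition fterm1 f n x : R := mult n * freq n * (sinc f n * fcos n x - cosc f n * fsin n x).
Definition fterm2 f n x : R := - freq n ^+ 2 * fterm f n x.
(** A single majorant for a Fourier term and its first two derivatives, obtained from
    [|k| <= 1 + k^2]. *)
Definition fbound f n : R := mult n * (1 + freq n ^+ 2) * (`|cosc f n| + `|sinc f n|).

Lemma mult_ge0 n : 0 <= mult n :> R. Proof. by case: n => /=. Qed.

Lemma der_fterm f n : der (fterm f n) (fterm1 f n).
Proof.
by have d := der_fcos a b n; have d' := der_fsin a b n; rewrite /fterm; der_auto; rewrite /fterm1; ring.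
Qed.

Lemma der_fterm1 f n : der (fterm1 f n) (fterm2 f n).
Proof.
by have d := der_fcos a b n; have d' := der_fsin a b n; rewrite /fterm1; der_auto; rewrite /fterm2 /fterm; ring.
Qed.

Lemma cts_fterm f n : cts (fterm f n). Proof. exact: der_cts (der_fterm f n). Qed.
Lemma cts_fterm1 f n : cts (fterm1 f n). Proof. exact: der_cts (der_fterm1 f n). Qed.
Lemma cts_fterm2 f n : cts (fterm2 f n).
Proof. by have c := @cts_fterm f n; rewrite /fterm2; cts_auto. Qed.

Lemma trig_comb_le (A B c s : R) : `|c| <= 1 -> `|s| <= 1 -> `|A * c + B * s| <= `|A| + `|B|.
Proof.
by move=> c1 s1; rewrite (le_trans (ler_normD _ _))// !normrM lerD// ler_piMr.
Qed.

Lemma fterm_bounds f n x : [/\ `|fterm f n x| <= fbound f n, `|fterm1 f n x| <= fbound f n &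
  `|fterm2 f n x| <= fbound f n].
Proof.
have m0 := mult_ge0 n; have c1 := fcos_le1 a b n x; have s1 := fsin_le1 a b n x.
have h1 := trig_comb_le (cosc f n) (sinc f n) c1 s1.
have h2 : `|sinc f n * fcos n x - cosc f n * fsin n x| <= `|cosc f n| + `|sinc f n|.
  by rewrite addrC -mulNr [leRHS]addrC -[`|cosc f n|]normrN [leRHS]addrC; apply: trig_comb_le.
have f2 : 0 <= freq n ^+ 2 by rewrite sqr_ge0.
have f1 : `|freq n| <= 1 + freq n ^+ 2.
  have : 0 <= (`|freq n| - 1) ^+ 2 by rewrite sqr_ge0.
  have : 0 <= `|freq n| by [].
  have : `|freq n| ^+ 2 = freq n ^+ 2 by rewrite real_normK ?num_real.
  by move: (`|freq n|) (freq n ^+ 2) => u v; nra.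
set q := `|cosc f n| + `|sinc f n|; have q0 : 0 <= q by rewrite addr_ge0.
have e (t u : R) : `|t| <= 1 + freq n ^+ 2 -> `|u| <= q -> `|mult n * t * u| <= fbound f n.
  by move=> ht hu; rewrite !normrM (ger0_norm m0) /fbound ler_pM// ?mulr_ge0// ler_wpM2l.
split.
- by rewrite /fterm -[mult n]mulr1; apply: e; rewrite ?normr1 ?lerDl.
- exact: e.
- rewrite /fterm2 /fterm mulrA (mulrC (- _)); apply: e => //.
  by rewrite normrN ger0_norm// lerDr.
Qed.

Lemma cvg_series_single (k : nat) (c : R) : series (fun n => if n == k then c else 0) @ \oo --> c.
Proof.
have e n : (k < n)%N -> series (fun n => if n == k then c else 0) n = c.
  move=> kn; rewrite seriesEnat /= (bigD1_seq k) ?iota_uniq ?mem_index_iota//= eqxx.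
  by rewrite big1 ?addr0// => i /negbTE->.
apply/cvgrPdist_le => eps eps0; exists k.+1 => // n /= kn.
by rewrite e// subrr normr0 ltW.
Qed.

Lemma RI_fterm_fcos f n k :
  RI a b (fun x => fterm f n x * fcos k x) = if n == k then L * cosc f k else 0.
Proof.
have cc := @cts_fcos R a b; have cs := @cts_fsin R a b; have ab := ltW hab.
have ck := cc k; have cn := cc n; have sn := cs n.
rewrite (_ : (fun x => _) = fun x => (mult n * cosc f n) * (fcos n x * fcos k x) +
   (mult n * sinc f n) * (fsin n x * fcos k x)); last by apply/funext => x; rewrite /fterm; ring.
rewrite RI_lin// ?RI_scale//; try by cts_auto.
case: eqP => [<-|nk].
  have [e _] := RI_sq hab n; rewrite RI_fsin_fcos// mulr0 addr0.
  by rewrite mulrAC e.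
by have [-> _ -> _] := RI_ortho hab nk; rewrite !mulr0 addr0.
Qed.

Lemma sinc0 f : sinc f 0 = 0.
Proof.
rewrite /sinc fsin0 (_ : (fun x => _) = fun=> 0) ?RI_cst ?mul0r ?mulr0 ?(ltW hab)//.
by apply/funext => x; rewrite mulr0.
Qed.

Lemma RI_fterm_fsin f n k :
  RI a b (fun x => fterm f n x * fsin k x) = if n == k then L * sinc f k else 0.
Proof.
have cc := @cts_fcos R a b; have cs := @cts_fsin R a b; have ab := ltW hab.
have ck := cs k; have cn := cc n; have sn := cs n.
rewrite (_ : (fun x => _) = fun x => (mult n * cosc f n) * (fcos n x * fsin k x) +
   (mult n * sinc f n) * (fsin n x * fsin k x)); last by apply/funext => x; rewrite /fterm; ring.
rewrite RI_lin// ?RI_scale//; try by cts_auto.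
case: eqP => [<-|nk].
  have [_ e] := RI_sq hab n.
  rewrite (_ : (fun x => fcos n x * fsin n x) = fun x => fsin n x * fcos n x); last first.
    by apply/funext => x; rewrite mulrC.
  rewrite RI_fsin_fcos// mulr0 add0r mulrAC.
  by case: (n =P 0%N) e => [->|/eqP n0] e; [rewrite sinc0 !mulr0|rewrite e].
by have [_ -> _ ->] := RI_ortho hab nk; rewrite !mulr0 addr0.
Qed.

(** Orthogonality shows that the uniformly convergent series has the coefficients of [f], and
    [fourier_unique] identifies the two. *)
Lemma fourier_inversion f : cts f -> periodic f -> cvgn (series (fbound f)) -> f = fser (fterm f).
Proof.
move=> cf pf cM; have uM n x : `|fterm f n x| <= fbound f n by have [] := fterm_bounds f n x.
have cu := @cts_fterm f; have cg := cts_fser uM cM cu; have L0 := lt0r_neq0 (L_gt0 hab).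
have pg : periodic (fser (fterm f)).
  move=> x; congr (limn (series _)); apply/funext => n.
  by rewrite /fterm fcos_periodic// fsin_periodic.
have hc k : cosc (fser (fterm f)) k = cosc f k.
  have := RI_fser uM cM cu (ltW hab) (@cts_fcos R a b k).
  under [X in series X @ _]eq_fun do rewrite RI_fterm_fcos.
  move=> hl; have e := cvg_unique _ (@cvg_series_single k (L * cosc f k)) hl.
  by transitivity (L^-1 * (L * cosc f k)); [rewrite e|rewrite mulKf].
have hs k : sinc (fser (fterm f)) k = sinc f k.
  have := RI_fser uM cM cu (ltW hab) (@cts_fsin R a b k).
  under [X in series X @ _]eq_fun do rewrite RI_fterm_fsin.
  move=> hl; have e := cvg_unique _ (@cvg_series_single k (L * sinc f k)) hl.
  by transitivity (L^-1 * (L * sinc f k)); [rewrite e|rewrite mulKf].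
have h0 : (fun x => f x - fser (fterm f) x) = fun=> 0.
  apply: (fourier_unique hab).
  - by cts_auto.
  - by move=> x; rewrite pf pg.
  - by move=> n; rewrite cosc_sub// hc subrr.
  - by move=> n; rewrite sinc_sub// hs subrr.
apply/funext => x; move/(congr1 (fun h => h x)): h0 => /eqP.
by rewrite subr_eq0 => /eqP.
Qed.

(** Termwise differentiation yields the derivatives; the limit is Parseval's identity for the H^1
    norm, found by integrating the series of [f] and of its second derivative against [f]. *)
Lemma fourier_C2 f : cts f -> periodic f -> cvgn (series (fbound f)) ->
  exists f1 f2, [/\ C2p f f1 f2,
    forall x, [/\ `|f x| <= limn (series (fbound f)), `|f1 x| <= limn (series (fbound f)) &
      `|f2 x| <= limn (series (fbound f))] &
    series (fun n => mult n * (1 + freq n ^+ 2) * (cosc f n ^+ 2 + sinc f n ^+ 2)) @ \oo -->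
      L^-1 * RI a b (fun x => f x * (f x - f2 x))].
Proof.
move=> cf pf cM; have fE := fourier_inversion cf pf cM.
have uM n x : `|fterm f n x| <= fbound f n by have [] := fterm_bounds f n x.
have u1M n x : `|fterm1 f n x| <= fbound f n by have [] := fterm_bounds f n x.
have u2M n x : `|fterm2 f n x| <= fbound f n by have [] := fterm_bounds f n x.
have c2 := cts_fser u2M cM (@cts_fterm2 f).
have d0 : der f (fser (fterm1 f)).
  by rewrite [X in der X _]fE; exact: (der_fser uM cM u1M cM (der_fterm f) (@cts_fterm1 f)).
have d1 : der (fser (fterm1 f)) (fser (fterm2 f)).
  exact: (der_fser u1M cM u2M cM (der_fterm1 f) (@cts_fterm2 f)).
exists (fser (fterm1 f)), (fser (fterm2 f)); split => [//|x|].
  split; first by rewrite [X in `|X x|]fE; apply: fser_bound uM cM x.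
    exact: fser_bound u1M cM x.
  exact: fser_bound u2M cM x.
have h1 := RI_fser uM cM (@cts_fterm f) (ltW hab) cf.
have h2 := RI_fser u2M cM (@cts_fterm2 f) (ltW hab) cf.
have L0 := lt0r_neq0 (L_gt0 hab).
have h := @cvg_series_lin _ (-1) _ _ _ _ h2 h1.
have ab := ltW hab.
have -> : RI a b (fun x => f x * (f x - fser (fterm2 f) x)) =
   -1 * RI a b (fun z => fser (fterm2 f) z * f z) + RI a b (fun z => fser (fterm f) z * f z).
  rewrite -RI_lin//; [|by cts_auto|by rewrite -fE; cts_auto].
  by congr RI; apply/funext => x; rewrite -fE; ring.
(* The zero series is added only to use the linear combination lemma as multiplication by [L^-1]. *)
have := @cvg_series_lin _ L^-1 _ _ _ _ h (@cvg_series_single 0%N 0).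
rewrite addr0; apply: cvg_trans; apply: near_eq_cvg; near=> n.
rewrite /series /=; apply: eq_bigr => k _; rewrite if_same addr0.
have cc := @cts_fcos R a b k; have cs := @cts_fsin R a b k; have ck := @cts_fterm f k.
have -> : RI a b (fun z => fterm2 f k z * f z) = - freq k ^+ 2 * RI a b (fun z => fterm f k z * f z).
  rewrite -RI_scale//; last by cts_auto.
  by congr RI; apply/funext => x; rewrite /fterm2; ring.
have -> : RI a b (fun z => fterm f k z * f z) =
   (mult k * cosc f k) * (L * cosc f k) + (mult k * sinc f k) * (L * sinc f k).
  have -> : L * cosc f k = RI a b (fun x => f x * fcos k x) by rewrite /cosc mulVKf.
  have -> : L * sinc f k = RI a b (fun x => f x * fsin k x) by rewrite /sinc mulVKf.
  rewrite -!RI_scale//; try by cts_auto.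
  rewrite -RI_add//; try by cts_auto.
  by congr RI; apply/funext => x; rewrite /fterm; ring.
by field.
Unshelve. all: by end_near.
Qed.

(** Two integrations by parts, again through the periodic function [g p1 - g1 p]. *)
Lemma cosc_second g g1 g2 n : C2p g g1 g2 ->
  cosc (fun x => g x - g2 x) n = (1 + freq n ^+ 2) * cosc g n /\
  sinc (fun x => g x - g2 x) n = (1 + freq n ^+ 2) * sinc g n.
Proof.
move=> [pg dg dg1 cg2]; have pg1 := der_periodic pg dg; have ab := ltW hab.
have key p p1 : periodic p -> der p p1 -> der p1 (fun x => - freq n ^+ 2 * p x) ->
    RI a b (fun x => (g x - g2 x) * p x) = (1 + freq n ^+ 2) * RI a b (fun x => g x * p x).
  move=> pp dp dp1; have pp1 := der_periodic pp dp.
  apply/eqP; rewrite -subr_eq0 -RI_scale// -?RI_sub//; try by cts_auto.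
  apply/eqP; apply: (@RI_der_periodic _ _ _ hab (fun x => g x * p1 x - g1 x * p x)).
  - by move=> x; rewrite pg pp1 pg1 pp.
  - by der_auto; ring.
  - by cts_auto.
rewrite /cosc /sinc.
rewrite (key _ _ (fcos_periodic hab n) (der_fcos a b n) (der_fcos1 a b n)).
rewrite (key _ _ (fsin_periodic hab n) (der_fsin a b n) (der_fsin1 a b n)).
by split; ring.
Qed.

Definition hweight (r : R) n : R := (1 + freq n ^+ 2) `^ r.
Definition hterm r f n : R := mult n * (hweight r n * (cosc f n ^+ 2 + sinc f n ^+ 2)).

Lemma hweight_ge0 r n : 0 <= hweight r n. Proof. exact: powR_ge0. Qed.

Lemma hterm_ge0 r f n : 0 <= hterm r f n.
Proof. by rewrite !mulr_ge0 ?mult_ge0 ?hweight_ge0// addr_ge0 ?sqr_ge0. Qed.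

(** Since [f] is real, the modulus of its coefficients is even in the frequency, so the sum over the
    integers folds into a series over the naturals. *)
Lemma Hnorm2E r f : cts f -> Hnorm2 a b r f = (\sum_(0 <= n <oo) (hterm r f n)%:E)%E.
Proof.
move=> cf; pose A (n : nat) := hweight r n * (cosc f n ^+ 2 + sinc f n ^+ 2).
pose T (k : int) := (1 + (k%:~R * wavenumber a b) ^+ 2) `^ r * Normc.normc (fourier a b f k) ^+ 2.
have A0 n : 0 <= A n by rewrite mulr_ge0 ?hweight_ge0// addr_ge0 ?sqr_ge0.
have nc (x y : R) : Normc.normc (Complex x y) ^+ 2 = x ^+ 2 + y ^+ 2.
  by rewrite /= sqr_sqrtr// addr_ge0 ?sqr_ge0.
have TP n : T (Posz n) = A n by rewrite /T /fourier nc sqrrN.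
have TN n : T (Negz n) = A n.+1.
  have nE : (Negz n)%:~R = - n.+1%:R :> R by rewrite NegzE mulrNz.
  rewrite /T /fourier nc sqrrN nE mulNr sqrrN /A /hweight; congr (_ * (_ ^+ 2 + _)).
    by congr (_ * _); apply: eq_Rintegral => x _; rewrite mulNr cosN.
  rewrite (_ : Rintegral _ _ _ = - RI a b (fun x => f x * fsin n.+1 x)) ?mulrN ?sqrrN//.
  have cs := @cts_fsin R a b n.+1.
  transitivity (-1 * RI a b (fun x => f x * fsin n.+1 x)); last by rewrite mulN1r.
  rewrite -RI_scale; [|exact: ltW|by cts_auto].
  by apply: eq_Rintegral => x _; rewrite mulNr sinN mulrN mulN1r.
rewrite /Hnorm2 -[LHS]/(\esum_(k in [set: int]) (T k)%:E)%E.
have T0 k : (0 <= (T k)%:E)%E by rewrite lee_fin; case: k => n; rewrite ?TP ?TN.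
rewrite (esumID (range Posz))//.
rewrite !setTI.
have -> : ~` (range Posz) = range Negz.
  apply/seteqP; split => -[n|n] /=.
  - by move=> h; exfalso; apply: h; exists n.
  - by move=> _; exists n.
  - by move=> [m _].
  - by move=> _ [m _].
rewrite (@reindex_esum _ _ _ [set: nat] _ Posz); last first.
  by split => [n _|m n _ _ []//|k [n _ <-]]; [exists n|exists n].
rewrite (@reindex_esum _ _ _ [set: nat] _ Negz); last first.
  by split => [n _|m n _ _ []//|k [n _ <-]]; [exists n|exists n].
rewrite -!nneseries_esumT; try by move=> *; exact: T0.
rewrite (eq_eseriesr (g := fun n => (A n)%:E)); last by move=> n _; rewrite TP.
rewrite [X in (_ + X)%E](eq_eseriesr (g := fun n => (A n.+1)%:E)); last by move=> n _; rewrite TN.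
(* [Negz n] is [-(n + 1)]: the negative half is reindexed from 1 and given the value 0 at 0, which
   is why [mult 0 = 1]. *)
pose A' n := if n is 0%N then 0 else A n.
have A'0 n : (0 <= (A' n)%:E)%E by rewrite lee_fin; case: n => [|n] /=.
have -> : (\sum_(0 <= n <oo) (A n.+1)%:E = \sum_(0 <= n <oo) (A' n)%:E)%E.
  rewrite [RHS]nneseries_recl//= add0e -(nneseries_addn 1); last by move=> n; exact: A'0.
  by apply: eq_eseriesr => n _; rewrite addn1.
rewrite -nneseriesD; [|by move=> n _ _; rewrite lee_fin|by move=> n _ _; exact: A'0].
apply: eq_eseriesr => n _; rewrite -EFinD /hterm; congr EFin.
by case: n => [|n] /=; rewrite ?addr0 ?mul1r// mulr_natl.
Qed.
End FourierSeries.

(** * The embedding of H^s into C^2 *)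

Section SobolevEmbedding.
Context {R : realType}.
Variables a b : R.
Hypothesis hab : a < b.
Implicit Types f g h : R -> R.

Local Notation L := (b - a).
Local Notation periodic := (Defs.periodic a b).
Local Notation freq := (freq a b).
Local Notation cosc := (cosc a b).
Local Notation sinc := (sinc a b).
Local Notation C2p := (C2p a b).
Local Notation hweight := (hweight a b).
Local Notation hterm := (hterm a b).
Local Notation fbound := (fbound a b).
Local Notation Hnorm2 := (Hnorm2 a b).
Local Notation sobolev := (sobolev a b).

Lemma continuousP_cts f : continuous f <-> cts f.
Proof. by split. Qed.

Lemma hbase_ge1 n : 1 <= 1 + freq n ^+ 2.
Proof. by rewrite lerDl sqr_ge0. Qed.

Lemma hbase_gt0 n : 0 < 1 + freq n ^+ 2.
Proof. by rewrite (lt_le_trans ltr01)// hbase_ge1. Qed.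

(* By Cauchy-Schwarz the H^s norm controls the C^2 norm when these terms are summable. *)
Definition qterm (s : R) n : R := mult n * hweight (2 - s) n.

(** The comparison of [n^(-1-de)] with a telescoping difference of [n^(-de)], in exponential form.
    Both [ln (n + 2) - ln (n + 1) >= 1 / (n + 2)] and the final bound come from
    [expR x >= 1 + x]. *)
Lemma telescope_powR (de : R) (n : nat) : 0 < de ->
  de * expR (- (de + 1) * ln n.+2%:R) <= expR (- de * ln n.+1%:R) - expR (- de * ln n.+2%:R).
Proof.
move=> de0; set l1 := ln n.+1%:R; set l2 := ln n.+2%:R.
have n1 : 0 < n.+1%:R :> R by rewrite ltr0n.
have n2 : 0 < n.+2%:R :> R by rewrite ltr0n.
have e2 : expR (- l2) = n.+2%:R^-1 by rewrite expRN lnK// posrE.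
have e1 : expR l1 = n.+1%:R by rewrite lnK// posrE.
have h1 : n.+2%:R^-1 <= l2 - l1.
  have := expR_ge1Dx (l1 - l2); rewrite expRD e1 e2.
  have -> : n.+1%:R / n.+2%:R = 1 - n.+2%:R^-1 :> R.
    have e : n.+1%:R = n.+2%:R - 1 :> R by rewrite -[n.+2%:R]natr1 addrK.
    by rewrite e mulrBl divff ?lt0r_neq0// mul1r.
  by move: (n.+2%:R^-1) => r; lra.
have -> : - (de + 1) * l2 = - de * l2 + - l2 by ring.
have -> : - de * l1 = - de * l2 + de * (l2 - l1) by ring.
rewrite !expRD e2 -[X in _ - X]mulr1 -mulrBr mulrCA.
rewrite ler_pM2l ?expR_gt0//.
have := expR_ge1Dx (de * (l2 - l1)).
have : de * n.+2%:R^-1 <= de * (l2 - l1) by rewrite ler_pM2l.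
by move: (n.+2%:R^-1) => r; lra.
Qed.

Lemma qterm_ge0 s n : 0 <= qterm s n.
Proof. by rewrite mulr_ge0 ?mult_ge0 ?hweight_ge0. Qed.

(** The terms decay like [n^(4 - 2 s)], that is [n^(-1-de)] with [de = 2 s - 5]; this is where
    [s > 5/2] is decisive. *)
Lemma qterm_summable s : 5 / 2 < s -> cvgn (series (qterm s)).
Proof.
move=> hs; pose de := 2 * s - 5; have de0 : 0 < de by rewrite /de; lra.
have mu0 := wavenumber_gt0 hab; set mu := wavenumber a b in mu0.
(* Collects the multiplicity 2, the power of the wavenumber, and the factor [de] lost in
   telescoping. *)
pose K := 2 * expR (- (de + 1) * ln mu) / de.
have K0 : 0 <= K by rewrite divr_ge0 ?mulr_ge0 ?expR_ge0// ltW.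
have qle n : qterm s n.+2 <= K * (expR (- de * ln n.+1%:R) - expR (- de * ln n.+2%:R)).
  apply: (@le_trans _ _ (K * (de * expR (- (de + 1) * ln n.+2%:R)))); last first.
    by rewrite ler_wpM2l// telescope_powR.
  have -> : K * (de * expR (- (de + 1) * ln n.+2%:R)) =
     2 * (expR (- (de + 1) * ln mu) * expR (- (de + 1) * ln n.+2%:R)).
    by rewrite /K; field; rewrite lt0r_neq0.
  rewrite -expRD /qterm /= ler_pM2l// /hweight /powR gt_eqF ?hbase_gt0// ler_expR.
  have n2 : 0 < n.+2%:R :> R by rewrite ltr0n.
  have f0 : 0 < freq n.+2 by rewrite mulr_gt0.
  have h1 : 2 * (ln n.+2%:R + ln mu) <= ln (1 + freq n.+2 ^+ 2).
    have -> : 2 * (ln n.+2%:R + ln mu) = ln (freq n.+2 ^+ 2).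
      by rewrite lnXn// /freq lnM ?posrE// mulr_natl.
    by rewrite ler_ln ?posrE ?hbase_gt0 ?exprn_gt0// lerDr.
  have : (2 - s) * ln (1 + freq n.+2 ^+ 2) <= (2 - s) * (2 * (ln n.+2%:R + ln mu)).
    by rewrite ler_nM2l//; lra.
  by rewrite /de; lra.
have bd n : series (qterm s) n.+2 <= qterm s 0 + qterm s 1 + K * (1 - expR (- de * ln n.+1%:R)).
  elim: n => [|n ih].
    by rewrite ln1 mulr0 expR0 subrr mulr0 addr0 /series /= !big_nat_recr//= big_geq// add0r.
  have -> : series (qterm s) n.+3 = series (qterm s) n.+2 + qterm s n.+2.
    by rewrite /series /= big_nat_recr.
  by have := qle n; lra.
have nd : {homo series (qterm s) : n m / (n <= m)%N >-> n <= m}.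
  by apply/nondecreasing_seqP => n; rewrite /series/= big_nat_recr//= lerDl qterm_ge0.
apply: nondecreasing_is_cvgn => //.
exists (qterm s 0 + qterm s 1 + K) => _ [n _ <-].
apply: le_trans (nd n n.+2 _) _; first by rewrite -addn2 leq_addr.
apply: le_trans (bd n) _; rewrite lerD2l.
by rewrite -[leRHS]mulr1 ler_wpM2l// gerBl expR_ge0.
Qed.

Definition qsum s := limn (series (qterm s)).

Lemma qsum_ge0 s : 5 / 2 < s -> 0 <= qsum s.
Proof.
move=> hs; apply: limr_ge; first exact: qterm_summable.
by near=> n; rewrite /series/= sumr_ge0// => i _; exact: qterm_ge0.
Unshelve. all: by end_near.
Qed.

(** Young's inequality for [W |A| = (W^(s/2) |A|) W^(1 - s/2)]. The free parameter [lam] replaces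
    the square root of Cauchy-Schwarz and later makes the C^2 norm small together with the H^s
    norm. *)
Lemma hweight_amgm s n (A lam : R) : 0 < lam ->
  (1 + freq n ^+ 2) * `|A| <= 2^-1 * (lam^-1 * (hweight s n * A ^+ 2) + lam * hweight (2 - s) n).
Proof.
move=> lam0; have W0 := hbase_gt0 n; set W := 1 + freq n ^+ 2 in W0 *.
rewrite /hweight /= -/W.
pose x := W `^ (s / 2) * `|A|; pose y := W `^ (1 - s / 2).
have hx : W `^ s * A ^+ 2 = x ^+ 2.
  have -> : W `^ s = (W `^ (s / 2)) ^+ 2.
    by rewrite -powR_mulrn ?powR_ge0// -powRrM; congr (_ `^ _); field.
  by rewrite /x exprMn real_normK ?num_real.
have hy : W `^ (2 - s) = y ^+ 2.
  by rewrite /y -powR_mulrn ?powR_ge0// -powRrM; congr (_ `^ _); field.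
have hxy : W * `|A| = x * y.
  rewrite /x /y mulrAC -powRD; last by rewrite (gt_eqF W0) implybT.
  by rewrite addrC subrK powRr1// ltW.
rewrite hx hy hxy.
have : 0 <= lam^-1 * (x - lam * y) ^+ 2 by rewrite mulr_ge0 ?sqr_ge0// invr_ge0 ltW.
have -> : lam^-1 * (x - lam * y) ^+ 2 = lam^-1 * x ^+ 2 + lam * y ^+ 2 - 2 * (x * y).
  by field; rewrite lt0r_neq0.
lra.
Qed.

Lemma fbound_le s f n lam : 0 < lam -> fbound f n <= lam^-1 * hterm s f n + lam * qterm s n.
Proof.
move=> lam0; have m0 := @mult_ge0 R n.
have hA := hweight_amgm s n (cosc f n) lam0; have hB := hweight_amgm s n (sinc f n) lam0.
have -> : lam^-1 * hterm s f n + lam * qterm s n = mult n *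
   (lam^-1 * (hweight s n * (cosc f n ^+ 2 + sinc f n ^+ 2)) + lam * hweight (2 - s) n).
  by rewrite /hterm /qterm /=; ring.
rewrite /fbound /= -mulrA; apply: ler_wpM2l; first exact: m0.
rewrite mulrDr; apply: le_trans (lerD hA hB) _.
have : 0 <= lam^-1 * (hweight s n * (cosc f n ^+ 2 + sinc f n ^+ 2)).
  by rewrite !mulr_ge0 ?hweight_ge0 ?addr_ge0 ?sqr_ge0// invr_ge0 ltW.
by move: (lam^-1) (hweight s n) (cosc f n ^+ 2) (sinc f n ^+ 2) => li w c2 s2; lra.
Qed.

Lemma sobolev_cts s f : sobolev s f -> cts f.
Proof. by case=> _ /continuousP_cts. Qed.

Lemma Hnorm2_ge0 s f : (0 <= Hnorm2 s f)%E.
Proof.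
by apply: esum_ge0 => k _; rewrite lee_fin mulr_ge0 ?powR_ge0// sqr_ge0.
Qed.

Lemma sobolev_series s f : sobolev s f ->
  cvgn (series (hterm s f)) /\ Hnorm2 s f = (limn (series (hterm s f)))%:E.
Proof.
move=> sf; have cf := sobolev_cts sf; case: sf => _ _.
by rewrite Hnorm2E//; apply: nnseries_real => n; exact: hterm_ge0.
Qed.

Lemma sobolev_fbound s f : 5 / 2 < s -> sobolev s f -> cvgn (series (fbound f)) /\
  forall lam, 0 < lam -> limn (series (fbound f)) <= lam^-1 * fine (Hnorm2 s f) + lam * qsum s.
Proof.
move=> hs sf; have [ch ->] := sobolev_series sf; have cq := qterm_summable hs.
(* The innermost series is zero, there only to scale the series of [qterm]. *)
have cv lam := @cvg_series_lin _ lam^-1 _ _ _ _ ch (@cvg_series_lin _ lam _ _ _ _ cq (@cvg_series_single _ 0%N 0)).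
have b0 n : 0 <= fbound f n.
  apply: mulr_ge0; last by rewrite addr_ge0.
  by apply: mulr_ge0; [exact: mult_ge0|rewrite ltW ?hbase_gt0].
have le lam n : 0 < lam -> fbound f n <= lam^-1 * hterm s f n + (lam * qterm s n + (if n == 0%N then 0 else 0)).
  by move=> lam0; rewrite if_same addr0; exact: fbound_le.
have cb : cvgn (series (fbound f)).
  apply: series_le_cvg (cvgP _ (cv 1)) => // n; last exact: le.
  by apply: le_trans (le 1 n ltr01).
split => // lam lam0; rewrite /= -[lam * qsum s]addr0 -(cvg_lim _ (cv lam))//.
by apply: lim_series_le (cvgP _ (cv lam)) _ => // n; exact: le.
Qed.

Lemma hweight1 n : hweight 1 n = 1 + freq n ^+ 2.
Proof. by rewrite /hweight powRr1// ltW// hbase_gt0. Qed.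

Lemma sobolev_C2 s f : 5 / 2 < s -> sobolev s f ->
  exists f1 f2, [/\ C2p f f1 f2,
    forall lam, 0 < lam -> forall x, [/\ `|f x| <= lam^-1 * fine (Hnorm2 s f) + lam * qsum s,
      `|f1 x| <= lam^-1 * fine (Hnorm2 s f) + lam * qsum s &
      `|f2 x| <= lam^-1 * fine (Hnorm2 s f) + lam * qsum s] &
    Hnorm2 1 f = (L^-1 * RI a b (fun x => f x * (f x - f2 x)))%:E].
Proof.
move=> hs sf; have cf := sobolev_cts sf; have [cb lb] := sobolev_fbound hs sf.
have pf : periodic f by case: sf.
have [f1 [f2 [C2f bf sr]]] := fourier_C2 hab cf pf cb.
exists f1, f2; split=> //.
  move=> lam lam0 x; have [h0 h1 h2] := bf x; have hl := lb lam lam0.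
  by split; apply: le_trans hl.
rewrite Hnorm2E//.
have e : hterm 1 f = fun n => mult n * (1 + freq n ^+ 2) * (cosc f n ^+ 2 + sinc f n ^+ 2).
  by apply/funext => n; rewrite /hterm hweight1 mulrA.
rewrite e nnseries_EFin; last exact: cvgP sr.
by rewrite (cvg_lim _ sr).
Qed.

Lemma Hnorm2_le r r' f : r <= r' -> cts f -> (Hnorm2 r f <= Hnorm2 r' f)%E.
Proof.
move=> rr cf; rewrite !Hnorm2E//; apply: lee_nneseries => n _.
  by rewrite lee_fin; move=> _; exact: hterm_ge0.
rewrite lee_fin /hterm ler_wpM2l ?mult_ge0// ler_wpM2r ?addr_ge0 ?sqr_ge0//.
by rewrite /hweight ler_powR// hbase_ge1.
Qed.

Lemma cosc_lin c f g n : cts f -> cts g -> cosc (fun x => c * f x + g x) n = c * cosc f n + cosc g n.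
Proof.
move=> cf cg; have cc := @cts_fcos R a b n; rewrite /cosc mulrCA -mulrDr.
rewrite -RI_lin; [|exact: ltW|by cts_auto|by cts_auto].
by congr (_ * RI _ _ _); apply/funext => x; ring.
Qed.

Lemma sinc_lin c f g n : cts f -> cts g -> sinc (fun x => c * f x + g x) n = c * sinc f n + sinc g n.
Proof.
move=> cf cg; have cc := @cts_fsin R a b n; rewrite /sinc mulrCA -mulrDr.
rewrite -RI_lin; [|exact: ltW|by cts_auto|by cts_auto].
by congr (_ * RI _ _ _); apply/funext => x; ring.
Qed.

Lemma Hnorm2_lin r c f g : cts f -> cts g ->
  (Hnorm2 r (fun x => c * f x + g x)%R <= (2 * c ^+ 2)%:E * Hnorm2 r f + 2%:E * Hnorm2 r g)%E.
Proof.
move=> cf cg; have cfg : cts (fun x => c * f x + g x) by cts_auto.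
rewrite !Hnorm2E// -!nneseriesZl; try by move=> *; rewrite lee_fin hterm_ge0.
rewrite -nneseriesD; last 2 first.
- by move=> n _ _; rewrite mule_ge0// lee_fin ?hterm_ge0// mulr_ge0// sqr_ge0.
- by move=> n _ _; rewrite mule_ge0// lee_fin ?hterm_ge0.
apply: lee_nneseries => n _; first by move=> _; rewrite lee_fin hterm_ge0.
rewrite -!EFinM -EFinD lee_fin /hterm cosc_lin// sinc_lin//.
have -> : 2 * c ^+ 2 * (mult n * (hweight r n * (cosc f n ^+ 2 + sinc f n ^+ 2))) +
  2 * (mult n * (hweight r n * (cosc g n ^+ 2 + sinc g n ^+ 2))) =
  mult n * (hweight r n * (2 * c ^+ 2 * (cosc f n ^+ 2 + sinc f n ^+ 2) + 2 * (cosc g n ^+ 2 + sinc g n ^+ 2))).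
  by ring.
apply: ler_wpM2l; first exact: mult_ge0.
apply: ler_wpM2l; first exact: hweight_ge0.
have : 0 <= (c * cosc f n - cosc g n) ^+ 2 by rewrite sqr_ge0.
have : 0 <= (c * sinc f n - sinc g n) ^+ 2 by rewrite sqr_ge0.
lra.
Qed.

Lemma sobolev_lin s c f g : sobolev s f -> sobolev s g -> sobolev s (fun x => c * f x + g x)%R.
Proof.
move=> sf sg; have cf := sobolev_cts sf; have cg := sobolev_cts sg.
have [pf _ Nf] := sf; have [pg _ Ng] := sg; split.
- by move=> x; rewrite pf pg.
- by apply/continuousP_cts; cts_auto.
- apply: le_lt_trans (Hnorm2_lin s c cf cg) _.
  by rewrite lte_add_pinfty// lte_mul_pinfty// lee_fin// mulr_ge0// sqr_ge0.
Qed.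

(** [Lam] divides each Fourier coefficient by [1 + freq n ^+ 2], which is worth two orders of
    regularity. *)
Lemma Hnorm2_Lam s f : cts f -> periodic f -> Hnorm2 s (Lam a b f) = Hnorm2 (s - 2) f.
Proof.
move=> cf pf; have [g1 [pg dg dg1]] := Lam_spec hab cf pf; set g := Lam a b f in pg dg dg1 *.
have cg := der_cts dg.
have C2g : C2p g g1 (fun x => g x - f x) by split => //; cts_auto.
rewrite !Hnorm2E//; apply: eq_eseriesr => n _; congr EFin; rewrite /hterm; congr (_ * _).
have [ec es] := cosc_second hab n C2g.
have fE : (fun x => g x - (g x - f x)) = f by apply/funext => x; ring.
rewrite fE in ec es; rewrite ec es.
have E (w c t W : R) : w * ((W * c) ^+ 2 + (W * t) ^+ 2) = (w * W ^+ 2) * (c ^+ 2 + t ^+ 2) by ring.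
rewrite E; congr (_ * _).
have W0 := hbase_gt0 n; have e2 := powR_mulrn 2 (ltW W0).
rewrite /hweight /= -e2 -powRD; first by rewrite subrK.
by rewrite (gt_eqF W0) implybT.
Qed.

Lemma sobolev_Lam s f : sobolev (s - 2) f -> sobolev s (Lam a b f).
Proof.
move=> sf; have cf := sobolev_cts sf; have [pf _ Nf] := sf.
have [g1 [pg dg dg1]] := Lam_spec hab cf pf; split=> //.
  by apply/continuousP_cts; exact: der_cts dg.
by rewrite Hnorm2_Lam.
Qed.
End SobolevEmbedding.
(** The factor [1/L] is that of the Fourier coefficients, so that [hdot f f] is [Hnorm2 1 f] on H^s,
    as [sobolev_hdot] shows. *)
HB.lock Definition hdot {R : realType} (a b : R) (f g : R -> R) : R :=
  (b - a)^-1 * RI a b (fun x => f x * g x + (f^`())%classic x * (g^`())%classic x).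

(** * The H^1 inner product on C^2 functions *)

Section EnergyForm.
Context {R : realType}.
Variables a b : R.
Hypothesis hab : a < b.
Implicit Types f g h : R -> R.

Local Notation L := (b - a).
Local Notation periodic := (Defs.periodic a b).
Local Notation C2p := (C2p a b).

Local Notation hdot := (hdot a b).

Definition C2 f : Prop := exists f1 f2, C2p f f1 f2.

Definition C2le (K : R) f : Prop := exists f1 f2, C2p f f1 f2 /\
  forall x, [/\ `|f x| <= K, `|f1 x| <= K & `|f2 x| <= K].

Lemma C2le_C2 K f : C2le K f -> C2 f.
Proof. by move=> [f1 [f2 [C2f _]]]; exists f1, f2. Qed.

Lemma C2_lin c f g : C2 f -> C2 g -> C2 (fun x => c * f x + g x).
Proof.
move=> [f1 [f2 C2f]] [g1 [g2 C2g]]; do 2 eexists; exact: C2p_lin C2f C2g.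
Qed.

Lemma C2_sub f g : C2 f -> C2 g -> C2 (fun x => f x - g x).
Proof.
move=> Cf Cg; have := C2_lin (-1) Cg Cf.
by congr C2; apply/funext => x; ring.
Qed.

Lemma C2_add f g : C2 f -> C2 g -> C2 (fun x => f x + g x).
Proof.
move=> Cf Cg; have := C2_lin 1 Cf Cg.
by congr C2; apply/funext => x; ring.
Qed.

Lemma C2le_lin c K K' f g : C2le K f -> C2le K' g -> C2le (`|c| * K + K') (fun x => c * f x + g x).
Proof.
move=> [f1 [f2 [C2f fK]]] [g1 [g2 [C2g gK]]].
exists (fun x => c * f1 x + g1 x), (fun x => c * f2 x + g2 x); split.
  exact: C2p_lin.
have e (t u : R) : `|t| <= K -> `|u| <= K' -> `|c * t + u| <= `|c| * K + K'.
  by move=> tK uK; rewrite (le_trans (ler_normD _ _))// normrM lerD// ler_wpM2l.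
by move=> x; have [a0 a1 a2] := fK x; have [b0 b1 b2] := gK x; split; apply: e.
Qed.

Lemma C2le_weaken K K' f : K <= K' -> C2le K f -> C2le K' f.
Proof.
move=> KK [f1 [f2 [C2f fK]]]; exists f1, f2; split=> // x.
by have [a0 a1 a2] := fK x; split; apply: le_trans KK.
Qed.

Lemma C2le_sub K K' f g : C2le K f -> C2le K' g -> C2le (K + K') (fun x => f x - g x).
Proof.
move=> Cf Cg; have := C2le_lin (-1) Cg Cf; rewrite normrN normr1 mul1r addrC.
by congr C2le; apply/funext => x; ring.
Qed.

Lemma C2le_add K K' f g : C2le K f -> C2le K' g -> C2le (K + K') (fun x => f x + g x).
Proof.
move=> Cf Cg; have := C2le_lin 1 Cf Cg; rewrite normr1 mul1r.
by congr C2le; apply/funext => x; ring.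
Qed.

Lemma hdotC f g : hdot f g = hdot g f.
Proof.
by rewrite hdot.unlock; congr (_ * RI _ _ _); apply/funext => x; rewrite mulrC [X in _ + X]mulrC.
Qed.

(** Integration by parts moves the derivative off [f]. Only the values of [f] remain, so a sup bound
    on it suffices in pairings with C^2 functions. *)
Lemma hdotE f f1 f2 g g1 g2 : C2p f f1 f2 -> C2p g g1 g2 ->
  hdot f g = L^-1 * RI a b (fun x => f x * (g x - g2 x)).
Proof.
move=> [pf df df1 cf2] [pg dg dg1 cg2]; rewrite hdot.unlock (der_derive1 df) (der_derive1 dg).
have pg1 := der_periodic pg dg.
congr (_ * _); apply/eqP; rewrite -subr_eq0 -RI_sub; [|exact: ltW|by cts_auto|by cts_auto].
apply/eqP; apply: (@RI_der_periodic _ _ _ hab (fun x => f x * g1 x)).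
- by move=> x; rewrite pf pg1.
- by der_auto; ring.
- by cts_auto.
Qed.

Lemma hdot_ge0 f : C2 f -> 0 <= hdot f f.
Proof.
move=> [f1 [f2 [_ df df1 _]]]; rewrite hdot.unlock (der_derive1 df).
rewrite mulr_ge0 ?invr_ge0 ?(ltW (L_gt0 hab))//.
have h : RI a b (fun=> 0) <= RI a b (fun x => f x * f x + f1 x * f1 x).
  apply: RI_le; [exact: ltW|exact: cts_cst|by cts_auto|].
  by move=> z _; rewrite addr_ge0// -expr2 sqr_ge0.
by rewrite RI_cst ?mul0r ?(ltW hab) in h.
Qed.

Lemma hdot_linl c f g h : C2 f -> C2 g -> C2 h ->
  hdot (fun x => c * f x + g x) h = c * hdot f h + hdot g h.
Proof.
move=> [f1 [f2 Cf]] [g1 [g2 Cg]] [h1 [h2 Ch]].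
rewrite (hdotE (C2p_lin c Cf Cg) Ch) (hdotE Cf Ch) (hdotE Cg Ch).
case: Cf Cg Ch => [_ df df1 cf2] [_ dg dg1 cg2] [_ dh dh1 ch2].
rewrite mulrCA -mulrDr -RI_lin; [|exact: ltW|by cts_auto|by cts_auto].
by congr (_ * RI _ _ _); apply/funext => x; ring.
Qed.

Lemma hdot_linr c f g h : C2 f -> C2 g -> C2 h ->
  hdot h (fun x => c * f x + g x) = c * hdot h f + hdot h g.
Proof. by move=> Cf Cg Ch; rewrite hdotC (hdot_linl c Cf Cg Ch) (hdotC f) (hdotC g). Qed.

Lemma hdot_addl f g h : C2 f -> C2 g -> C2 h ->
  hdot (fun x => f x + g x) h = hdot f h + hdot g h.
Proof.
move=> Cf Cg Ch; have e : (fun x => f x + g x) = (fun x => 1 * f x + g x) by apply/funext => x; rewrite mul1r.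
by rewrite e (hdot_linl 1 Cf Cg Ch) mul1r.
Qed.

Lemma hdot_addr f g h : C2 f -> C2 g -> C2 h ->
  hdot h (fun x => f x + g x) = hdot h f + hdot h g.
Proof. by move=> Cf Cg Ch; rewrite hdotC (hdot_addl Cf Cg Ch) (hdotC f) (hdotC g). Qed.

Lemma hdot_subl f g h : C2 f -> C2 g -> C2 h ->
  hdot (fun x => f x - g x) h = hdot f h - hdot g h.
Proof.
move=> Cf Cg Ch; have e : (fun x => f x - g x) = (fun x => -1 * g x + f x) by apply/funext => x; ring.
by rewrite e (hdot_linl (-1) Cg Cf Ch) mulN1r addrC.
Qed.

Lemma hdot_subr f g h : C2 f -> C2 g -> C2 h ->
  hdot h (fun x => f x - g x) = hdot h f - hdot h g.
Proof. by move=> Cf Cg Ch; rewrite hdotC (hdot_subl Cf Cg Ch) (hdotC f) (hdotC g). Qed.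

Lemma hdot_lin_sq c f g : C2 f -> C2 g -> let h := fun x => c * f x + g x in
  hdot h h = c ^+ 2 * hdot f f + 2 * c * hdot f g + hdot g g.
Proof.
move=> Cf Cg h; have Ch := C2_lin c Cf Cg.
rewrite (hdot_linl c Cf Cg Ch) (hdot_linr c Cf Cg Cf) (hdot_linr c Cf Cg Cg) (hdotC g f); ring.
Qed.

Lemma hdot_CS f g : C2 f -> C2 g -> hdot f g ^+ 2 <= hdot f f * hdot g g.
Proof.
move=> Cf Cg; have q c : 0 <= c ^+ 2 * hdot f f + 2 * c * hdot f g + hdot g g.
  by rewrite -(hdot_lin_sq c Cf Cg); apply/hdot_ge0/C2_lin.
have := hdot_ge0 Cf; rewrite le_eqVlt => /predU1P[f0|f0].
  rewrite -f0 mul0r; have [->|ne] := eqVneq (hdot f g) 0; first by rewrite expr0n.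
  (* When [f] has norm zero the quadratic is affine in [c]; at this point it would equal -1. *)
  have := q (- (hdot g g + 1) / (2 * hdot f g)); rewrite -f0 mulr0 add0r.
  have -> : 2 * (- (hdot g g + 1) / (2 * hdot f g)) * hdot f g + hdot g g = -1 by field.
  by rewrite oppr_ge0 leNgt ltr01.
have := q (- hdot f g / hdot f f).
have -> : (- hdot f g / hdot f f) ^+ 2 * hdot f f + 2 * (- hdot f g / hdot f f) * hdot f g + hdot g g
   = (hdot f f * hdot g g - hdot f g ^+ 2) / hdot f f by field; exact: lt0r_neq0.
by rewrite pmulr_lge0 ?invr_gt0// subr_ge0.
Qed.

Lemma hdot_amgm (lam : R) f g : 0 < lam -> C2 f -> C2 g ->
  `|hdot f g| <= lam * hdot f f + lam^-1 * hdot g g.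
Proof.
move=> l0 Cf Cg; have q c : 0 <= c ^+ 2 * hdot f f + 2 * c * hdot f g + hdot g g.
  by rewrite -(hdot_lin_sq c Cf Cg); apply/hdot_ge0/C2_lin.
have := hdot_ge0 Cf; have := hdot_ge0 Cg; have := q lam; have := q (- lam).
move: (hdot f f) (hdot f g) (hdot g g) => F X G h1 h2 G0 F0.
have i0 : 0 < lam^-1 by rewrite invr_gt0.
have e1 : lam^-1 * ((- lam) ^+ 2 * F + 2 * (- lam) * X + G) = lam * F - 2 * X + lam^-1 * G.
  by field; exact: lt0r_neq0.
have e2 : lam^-1 * (lam ^+ 2 * F + 2 * lam * X + G) = lam * F + 2 * X + lam^-1 * G.
  by field; exact: lt0r_neq0.
have k1 := mulr_ge0 (ltW i0) h1; have k2 := mulr_ge0 (ltW i0) h2; rewrite e1 in k1; rewrite e2 in k2.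
have k3 := mulr_ge0 (ltW l0) F0; have k4 := mulr_ge0 (ltW i0) G0.
by move: (lam^-1 * G) (lam * F) k1 k2 k3 k4 => A B k1 k2 k3 k4; rewrite ler_norml; apply/andP; split; lra.
Qed.

Lemma hdot_bound f g (A B : R) : C2 f -> (forall x, `|f x| <= A) -> C2le B g ->
  `|hdot f g| <= A * (2 * B).
Proof.
move=> [f1 [f2 Cf]] fA [g1 [g2 [Cg gB]]]; rewrite (hdotE Cf Cg).
have L0 := L_gt0 hab.
rewrite normrM ger0_norm ?invr_ge0 ?(ltW L0)// mulrC ler_pdivrMr//.
case: Cf Cg => [_ df df1 cf2] [_ dg dg1 cg2].
apply: RI_bound; [exact: ltW|by cts_auto|].
move=> z _; have [g0 _ g2'] := gB z.
rewrite normrM ler_pM// (le_trans (ler_normB _ _))//; lra.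
Qed.

Variable s : R.
Hypothesis hs : 5 / 2 < s.
Local Notation sobolev := (sobolev a b s).
Local Notation Hnorm2 := (Hnorm2 a b).

Lemma sobolev_hdot f : sobolev f -> C2 f /\ Hnorm2 1 f = (hdot f f)%:E.
Proof.
move=> sf; have [f1 [f2 [Cf _ e]]] := sobolev_C2 hab hs sf.
by split; [exists f1, f2|rewrite e (hdotE Cf Cf)].
Qed.

Lemma sobolev_fin f : sobolev f -> Hnorm2 s f = (fine (Hnorm2 s f))%:E.
Proof. by move=> [_ _ Nf]; rewrite fineK// ge0_fin_numE// Hnorm2_ge0. Qed.

Lemma sobolev_hdot_le f : sobolev f -> hdot f f <= fine (Hnorm2 s f).
Proof.
move=> sf; have [_ e] := sobolev_hdot sf; rewrite -lee_fin -e -sobolev_fin//.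
apply: Hnorm2_le => //; last exact: sobolev_cts sf.
by have := hs; lra.
Qed.

Lemma sobolev_bounded f : sobolev f -> exists K, C2le K f.
Proof.
move=> sf; have [f1 [f2 [Cf bf _]]] := sobolev_C2 hab hs sf.
by eexists; exists f1, f2; split=> // x; apply: (bf 1 ltr01 x).
Qed.

Lemma sobolev_small (eps : R) : 0 < eps ->
  exists2 eta : R, 0 < eta & forall f, sobolev f -> (Hnorm2 s f < eta%:E)%E -> C2le eps f.
Proof.
move=> e0; have S0 := qsum_ge0 hab hs; pose S := qsum a b s.
(* Makes [lam * S] at most [eps / 2]; the radius [lam * (eps / 2)] does the same for the other term.
   The added 1 avoids division by zero. *)
pose lam := eps / (2 * (S + 1)).
have S1 : 0 < 2 * (S + 1) by rewrite mulr_gt0// ltr_wpDl.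
have lam0 : 0 < lam by rewrite divr_gt0.
exists (lam * (eps / 2)); first by rewrite mulr_gt0// divr_gt0.
move=> f sf; rewrite sobolev_fin// lte_fin => fN.
have [f1 [f2 [Cf bf _]]] := sobolev_C2 hab hs sf.
suff h : lam^-1 * fine (Hnorm2 s f) + lam * S <= eps.
  by exists f1, f2; split=> // x; have [h0 h1 h2] := bf _ lam0 x; split; apply: le_trans h.
have h1 : lam^-1 * fine (Hnorm2 s f) <= eps / 2 by rewrite mulrC ler_pdivrMr// mulrC ltW.
have h2 : lam * S <= eps / 2.
  rewrite /lam mulrAC ler_pdivrMr//.
  have -> : eps / 2 * (2 * (S + 1)) = eps * S + eps by field.
  lra.
lra.
Qed.
End EnergyForm.

(** Compactness of the segment, phrased with a parameter [k] tending to 0 from the right. Uniform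
    continuity and boundedness of paths are both instances. *)
Lemma segment_uniform {R : realType} (T : R) (P : R -> R -> Prop) :
  (forall k k' t, 0 < k -> k <= k' -> P k' t -> P k t) ->
  (forall t, 0 <= t <= T -> exists2 d, 0 < d &
     forall t', 0 <= t' <= T -> `|t' - t| < d -> P d t') ->
  exists2 d, 0 < d & forall t, 0 <= t <= T -> P d t.
Proof.
move=> mono loc.
have /compact_near_coveringP cov := @segment_compact R 0 T.
have := cov R 0^'+ (fun k t => 0 <= t <= T -> P k t) _.
case.
- move=> t /=; rewrite in_itv/= => tT; have [d d0 hd] := loc t tT.
  exists (ball t d, [set k | 0 < k <= d]).
    split; first exact: nbhsx_ballx.
    near=> k => /=; apply/andP; split => //; near: k; exact: nbhs_right_le.
  move=> [t' k] /= [bt /andP[k0 kd]] t'T; apply: (mono k d) => //.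
  by apply: hd => //; rewrite distrC.
- move=> d /= d0 h; exists (d / 2); first by rewrite divr_gt0.
  move=> t tT; apply: (h (d / 2)) => //=.
  + by rewrite sub0r normrN gtr0_norm ?divr_gt0//; lra.
  + by rewrite divr_gt0.
Unshelve. all: by end_near.
Qed.

(** * The energy balance along one path *)

Section Pathwise.
Context {R : realType}.
Variables a b s T : R.
Hypothesis hab : a < b.
Hypothesis hs : 5 / 2 < s.
Hypothesis T0 : 0 < T.

Local Notation sobolev := (sobolev a b s).
Local Notation Hnorm2 := (Hnorm2 a b).
Local Notation C2p := (C2p a b).
Local Notation C2 := (C2 a b).
Local Notation C2le := (C2le a b).
Local Notation hdot := (hdot a b).
Local Notation drift := (drift a b).

Definition sobolev_on (v : R -> R -> R) : Prop :=
  (forall t, 0 <= t <= T -> sobolev (v t)) /\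
  forall t eps, 0 <= t <= T -> 0 < eps -> exists2 d, 0 < d &
    forall t', 0 <= t' <= T -> `|t' - t| < d -> (Hnorm2 s (v t' \- v t)%R < eps%:E)%E.

Lemma sobolev_path_on sigma v : (T%:E < sigma)%E -> sobolev_path a b s sigma v -> sobolev_on v.
Proof.
move=> Ts hv; have lts t : 0 <= t <= T -> (t%:E < sigma)%E.
  by move=> /andP[_ tT]; apply: le_lt_trans Ts; rewrite lee_fin.
split=> [t tT|t eps tT e0]; have [t0 _] := andP tT; have [st ct] := hv t t0 (lts t tT) => //.
have h0 : nbhs (0 : \bar R)%E [set x | (x < eps%:E)%E].
  by apply: open_nbhs_nbhs; split; [exact: open_ereal_lt_ereal|rewrite /= lte_fin].
have /nbhs_ballP[d /= d0 hd] : \forall t' \near t,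
  (0 <= t')%R -> (Hnorm2 s (v t' \- v t)%R < eps%:E)%E := ct _ h0.
exists d => // t' /andP[t'0 _] tt'; apply: hd => //.
by rewrite /ball/= distrC.
Qed.

Lemma sobolev_sub f g : sobolev f -> sobolev g -> sobolev (f \- g).
Proof.
move=> sf sg; have := sobolev_lin hab (-1) sg sf.
by congr (sobolev); apply/funext => x /=; ring.
Qed.

(** Smallness in H^s gives smallness in C^2 by [sobolev_small], and compactness turns continuity in
    time into uniform continuity. *)
Lemma path_C2 v (eps : R) : sobolev_on v -> 0 < eps -> exists2 d, 0 < d &
  forall t t', 0 <= t <= T -> 0 <= t' <= T -> `|t' - t| < d -> C2le eps (v t' \- v t).
Proof.
move=> [sv cv] e0.
have [|t tT|d d0 hd] := @segment_uniform R T (fun k t => forall t', 0 <= t' <= T ->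
  `|t' - t| < k -> C2le eps (v t' \- v t)).
- by move=> k k' t _ kk' h t' t'T tk; apply: h => //; apply: lt_le_trans tk kk'.
- have e2 : 0 < eps / 2 by rewrite divr_gt0.
  have [eta eta0 small] := sobolev_small hab hs e2.
  have [d d0 hd] := cv t eta tT eta0.
  (* Half of [d], so that two times, each within [d / 2] of the next, all stay within [d] of [t]. *)
  exists (d / 2); first by rewrite divr_gt0.
  move=> t' t'T tt' t'' t''T tt''.
  have near r : 0 <= r <= T -> `|r - t| < d -> C2le (eps / 2) (v r \- v t).
    by move=> rT rd; apply: small; [exact: sobolev_sub (sv r rT) (sv t tT)|exact: hd].
  have h1 : C2le (eps / 2) (v t' \- v t) by apply: near => //; lra.
  have h2 : C2le (eps / 2) (v t'' \- v t).
    apply: near => //; have -> : t'' - t = (t'' - t') + (t' - t) by ring.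
    by apply: le_lt_trans (ler_normD _ _) _; lra.
  have := C2le_sub h2 h1.
  have -> : eps / 2 + eps / 2 = eps by field.
  by congr (C2le _); apply/funext => x /=; ring.
- by exists d => // t t' tT t'T; apply: hd.
Qed.

Lemma path_bounded v : sobolev_on v -> exists2 K, 1 <= K & forall t, 0 <= t <= T -> C2le K (v t).
Proof.
move=> sv; have [svt _] := sv; have [d d0 hd] := path_C2 sv ltr01.
(* The bound is encoded as [k^-1], because [segment_uniform] delivers a small parameter. *)
have [|t tT|k k0 hk] := @segment_uniform R T (fun k t => C2le k^-1 (v t)).
- move=> k k' t k0 kk' h; apply: C2le_weaken h.
  by rewrite lef_pV2// posrE (lt_le_trans k0).
- have [K CK] := sobolev_bounded hab hs (svt t tT).
  have K0 : 0 < 1 + `|K| by rewrite ltr_pwDl.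
  pose e := Num.min d (1 + `|K|)^-1.
  have e0 : 0 < e by rewrite lt_min d0 invr_gt0.
  exists e => // t' t'T tt'.
  have h1 : C2le 1 (v t' \- v t) by apply: hd => //; apply: lt_le_trans tt' _; rewrite ge_min lexx.
  have h2 : C2le (1 + K) (v t').
    have := C2le_add h1 CK; congr (C2le _); apply/funext => x /=; ring.
  apply: C2le_weaken h2; apply: (@le_trans _ _ (1 + `|K|)).
    by rewrite lerD2l ler_norm.
  by rewrite -[leLHS]invrK lef_pV2 ?posrE ?invr_gt0// ge_min lexx orbT.
- exists (1 + k^-1); first by rewrite lerDl invr_ge0 ltW.
  move=> t tT; apply: C2le_weaken (hk t tT).
  by rewrite lerDr.
Qed.

Lemma drift_C2le_lip K d v w : C2le K v -> C2le K w -> C2le d (v \- w) ->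
  forall x, `|drift v x - drift w x| <= 8 * K * d.
Proof.
move=> [v1 [v2 [Cv bv]]] [w1 [w2 [Cw bw]]] [z1 [z2 [Cz bz]]].
have Cz' : C2p (v \- w) (fun x => v1 x - w1 x) (fun x => v2 x - w2 x).
  have := C2p_lin (-1) Cw Cv; congr (C2p _ _ _); apply/funext => x /=; ring.
have [e1 e2] := C2p_uniq Cz Cz'; subst z1 z2.
have bz' x : [/\ `|v x - w x| <= d, `|v1 x - w1 x| <= d & `|v2 x - w2 x| <= d] := bz x.
exact: (drift_lip hab Cv Cw bv bw bz').
Qed.

(** Freezing the path outside [[0, T]] makes the drift continuous on the whole line, as [cts]
    demands, without changing it on [[0, T]]. *)
Definition clamp (t : R) : R := Num.max 0 (Num.min t T).

Lemma clamp_in t : 0 <= clamp t <= T.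
Proof. by rewrite /clamp le_max lexx/= ge_max ge_min lexx orbT (ltW T0). Qed.

Lemma clamp_id t : 0 <= t <= T -> clamp t = t.
Proof. by move=> /andP[t0 tT]; rewrite /clamp min_l// max_r. Qed.

Lemma clamp_lip t t' : `|clamp t - clamp t'| <= `|t - t'|.
Proof.
wlog tt' : t t' / t' <= t.
  by move=> h; have [/h//|/ltW/h] := leP t' t; rewrite distrC [leRHS]distrC.
rewrite [leRHS]ger0_norm ?subr_ge0// /clamp.
rewrite ler_norml; have T0' := T0.
case: (leP t T) => a1; case: (leP t' T) => a2; case: (leP 0 t) => a3; case: (leP 0 t') => a4;
  case: (leP 0 T) => a5; apply/andP; split; lra.
Qed.

Section Equation.
Variables (u0 : R -> R) (v m : R -> R -> R).
Hypothesis sv : sobolev_on v.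
Hypothesis sm : sobolev_on m.
Hypothesis veq : forall t, 0 <= t <= T -> forall x,
  v t x = u0 x + RI 0 t (fun t' => drift (v t') x) + m t x.

Let y t : R -> R := v t \- m t.

Lemma drift_path_cts x : cts (fun t => drift (v (clamp t)) x).
Proof.
have [K K1 bK] := path_bounded sv; apply/cts_P => t e e0.
have K0 : 0 < 8 * K by lra.
have e0' : 0 < e / (2 * (8 * K)) by rewrite divr_gt0// mulr_gt0.
have [d d0 hd] := path_C2 sv e0'.
exists d => // t' tt'.
have h := drift_C2le_lip (bK _ (clamp_in t)) (bK _ (clamp_in t')) (hd _ _ (clamp_in t') (clamp_in t) _).
apply: le_lt_trans (h _ x) _; first by apply: le_lt_trans (clamp_lip _ _) tt'.
have -> : 8 * K * (e / (2 * (8 * K))) = e / 2 by field; lra.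
lra.
Qed.

(** The increment of [y] is a time integral of the drift; freezing the drift at [t1] costs its
    Lipschitz constant times the oscillation [e]. *)
Lemma path_increment (K e t1 t2 : R) : 0 <= t1 -> t1 <= t2 -> t2 <= T ->
  (forall t, t1 <= t <= t2 -> C2le K (v t)) ->
  (forall t, t1 <= t <= t2 -> C2le e (v t \- v t1)) ->
  forall x, `|y t2 x - y t1 x - (t2 - t1) * drift (v t1) x| <= 8 * K * e * (t2 - t1).
Proof.
move=> t10 t12 t2T bK be x.
pose phi t := drift (v (clamp t)) x.
have cphi : cts phi by exact: drift_path_cts.
have yE t : 0 <= t <= T -> y t x = u0 x + RI 0 t phi.
  move=> tT; have eI : RI 0 t (fun t' => drift (v t') x) = RI 0 t phi.
    apply: eq_Rintegral => r; rewrite inE/= in_itv/= => /andP[r0 rt].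
    by rewrite /phi clamp_id// r0/=; case/andP: tT => _; apply: le_trans.
  have vE : v t x = u0 x + RI 0 t phi + m t x.
    by rewrite -eI; exact: (veq tT x).
  have yt : y t x = v t x - m t x by [].
  by rewrite yt vE; move: (RI 0 t phi) => r; rewrite addrK.
have t1T : 0 <= t1 <= T by rewrite t10 (le_trans t12).
have t2T' : 0 <= t2 <= T by rewrite (le_trans t10 t12).
rewrite (yE _ t1T) (yE _ t2T') (RI_chasles cphi t10 t12).
have -> : u0 x + (RI 0 t1 phi + RI t1 t2 phi) - (u0 x + RI 0 t1 phi) - (t2 - t1) * drift (v t1) x =
    RI t1 t2 phi - drift (v t1) x * (t2 - t1) by ring.
rewrite -(RI_cst _ t12) -RI_sub; [|exact: t12|exact: cphi|exact: cts_cst].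
apply: RI_bound; [exact: t12| |].
  by apply: cts_add; [exact: cphi|apply: cts_opp; exact: cts_cst].
move=> t t12'; have [h1 h2] := andP t12'.
have tT : 0 <= t <= T by rewrite (le_trans t10 h1) (le_trans h2 t2T).
rewrite /phi (clamp_id tT); apply: drift_C2le_lip; [exact: bK| |exact: be].
by apply: bK; rewrite lexx.
Qed.

Lemma path_C2_at t : 0 <= t <= T -> C2 (v t) /\ C2 (m t).
Proof.
by move=> tT; split; [case: (sobolev_hdot hab hs (sv.1 t tT))|case: (sobolev_hdot hab hs (sm.1 t tT))].
Qed.

(** The increment of [y] is [(t2 - t1) drift (v t1)] up to [O(e)], and the other factor is [2 v t1]
    up to [2 e]. The product of the leading parts vanishes by [drift_energy], so each remaining
    contribution carries both [e] and [t2 - t1]; their total is [80 = 2 * 16 + 48]. *)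
Lemma step_small (K e t1 t2 : R) : 0 <= t1 -> t1 <= t2 -> t2 <= T -> 1 <= K -> 0 < e -> e <= 1 ->
  (forall t, t1 <= t <= t2 -> C2le K (v t)) ->
  (forall t, t1 <= t <= t2 -> C2le e (v t \- v t1)) -> C2le e (m t2 \- m t1) ->
  `|hdot (y t2 \- y t1) (fun x => v t2 x + v t1 x + (m t2 x - m t1 x))| <= 80 * K ^+ 2 * e * (t2 - t1).
Proof.
move=> t10 t12 t2T K1 e0 e1 bK be bm.
have t1T : 0 <= t1 <= T by rewrite t10 (le_trans t12).
have t2T' : 0 <= t2 <= T by rewrite (le_trans t10 t12).
have [Cv1 Cm1] := path_C2_at t1T; have [Cv2 Cm2] := path_C2_at t2T'.
pose h := t2 - t1; have h0 : 0 <= h by rewrite subr_ge0.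
pose f := y t2 \- y t1.
have Cf : C2 f by apply: C2_sub; apply: C2_sub.
have t11 : t1 <= t1 <= t2 by rewrite lexx.
have t22 : t1 <= t2 <= t2 by rewrite lexx andbT.
have [D [cD Dle en inc]] : exists D : R -> R, [/\ cts D, forall x, `|D x| <= 4 * K ^+ 2,
    forall w1 w2, C2p (v t1) w1 w2 -> RI a b (fun x => D x * (v t1 x - w2 x)) = 0 &
    forall x, `|f x - h * D x| <= 8 * K * e * h].
  exists (drift (v t1)); have [w1 [w2 [Cw bw]]] := bK t1 t11; split.
  - exact: (@drift_cts R a b hab _ _ _ Cw).
  - exact: (drift_bound hab Cw bw).
  - move=> z1 z2 Cz; exact: (drift_energy hab Cz).
  - exact: (path_increment t10 t12 t2T bK be).
have KK : K <= K ^+ 2 by rewrite expr2 ler_peMl//; lra.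
have Ke : K * e <= K ^+ 2.
  by apply: le_trans KK; rewrite ler_piMr//; lra.
(* [12 = 8 + 4]: the error of [path_increment], with [e <= 1 <= K], and the drift itself. *)
have fle x : `|f x| <= 12 * K ^+ 2 * h.
  have -> : f x = (f x - h * D x) + h * D x by rewrite subrK.
  apply: le_trans (ler_normD _ _) _.
  have i1 := inc x.
  have i2 : `|h * D x| <= h * (4 * K ^+ 2) by rewrite normrM (ger0_norm h0) ler_wpM2l.
  have i3 : K * e * h <= K ^+ 2 * h by rewrite ler_wpM2r.
  lra.
pose r x := (v t2 x - v t1 x) + (m t2 x - m t1 x).
have Cr : C2le (e + e) r by apply: C2le_add => //; exact: be.
have gE : (fun x => v t2 x + v t1 x + (m t2 x - m t1 x)) = (fun x => 2 * v t1 x + r x).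
  by apply/funext => x; rewrite /r; ring.
rewrite gE (hdot_linr hab 2 Cv1 (C2le_C2 Cr) Cf).
apply: le_trans (ler_normD _ _) _.
have b1 : `|hdot f r| <= 12 * K ^+ 2 * h * (2 * (e + e)) := hdot_bound hab Cf fle Cr.
have b2 : `|hdot f (v t1)| <= 8 * K * e * h * (2 * K).
  have [w1 [w2 [Cw bw]]] := bK t1 t11; have [f1 [f2 Cf']] := Cf.
  rewrite (hdotE hab Cf' Cw); have {}en := en _ _ Cw; have ab := ltW hab.
  case: Cw Cf' => [_ dw dw1 cw2] [_ df df1 cf2].
  (* By orthogonality of the drift, only the error [f - h D] contributes. *)
  have -> : RI a b (fun x => f x * (v t1 x - w2 x)) = RI a b (fun x => (f x - h * D x) * (v t1 x - w2 x)).
    rewrite (_ : (fun x => f x * _) = fun x => h * (D x * (v t1 x - w2 x)) + (f x - h * D x) * (v t1 x - w2 x)).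
      by rewrite RI_lin; [rewrite en mulr0 add0r|exact: ab|cts_auto|cts_auto].
    by apply/funext => x; ring.
  have L0 := L_gt0 hab.
  rewrite normrM ger0_norm ?invr_ge0 ?(ltW L0)// mulrC ler_pdivrMr//.
  apply: RI_bound; [exact: ab|by cts_auto|].
  move=> x _; have [g0 _ g2] := bw x.
  rewrite normrM; apply: ler_pM; [by []|by []|exact: inc|].
  by apply: le_trans (ler_normB _ _) _; lra.
rewrite normrM (ger0_norm (_ : 0 <= 2)) // -/h.
have -> : 80 * K ^+ 2 * e * h = 2 * (8 * K * e * h * (2 * K)) + 12 * K ^+ 2 * h * (2 * (e + e)) by ring.
by rewrite lerD// ler_pM2l.
Qed.

Definition tpart N (i : nat) : R := i%:R * (T / N.+1%:R).

(** This is [|v|^2 - |m|^2], in a form with no square of [m]. *)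
Let Z t := hdot (y t) (y t) + 2 * hdot (y t) (m t).

(** Polarization, using [y t2 + y t1 + 2 m t2 = v t2 + v t1 + (m t2 - m t1)]. The last pairing has
    its left factor at the earlier time, as a martingale increment requires. *)
Lemma step_identity t1 t2 : 0 <= t1 <= T -> 0 <= t2 <= T ->
  Z t2 - Z t1 = hdot (y t2 \- y t1) (fun x => v t2 x + v t1 x + (m t2 x - m t1 x)) +
    2 * hdot (y t1) (m t2 \- m t1).
Proof.
move=> t1T t2T; have [Cv1 Cm1] := path_C2_at t1T; have [Cv2 Cm2] := path_C2_at t2T.
have Cy1 : C2 (y t1) by apply: C2_sub.
have Cy2 : C2 (y t2) by apply: C2_sub.
have -> : (fun x => v t2 x + v t1 x + (m t2 x - m t1 x)) = (fun x => (y t2 x + y t1 x) + (2 * m t2 x + 0)).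
  by apply/funext => x; rewrite /y /=; ring.
have C0 : C2 (fun=> 0).
  have := C2_sub Cy1 Cy1; congr (C2); apply/funext => x; ring.
have h0 f : C2 f -> hdot f (fun=> 0) = 0.
  move=> Cf; have e : (fun=> 0) = (fun x => f x - f x) by apply/funext => x; rewrite subrr.
  by rewrite e (hdot_subr hab Cf Cf Cf) subrr.
have Cd := C2_sub Cy2 Cy1; have Cs := C2_add Cy2 Cy1; have C2m := C2_lin 2 Cm2 C0.
rewrite (hdot_addr hab Cs C2m Cd) (hdot_linr hab 2 Cm2 C0 Cd) (h0 _ Cd).
rewrite (hdot_addr hab Cy2 Cy1 Cd) (hdot_subr hab Cm2 Cm1 Cy1).
rewrite !(hdot_subl hab Cy2 Cy1 _)// /Z (hdotC _ _ (y t1) (y t2)).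
ring.
Qed.

Lemma energy_balance (eps : R) : 0 < eps -> exists N0, forall N, (N0 <= N)%N ->
  `|Z T - Z 0 - 2 * \sum_(0 <= i < N.+1) hdot (y (tpart N i)) (m (tpart N i.+1) \- m (tpart N i))| <= eps.
Proof.
move=> eps0; have [K K1 bK] := path_bounded sv.
have K20 : 0 < 80 * K ^+ 2 * T.
  have K2 : 0 < K ^+ 2 by rewrite exprn_gt0//; lra.
  by move: (K ^+ 2) K2 => k k0; rewrite mulr_gt0// mulr_gt0.
(* The [N + 1] errors add up to at most [80 K^2 T e], whatever [N] is. *)
pose e := Num.min 1 (eps / (80 * K ^+ 2 * T)).
have e0 : 0 < e by rewrite lt_min ltr01 divr_gt0.
have e1 : e <= 1 by rewrite ge_min lexx.
have e2 : 80 * K ^+ 2 * T * e <= eps by rewrite mulrC -ler_pdivlMr// ge_min lexx orbT.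
have [d1 d10 hd1] := path_C2 sv e0; have [d2 d20 hd2] := path_C2 sm e0.
pose d := Num.min d1 d2; have d0 : 0 < d by rewrite lt_min d10.
exists (Num.trunc (T / d)).+1 => N hN.
have hT : T / N.+1%:R < d.
  rewrite ltr_pdivrMr ?ltr0n// mulrC -ltr_pdivrMr//.
  apply: lt_le_trans (truncnS_gt _) _; rewrite ler_nat.
  exact: leq_trans hN (leqnSn _).
have dt0 : 0 <= T / N.+1%:R by rewrite divr_ge0// ltW.
have tS i : tpart N i.+1 - tpart N i = T / N.+1%:R.
  by rewrite /tpart -natr1; ring.
have t0 : tpart N 0 = 0 by rewrite /tpart mul0r.
have tT : tpart N N.+1 = T by rewrite /tpart mulrC divfK// lt0r_neq0.
have tmono i : tpart N i <= tpart N i.+1 by rewrite -subr_ge0 tS.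
have tin i : (i <= N.+1)%N -> 0 <= tpart N i <= T.
  move=> iN; rewrite /tpart mulr_ge0//= -[leRHS]tT /tpart ler_wpM2r// ler_nat//.
have tel : Z T - Z 0 = \sum_(0 <= i < N.+1) (Z (tpart N i.+1) - Z (tpart N i)).
  by rewrite telescope_sumr// tT t0.
rewrite tel mulr_sumr -sumrB.
apply: (@le_trans _ _ (\sum_(0 <= i < N.+1) (80 * K ^+ 2 * e * (T / N.+1%:R)))); last first.
  have sc (c : R) : \sum_(0 <= i < N.+1) c = c * N.+1%:R.
    by rewrite big_const_nat subn0 iter_addr_0 mulr_natr.
  rewrite sc.
  have -> : 80 * K ^+ 2 * e * (T / N.+1%:R) * N.+1%:R = 80 * K ^+ 2 * T * e.
    by field; rewrite lt0r_neq0// -natr1 ltr_wpDl.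
  by [].
apply: le_trans (ler_norm_sum _ _ _) _.
rewrite !big_nat; apply: ler_sum => i /andP[_ iN].
have ti := tin i (ltnW iN); have ti1 := tin i.+1 iN.
rewrite (step_identity ti ti1) addrK.
have [ti0 tiT] := andP ti; have [ti10 ti1T] := andP ti1.
have bnd t : tpart N i <= t <= tpart N i.+1 -> 0 <= t <= T /\ `|t - tpart N i| < d.
  move=> /andP[h1 h2]; split; first by rewrite (le_trans ti0 h1) (le_trans h2 ti1T).
  rewrite ger0_norm ?subr_ge0//; apply: le_lt_trans hT; rewrite -(tS i).
  by rewrite lerD2r.
rewrite -(tS i); apply: step_small => //.
- by move=> t /bnd[tT' _]; apply: bK.
- move=> t /bnd[tT' td]; apply: hd1 => //; apply: lt_le_trans td _.
  by rewrite ge_min lexx.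
- have bi : tpart N i <= tpart N i.+1 <= tpart N i.+1 by rewrite tmono lexx.
  have [_ td] := bnd _ bi.
  by apply: hd2 => //; apply: lt_le_trans td _; rewrite ge_min lexx orbT.
Qed.

End Equation.
End Pathwise.

(** * Integrals of nonnegative functions: densities and monotonicity *)

Section Density.
Local Open Scope ereal_scope.
Import HBNNSimple.

(** The usual passage from indicators to simple functions and then, by monotone convergence, to all
    nonnegative measurable functions. *)
Lemma integral_density {R : realType} (d : measure_display) (T : measurableType d)
    (mu nu : {measure set T -> \bar R}) (p : T -> R) (f : T -> \bar R) :
  measurable_fun setT p -> (forall x, (0 <= p x)%R) ->
  (forall A, measurable A -> nu A = \int[mu]_(x in A) (p x)%:E) ->
  measurable_fun setT f -> (forall x, 0 <= f x) ->
  \int[nu]_x f x = \int[mu]_x (f x * (p x)%:E).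
Proof.
move=> mp p0 nuE mf f0.
have mpE : measurable_fun setT (fun x => (p x)%:E) by exact/measurable_EFinP.
have ind (A : set T) (r : R) : measurable A -> (0 <= r)%R ->
    \int[nu]_x (r * \1_A x)%:E = \int[mu]_x ((r * \1_A x)%:E * (p x)%:E).
  move=> mA r0; under eq_integral do rewrite EFinM.
  rewrite ge0_integralZl//; last exact/measurable_EFinP/measurable_indic.
  rewrite integral_indic// setIT nuE// integral_mkcond -ge0_integralZl//; last first.
  - by move=> x _; rewrite patchE; case: ifP => _ //; rewrite lee_fin.
  - exact/(measurable_restrictT _ mA).1/measurable_funTS.
  apply: eq_integral => x _; rewrite patchE indicE; case: (x \in A).
    by rewrite mulr1.
  by rewrite mulr0 mul0e mule0.
have nns (g : {nnsfun T >-> R}) : \int[nu]_x (g x)%:E = \int[mu]_x ((g x)%:E * (p x)%:E).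
  under [LHS]eq_integral do rewrite fimfunE -fsumEFin//.
  rewrite [LHS]ge0_integral_fsum//; last 2 first.
  - by move=> r; exact/measurable_EFinP/measurableT_comp.
  - by move=> n x _; rewrite EFinM nnfun_muleindic_ge0.
  under [RHS]eq_integral.
    move=> x xD; rewrite fimfunE -fsumEFin// ge0_mule_fsuml; last first.
      by move=> r; rewrite EFinM nnfun_muleindic_ge0.
    over.
  rewrite [RHS]ge0_integral_fsum//; last 2 first.
  - move=> r; apply: emeasurable_funM => //.
    exact/measurable_EFinP/measurableT_comp.
  - by move=> n x _; apply: mule_ge0; [rewrite EFinM nnfun_muleindic_ge0|rewrite lee_fin].
  apply: eq_fsbigr => r _; have [r0|r0] := leP 0%R r; first exact: ind.
  rewrite preimage_nnfun0// indic0.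
  by rewrite !integral0_eq// => x _; rewrite ?indicE /= ?mulr0 ?mul0e.
pose g := nnsfun_approx measurableT mf.
transitivity (lim (\int[nu]_x (g n x)%:E @[n --> \oo])).
  rewrite -monotone_convergence//=.
  - apply: eq_integral => ? /[!inE] xD; apply/esym/cvg_lim => //=.
    exact: cvg_nnsfun_approx.
  - by move=> n; exact/measurable_EFinP/measurable_funTS.
  - by move=> n ? _; rewrite lee_fin.
  - by move=> ? _ ? ? mn; rewrite lee_fin; exact/lefP/nd_nnsfun_approx.
rewrite [RHS](_ : _ = lim (\int[mu]_x ((g n x)%:E * (p x)%:E) @[n --> \oo])); last first.
  rewrite -monotone_convergence//=.
  - apply: eq_integral => x /[!inE] xD; apply/esym/cvg_lim => //.
    by apply: cvgeZr => //; exact: cvg_nnsfun_approx.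
  - by move=> n; apply: emeasurable_funM => //; exact/measurable_EFinP/measurable_funTS.
  - by move=> n ? _; rewrite mule_ge0 ?lee_fin.
  - move=> x _ ? ? mn; rewrite lee_wpmul2r ?lee_fin//; exact/lefP/nd_nnsfun_approx.
by apply: congr_lim; apply/funext => n /=; exact: nns.
Qed.

(** The integral of a nonnegative function is a supremum over simple functions below it, hence
    monotone without measurability. This serves for suprema over time and for H^s norms of
    processes. *)
Lemma ge0_le_integral_nomeas {R : realType} (d : measure_display) (T : measurableType d)
    (mu : {measure set T -> \bar R}) (f g : T -> \bar R) :
  (forall x, 0 <= f x) -> (forall x, f x <= g x) -> \int[mu]_x f x <= \int[mu]_x g x.
Proof.
move=> f0 fg; rewrite !ge0_integralTE//; last by move=> x; apply: le_trans (fg x).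
by apply: le_ereal_sup => _ [h hf <-]; exists h => // x; apply: le_trans (hf x) (fg x).
Qed.
End Density.

(** * First and second moments of the centred normal law *)

Section NormalMoments.
Context {R : realType}.
Variable h : R.
Hypothesis h0 : 0 < h.
Local Notation leb := (@lebesgue_measure R).
Local Notation pdf := (normal_pdf 0 (Num.sqrt h)).
Local Notation nu := (normal_prob 0 (Num.sqrt h)).

Lemma RI_EFin (f : R -> R) x y : cts f ->
  (\int[leb]_(z in `[x, y]) (f z)%:E = (RI x y f)%:E)%E.
Proof.
by move=> cf; rewrite /RI /Rintegral fineK//; apply: integrable_fin_num => //; exact: cts_integrable.
Qed.

Lemma RI_cvg_integral (f : R -> R) : cts f -> (forall x, 0 <= f x) ->
  (RI (- n%:R) n%:R f)%:E @[n --> \oo] --> (\int[leb]_x (f x)%:E)%E.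
Proof.
move=> cf f0; pose I (n : nat) : set R := `[- n%:R, n%:R]%classic.
have mf : measurable_fun setT (fun x => (f x)%:E).
  by apply/measurable_EFinP; apply: continuous_measurable_fun; exact/continuousP_cts.
have UI : \bigcup_n I n = setT.
  apply/seteqP; split => // x _; exists (Num.trunc `|x|).+1 => //; rewrite /I /=.
  by rewrite in_itv/= -ler_norml ltW// truncnS_gt.
have := @ge0_nondecreasing_set_cvg_integral _ (measurableTypeR R) R I (fun x => (f x)%:E) leb.
rewrite UI; have -> : (fun n : nat => (\int[leb]_(x in I n) (f x)%:E)%E) = (fun n => (RI (- n%:R) n%:R f)%:E).
  by apply/funext => n; exact: RI_EFin.
apply.
- move=> m n mn; apply/subsetPset => x; rewrite /I /= !in_itv/= => /andP[h1 h2].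
  have : m%:R <= n%:R :> R by rewrite ler_nat.
  by move=> mnR; apply/andP; split; lra.
- by move=> n; exact: measurable_itv.
- by move=> n; exact: measurable_funTS.
- by move=> n x _; rewrite lee_fin.
Qed.

Lemma sqrt_h_neq0 : Num.sqrt h != 0. Proof. by rewrite gt_eqF ?sqrtr_gt0. Qed.

Lemma pdfE x : pdf x = normal_peak (Num.sqrt h) * expR (- (x ^+ 2) / (h *+ 2)).
Proof.
by rewrite normal_pdfE ?sqrt_h_neq0// /normal_fun subr0 sqr_sqrtr// ltW.
Qed.

Lemma der_pdf : der pdf (fun x => - (x / h) * pdf x).
Proof.
have -> : pdf = fun x => normal_peak (Num.sqrt h) * expR (- (x ^+ 2) / (h *+ 2)).
  by apply/funext => x; exact: pdfE.
have d1 : der (fun x : R => - (x ^+ 2) / (h *+ 2)) (fun x => - (x / h)).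
  by der_auto; rewrite ?expr1 -mulr_natr; field; exact: lt0r_neq0.
have d2 := der_comp der_expR d1.
by der_auto; ring.
Qed.

Lemma cts_pdf : cts pdf. Proof. exact: der_cts der_pdf. Qed.

Lemma pdf_ge0 x : 0 <= pdf x. Proof. exact: normal_pdf_ge0. Qed.

Lemma pdfN x : pdf (- x) = pdf x.
Proof. by rewrite !pdfE sqrrN. Qed.

(** From [expR x >= 1 + x] the density is [O(n^-2)], enough for the boundary terms of the
    integration by parts. *)
Lemma pdf_decay : (n%:R * pdf n%:R) @[n --> \oo] --> (0 : R).
Proof.
pose K := normal_peak (Num.sqrt h) * (2 * h).
have K0 : 0 <= K by rewrite mulr_ge0 ?normal_peak_ge0 ?mulr_ge0 ?ltW.
have ub (n : nat) : (0 < n)%N -> n%:R * pdf n%:R <= K / n%:R.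
  move=> n0; have nR : 0 < n%:R :> R by rewrite ltr0n.
  rewrite pdfE mulNr expRN /K; have E0 := expR_gt0 (n%:R ^+ 2 / (h *+ 2)).
  have he := expR_ge1Dx (n%:R ^+ 2 / (h *+ 2)).
  have nE : n%:R * n%:R <= 2 * h * expR (n%:R ^+ 2 / (h *+ 2)).
    have e : n%:R * n%:R = 2 * h * (n%:R ^+ 2 / (h *+ 2)) :> R.
      by rewrite -[h *+ 2]mulr_natl; field; exact: lt0r_neq0.
    by rewrite e ler_pM2l ?mulr_gt0//; apply: le_trans he; rewrite lerDr.
  have P0 := @normal_peak_ge0 R (Num.sqrt h).
  move: (expR _) E0 nE (normal_peak _) P0 => E E0 nE P P0.
  have -> : n%:R * (P * E^-1) = P * (n%:R * n%:R / E) / n%:R :> R.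
    by field; rewrite !lt0r_neq0.
  by rewrite ler_pM2r ?invr_gt0// ler_wpM2l// ler_pdivrMr.
apply/cvgrPdist_le => e e0; exists (Num.trunc (K / e)).+1 => // n /= hn.
have n0 : (0 < n)%N by exact: leq_trans hn.
have nR : 0 < n%:R :> R by rewrite ltr0n.
rewrite sub0r normrN ger0_norm ?mulr_ge0 ?pdf_ge0//.
apply: le_trans (ub n n0) _; rewrite ler_pdivrMr// mulrC -ler_pdivrMr//.
apply: ltW; apply: lt_le_trans (truncnS_gt _) _.
by rewrite ler_nat.
Qed.

Lemma integral_pdf : (\int[leb]_x (pdf x)%:E = 1)%E.
Proof. exact: integral_normal_pdf. Qed.

Lemma cts_sq_pdf : cts (fun x => x ^+ 2 * pdf x).
Proof. by have c := cts_pdf; have ci := @cts_id R; apply: cts_mul => //; exact: cts_exp. Qed.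

(** By parts: [- h x pdf] is a primitive of [x^2 pdf - h pdf], and its boundary values on [[-n, n]]
    vanish in the limit. *)
Lemma integral_sq_pdf : (\int[leb]_x (x ^+ 2 * pdf x)%:E = h%:E)%E.
Proof.
have c2 := cts_sq_pdf; have c0 := cts_pdf.
have l1 := RI_cvg_integral c2 (fun x => mulr_ge0 (sqr_ge0 x) (pdf_ge0 x)).
have l2 := RI_cvg_integral c0 pdf_ge0; rewrite integral_pdf in l2.
have e (n : nat) : RI (- n%:R) n%:R (fun x => x ^+ 2 * pdf x) =
    h * RI (- n%:R) n%:R pdf - 2 * h * (n%:R * pdf n%:R).
  have nn : - n%:R <= n%:R :> R by have : 0 <= n%:R :> R by []; lra.
  have d : der (fun x => - (h * (x * pdf x))) (fun x => x ^+ 2 * pdf x - h * pdf x).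
    have dp := der_pdf; der_auto; field; exact: lt0r_neq0.
  have := RI_FTC nn d; rewrite pdfN RI_sub//; last by apply: cts_mul => //; exact: cts_cst.
  rewrite RI_scale// => /(_ _) eq1.
  have : cts (fun x => x ^+ 2 * pdf x - h * pdf x).
    by apply: cts_add => //; apply: cts_opp; apply: cts_mul => //; exact: cts_cst.
  by move=> /eq1; lra.
have E1 : (fun n : nat => (RI (- n%:R) n%:R (fun x => x ^+ 2 * pdf x))%:E) =
    (fun n => h%:E * (RI (- n%:R) n%:R pdf)%:E - (2 * h * (n%:R * pdf n%:R))%:E)%E.
  by apply/funext => n; rewrite e EFinB EFinM.
rewrite E1 in l1.
have l3 : ((2 * h * (n%:R * pdf n%:R))%:E @[n --> \oo] --> 0%E).
  apply: cvg_EFin; first exact: nearW.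
  rewrite /comp /=; rewrite -[X in _ --> X](mulr0 (2 * h)).
  by apply: cvgM; [exact: cvg_cst|exact: pdf_decay].
have l4 : ((h%:E * (RI (- n%:R) n%:R pdf)%:E - (2 * h * (n%:R * pdf n%:R))%:E)%E @[n --> \oo] --> h%:E).
  rewrite -[X in _ --> X]sube0 -[X in _ --> (X - _)%E]mule1.
  by apply: cvgeB => //; apply: cvgeZl.
exact: (cvg_unique _ l1 l4).
Qed.

(** The positive part, in a form whose continuity is immediate; [rneg] is the negative part. *)
Definition rpos (x : R) : R := 2^-1 * (`|x| + x).
Definition rneg (x : R) : R := 2^-1 * (`|x| - x).

Lemma rpos_ge0 x : 0 <= rpos x.
Proof. by rewrite mulr_ge0// -lerBlDr sub0r ler_normr lexx orbT. Qed.
Lemma rneg_ge0 x : 0 <= rneg x.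
Proof. by rewrite mulr_ge0// subr_ge0 ler_norm. Qed.
Lemma rposneg x : x = rpos x - rneg x. Proof. by rewrite /rpos /rneg; field. Qed.
Lemma rpos_le x : rpos x <= `|x|.
Proof. by have := ler_norm x; rewrite /rpos; lra. Qed.
Lemma rneg_le x : rneg x <= `|x|.
Proof. by have := ler_norm (- x); rewrite normrN /rneg; lra. Qed.
Lemma cts_rpos : cts rpos.
Proof.
have cn : cts (fun x : R => `|x|) by move=> x; exact: norm_continuous.
by apply: cts_mul; [exact: cts_cst|apply: cts_add => //; exact: cts_id].
Qed.
Lemma cts_rneg : cts rneg.
Proof.
have cn : cts (fun x : R => `|x|) by move=> x; exact: norm_continuous.
by apply: cts_mul; [exact: cts_cst|apply: cts_add => //; apply: cts_opp; exact: cts_id].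
Qed.
Lemma cts_measurable (f : R -> R) : cts f -> measurable_fun setT f.
Proof. by move=> cf; apply: continuous_measurable_fun; exact/continuousP_cts. Qed.

Lemma integral_normal (f : R -> R) : cts f -> (forall x, 0 <= f x) ->
  (\int[nu]_x (f x)%:E = \int[leb]_x (f x * pdf x)%:E)%E.
Proof.
move=> cf f0.
transitivity (\int[leb]_x ((f x)%:E * (pdf x)%:E))%E; last first.
  by apply: eq_integral => x _; rewrite EFinM.
apply: integral_density.
- exact: measurable_normal_pdf.
- by move=> x; exact: pdf_ge0.
- by [].
- by apply/measurable_EFinP; apply: cts_measurable.
- by move=> x; rewrite lee_fin.
Qed.

Lemma normal_second_moment : (\int[nu]_x (x ^+ 2)%:E = h%:E)%E.
Proof.
rewrite integral_normal ?integral_sq_pdf//; first exact: cts_exp (@cts_id R).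
by move=> x; exact: sqr_ge0.
Qed.

(** The difference of the two integrands is [x pdf], with the even primitive [- h pdf], so its
    integral over each [[-n, n]] is zero. Finiteness follows from [|x| <= 1 + x^2]. The common value
    never matters. *)
Lemma normal_first_moment : exists2 c : R, 0 <= c &
  (\int[nu]_x (rpos x)%:E = c%:E /\ \int[nu]_x (rneg x)%:E = c%:E)%E.
Proof.
have cp := cts_rpos; have cn := cts_rneg; have c0 := cts_pdf.
rewrite (integral_normal cp rpos_ge0) (integral_normal cn rneg_ge0).
have cpp : cts (fun x => rpos x * pdf x) by exact: cts_mul.
have cnp : cts (fun x => rneg x * pdf x) by exact: cts_mul.
have l1 := RI_cvg_integral cpp (fun x => mulr_ge0 (rpos_ge0 x) (pdf_ge0 x)).
have l2 := RI_cvg_integral cnp (fun x => mulr_ge0 (rneg_ge0 x) (pdf_ge0 x)).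
have e (n : nat) : RI (- n%:R) n%:R (fun x => rpos x * pdf x) = RI (- n%:R) n%:R (fun x => rneg x * pdf x).
  have nn : - n%:R <= n%:R :> R by have : 0 <= n%:R :> R by []; lra.
  apply/eqP; rewrite -subr_eq0 -RI_sub//; apply/eqP.
  have -> : (fun x => rpos x * pdf x - rneg x * pdf x) = (fun x => x * pdf x).
    by apply/funext => x; rewrite -mulrBl -rposneg.
  have d : der (fun x => - (h * pdf x)) (fun x => x * pdf x).
    have dp := der_pdf; der_auto; field; exact: lt0r_neq0.
  rewrite (RI_FTC nn d); first by rewrite pdfN subrr.
  by apply: cts_mul => //; exact: cts_id.
have eq12 : (\int[leb]_x (rpos x * pdf x)%:E = \int[leb]_x (rneg x * pdf x)%:E)%E.
  have E1 : (fun n : nat => (RI (- n%:R) n%:R (fun x => rpos x * pdf x))%:E) =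
      (fun n => (RI (- n%:R) n%:R (fun x => rneg x * pdf x))%:E).
    by apply/funext => n; rewrite e.
  rewrite E1 in l1; exact: (cvg_unique _ l1 l2).
have fin : (\int[leb]_x (rpos x * pdf x)%:E < +oo)%E.
  apply: (@le_lt_trans _ _ (\int[leb]_x ((pdf x)%:E + (x ^+ 2 * pdf x)%:E))%E).
    apply: ge0_le_integral_nomeas => x.
      by rewrite lee_fin mulr_ge0 ?rpos_ge0 ?pdf_ge0.
    rewrite -EFinD lee_fin -{2}[pdf x]mul1r -mulrDl ler_wpM2r ?pdf_ge0//.
    apply: le_trans (rpos_le x) _; rewrite -[x ^+ 2]real_normK ?num_real//.
    by have := sqr_ge0 (`|x| - 1); have := normr_ge0 x; nra.
  rewrite ge0_integralD//=.
  - by rewrite integral_pdf integral_sq_pdf ltry.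
  - by move=> x _; rewrite lee_fin pdf_ge0.
  - by apply/measurable_EFinP; apply: cts_measurable.
  - by move=> x _; rewrite lee_fin mulr_ge0 ?sqr_ge0 ?pdf_ge0.
  - by apply/measurable_EFinP; apply: cts_measurable; exact: cts_sq_pdf.
have ge0 : (0 <= \int[leb]_x (rpos x * pdf x)%:E)%E.
  by apply: integral_ge0 => x _; rewrite lee_fin mulr_ge0 ?rpos_ge0 ?pdf_ge0.
exists (fine (\int[leb]_x (rpos x * pdf x)%:E)%E); first by rewrite fine_ge0.
by rewrite -eq12 fineK ?ge0_fin_numE.
Qed.
End NormalMoments.

(** * Expectations of integrable real random variables *)

Section L1Calculus.
Context {R : realType} {d : measure_display} {Omega : measurableType d}.
Variable P : probability Omega R.
Implicit Types X Y V : Omega -> R.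

Definition L1 X : Prop := P.-integrable setT (EFin \o X).
Definition EX X : R := \int[P]_w X w.

Lemma L1_meas X : L1 X -> measurable_fun setT X.
Proof. by move=> /integrableP[/measurable_EFinP]. Qed.

Lemma EX_EFin X : L1 X -> (\int[P]_w (X w)%:E = (EX X)%:E)%E.
Proof. by move=> iX; rewrite /EX /Rintegral fineK//; exact: integrable_fin_num iX. Qed.

Lemma L1_cst c : L1 (fun=> c).
Proof. exact: finite_measure_integrable_cst. Qed.

Lemma EX_cst c : EX (fun=> c) = c.
Proof.
by rewrite /EX /Rintegral integral_cst//= probability_setT mule1.
Qed.

Lemma L1_lin c X Y : L1 X -> L1 Y -> L1 (fun w => c * X w + Y w).
Proof.
move=> iX iY; have h := integrableD measurableT (integrableZl measurableT c iX) iY.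
rewrite /L1 (_ : EFin \o _ = ((fun x => c%:E * (EFin \o X) x) \+ (EFin \o Y))%E)//.
Qed.

Lemma EX_lin c X Y : L1 X -> L1 Y -> EX (fun w => c * X w + Y w) = c * EX X + EX Y.
Proof.
move=> iX iY; rewrite /EX RintegralD//; first by rewrite RintegralZl.
by have h := integrableZl measurableT c iX; rewrite (_ : EFin \o _ = (fun x => c%:E * (EFin \o X) x)%E).
Qed.

Lemma L1_scale c X : L1 X -> L1 (fun w => c * X w).
Proof.
move=> iX; have := L1_lin c iX (L1_cst 0).
by congr L1; apply/funext => w; rewrite addr0.
Qed.

Lemma EX_scale c X : L1 X -> EX (fun w => c * X w) = c * EX X.
Proof.
move=> iX; have := EX_lin c iX (L1_cst 0); rewrite EX_cst addr0 => <-.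
by congr EX; apply/funext => w; rewrite addr0.
Qed.

Lemma L1_add X Y : L1 X -> L1 Y -> L1 (fun w => X w + Y w).
Proof.
move=> iX iY; have := L1_lin 1 iX iY.
by congr L1; apply/funext => w; rewrite mul1r.
Qed.

Lemma EX_add X Y : L1 X -> L1 Y -> EX (fun w => X w + Y w) = EX X + EX Y.
Proof.
move=> iX iY; have := EX_lin 1 iX iY; rewrite mul1r => <-.
by congr EX; apply/funext => w; rewrite mul1r.
Qed.

Lemma L1_sub X Y : L1 X -> L1 Y -> L1 (fun w => X w - Y w).
Proof.
move=> iX iY; have := L1_lin (-1) iY iX.
by congr L1; apply/funext => w; rewrite mulN1r addrC.
Qed.

Lemma EX_sub X Y : L1 X -> L1 Y -> EX (fun w => X w - Y w) = EX X - EX Y.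
Proof.
move=> iX iY; have := EX_lin (-1) iY iX; rewrite mulN1r addrC => <-.
by congr EX; apply/funext => w; rewrite mulN1r addrC.
Qed.

Lemma L1_sum (I : Type) (r : seq I) (F : I -> Omega -> R) : (forall i, L1 (F i)) ->
  L1 (fun w => \sum_(i <- r) F i w).
Proof.
move=> iF; elim: r => [|i r ih].
  by have := L1_cst 0; congr L1; apply/funext => w; rewrite big_nil.
by have := L1_add (iF i) ih; congr L1; apply/funext => w; rewrite big_cons.
Qed.

Lemma EX_sum (I : Type) (r : seq I) (F : I -> Omega -> R) : (forall i, L1 (F i)) ->
  EX (fun w => \sum_(i <- r) F i w) = \sum_(i <- r) EX (F i).
Proof.
move=> iF; elim: r => [|i r ih].
  by rewrite big_nil -[RHS](EX_cst 0); congr EX; apply/funext => w; rewrite big_nil.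
rewrite big_cons -ih -EX_add//; last exact: L1_sum.
by congr EX; apply/funext => w; rewrite big_cons.
Qed.

Lemma EX_le X Y : L1 X -> L1 Y -> (forall w, X w <= Y w) -> EX X <= EX Y.
Proof. by move=> iX iY XY; apply: le_Rintegral. Qed.

Lemma EX_ge0 X : (forall w, 0 <= X w) -> 0 <= EX X.
Proof. by move=> X0; apply: Rintegral_ge0. Qed.

Lemma L1_le X Y : measurable_fun setT X -> (forall w, `|X w| <= Y w) -> L1 Y -> L1 X.
Proof.
move=> mX XY iY; apply: (le_integrable _ _ _ iY) => //; first exact/measurable_EFinP.
by move=> w _ /=; rewrite lee_fin (le_trans (XY w))// ler_norm.
Qed.

Lemma EX_norm X : L1 X -> `|EX X| <= EX (fun w => `|X w|).
Proof. by move=> iX; apply: le_normr_Rintegral. Qed.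

Lemma L1_abs X : L1 X -> L1 (fun w => `|X w|).
Proof.
move=> iX; have := integrable_abse iX.
by congr (P.-integrable setT _); apply/funext => w.
Qed.

Lemma L1_fin X : measurable_fun setT X -> (forall w, 0 <= X w) ->
  (\int[P]_w (X w)%:E < +oo)%E -> L1 X.
Proof.
move=> mX X0 fin; apply/integrableP; split; first exact/measurable_EFinP.
rewrite (_ : (fun x => _) = fun w => (X w)%:E)//.
by apply/funext => w /=; rewrite ger0_norm.
Qed.

Lemma L1_of_sq X : measurable_fun setT X -> L1 (fun w => X w ^+ 2) -> L1 X.
Proof.
move=> mX iX; apply: (L1_le mX _ (L1_add (L1_cst 1) iX)) => w.
rewrite -[X w ^+ 2]real_normK ?num_real//.
by have := sqr_ge0 (`|X w| - 1); have := normr_ge0 (X w); nra.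
Qed.

Lemma L1_mul X Y : measurable_fun setT X -> measurable_fun setT Y ->
  L1 (fun w => X w ^+ 2) -> L1 (fun w => Y w ^+ 2) -> L1 (fun w => X w * Y w).
Proof.
move=> mX mY iX iY; apply: (L1_le _ _ (L1_add iX iY)); first exact: measurable_funM.
move=> w; have h1 := sqr_ge0 (X w - Y w); have h2 := sqr_ge0 (X w + Y w).
have h3 := sqr_ge0 (X w); have h4 := sqr_ge0 (Y w).
by rewrite ler_norml; apply/andP; split; nra.
Qed.

Lemma EX_ae (G : set Omega) X Y : measurable G -> P (~` G) = 0%E ->
  measurable_fun setT Y -> (forall w, G w -> X w = Y w) -> L1 X -> L1 Y /\ EX Y = EX X.
Proof.
move=> mG PG mY XY iX; have mX := L1_meas iX.
have mCG : measurable (~` G) by exact: measurableC.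
have ae : ae_eq P setT (EFin \o X) (EFin \o Y).
  exists (~` G); split => // w /= h Gw.
  by apply: h => _; rewrite XY.
have iY : L1 Y.
  apply/integrableP; split; first exact/measurable_EFinP.
  rewrite (@ae_eq_integral _ _ _ _ _ (fun w => `|(X w)%:E|)%E)//.
  - by case/integrableP: iX.
  - by apply: measurableT_comp => //; exact/measurable_EFinP.
  - by apply: measurableT_comp => //; exact/measurable_EFinP.
  - exists (~` G); split => // w /= h Gw.
    by apply: h => _; rewrite XY.
split => //; rewrite /EX /Rintegral; congr fine; apply/esym.
by apply: ae_eq_integral => //; exact/measurable_EFinP.
Qed.

(** Measurability of [f] is not assumed: it is squeezed between [Y] cut to 0 and [Y] raised to
    infinity off [G], both measurable with the same integral. *)
Lemma integral_ae_nomeas (G : set Omega) (f : Omega -> \bar R) Y : measurable G -> P (~` G) = 0%E ->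
  (forall w, (0 <= f w)%E) -> L1 Y -> (forall w, 0 <= Y w) ->
  (forall w, G w -> f w = (Y w)%:E) -> (\int[P]_w f w = (EX Y)%:E)%E.
Proof.
move=> mG PG f0 iY Y0 fY; rewrite -EX_EFin//; have mY := L1_meas iY.
have mYE : measurable_fun setT (fun w => (Y w)%:E) by exact/measurable_EFinP.
have aeq (g : Omega -> \bar R) : measurable_fun setT g -> (forall w, G w -> g w = (Y w)%:E) ->
    (\int[P]_w g w = \int[P]_w (Y w)%:E)%E.
  move=> mg gY; apply: ae_eq_integral => //.
  exists (~` G); split => //; first exact: measurableC.
  by move=> w /= h Gw; apply: h => _; rewrite gY.
apply/eqP; rewrite eq_le; apply/andP; split.
- pose g w := ((Y w)%:E * (\1_G w)%:E + +oo * (\1_(~` G) w)%:E)%E.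
  rewrite -(aeq g).
  + apply: ge0_le_integral_nomeas => // w; rewrite /g !indicE in_setC.
    have [wG|wG] := boolP (w \in G); first by rewrite mule1 mule0 adde0 fY//; exact: set_mem.
    by rewrite mule0 mule1 add0e leey.
  + apply: emeasurable_funD; apply: emeasurable_funM => //;
      by apply/measurable_EFinP; apply: measurable_indic => //; exact: measurableC.
  + move=> w Gw; rewrite /g !indicE in_setC mem_set//= mule1 mule0 adde0//.
- pose g w := ((Y w)%:E * (\1_G w)%:E)%E.
  rewrite -(aeq g).
  + apply: ge0_le_integral_nomeas => w; rewrite /g indicE.
      by rewrite mule_ge0 ?lee_fin.
    have [wG|wG] := boolP (w \in G); first by rewrite mule1 fY//; exact: set_mem.
    by rewrite mule0.
  + by apply: emeasurable_funM => //; apply/measurable_EFinP; exact: measurable_indic.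
  + by move=> w Gw; rewrite /g indicE mem_set//= mule1.
Qed.
End L1Calculus.

(** * Independence from a variable of given law *)

Section Independence.
Context {R : realType} {d : measure_display} {Omega : measurableType d}.
Variable P : probability Omega R.
Variable nu : probability (measurableTypeR R) R.

Definition indep_law (X V : Omega -> R) : Prop := forall A B : set R, measurable A -> measurable B ->
  P ((X @^-1` A) `&` (V @^-1` B)) = (P (X @^-1` A) * nu B)%E.

(** The joint law agrees with a product measure on rectangles, hence everywhere; Tonelli's theorem
    then factors the integral. *)
Lemma indep_integral (X V : Omega -> R) (f g : R -> R) :
  measurable_fun setT X -> measurable_fun setT V -> indep_law X V ->
  measurable_fun setT f -> measurable_fun setT g ->
  (forall x, 0 <= f x) -> (forall x, 0 <= g x) ->
  (\int[P]_w (f (X w) * g (V w))%:E = (\int[P]_w (f (X w))%:E) * \int[nu]_y (g y)%:E)%E.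
Proof.
move=> mX mV ind mf mg f0 g0.
pose X' : {mfun Omega >-> R} := HB.pack X (isMeasurableFun.Build _ _ Omega R X mX).
have mV' : measurable_fun setT (V : Omega -> measurableTypeR R) := mV.
pose W : {mfun Omega >-> (R * measurableTypeR R)%type} :=
  HB.pack (fun w => (X w, V w : measurableTypeR R))
    (isMeasurableFun.Build _ _ Omega (R * measurableTypeR R)%type _ (measurable_fun_pair mX mV')).
pose PX := distribution P X'; pose PW := distribution P W.
have mfg : measurable_fun setT (fun z : R * measurableTypeR R => (f z.1 * g z.2)%:E).
  apply/measurable_EFinP; apply: measurable_funM.
    exact: (measurableT_comp mf measurable_fst).
  have mg' : measurable_fun setT (g : measurableTypeR R -> R) := mg.
  exact: (measurableT_comp mg' measurable_snd).
have fg0 z : (0 <= (f z.1 * g z.2)%:E)%E by rewrite lee_fin mulr_ge0.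
have -> : (\int[P]_w (f (X w) * g (V w))%:E = \int[PW]_z (f z.1 * g z.2)%:E)%E.
  by rewrite ge0_integral_distribution.
have PWE : forall S, measurable S -> S `<=` setT -> PW S = (PX \x nu)%E S.
  move=> S mS _; apply/esym; apply: (product_measure_unique (m' := PW)); last exact: mS.
  by move=> A B mA mB; exact: (ind A B mA mB).
rewrite (eq_measure_integral (PX \x nu)%E PWE) fubini_tonelli1//.
have -> : (\int[P]_w (f (X w))%:E = \int[PX]_x (f x)%:E)%E.
  by rewrite ge0_integral_distribution//; exact/measurable_EFinP.
rewrite -ge0_integralZr//; last 3 first.
- exact/measurable_EFinP.
- by move=> x _; rewrite lee_fin.
- by apply: integral_ge0 => y _; rewrite lee_fin.
apply: eq_integral => x _; rewrite /fubini_F -ge0_integralZl//.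
- by apply/measurable_EFinP.
- by move=> y _; rewrite lee_fin.
- by rewrite lee_fin.
Qed.

(** Conditioning on the event [V2] in [C] leaves the joint law of [(X, V1)] equal to the same
    product measure, so the probability of any event about [X * V1] is unchanged. *)
Lemma indep_pair_mul (X V1 V2 : Omega -> R) :
  measurable_fun setT X -> measurable_fun setT V1 -> measurable_fun setT V2 ->
  (forall A B C : set R, measurable A -> measurable B -> measurable C ->
    P ((X @^-1` A) `&` (V1 @^-1` B) `&` (V2 @^-1` C)) = (P (X @^-1` A) * (nu B * nu C))%E) ->
  indep_law (fun w => X w * V1 w) V2.
Proof.
move=> mX mV1 mV2 ind S C mS mC.
pose X' : {mfun Omega >-> R} := HB.pack X (isMeasurableFun.Build _ _ Omega R X mX).
have mV1' : measurable_fun setT (V1 : Omega -> measurableTypeR R) := mV1.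
pose W : {mfun Omega >-> (R * measurableTypeR R)%type} :=
  HB.pack (fun w => (X w, V1 w : measurableTypeR R))
    (isMeasurableFun.Build _ _ Omega (R * measurableTypeR R)%type _ (measurable_fun_pair mX mV1')).
pose PX := distribution P X'; pose PW := distribution P W.
have nuT : nu setT = 1%E by exact: probability_setT.
have PC : P (V2 @^-1` C) = nu C.
  have := ind setT setT C measurableT measurableT mC.
  by rewrite !preimage_setT !setTI nuT mul1e probability_setT mul1e.
have mV2C : measurable (V2 @^-1` C) by rewrite -[_ @^-1` _]setTI; exact: mV2.
pose S' : set (R * measurableTypeR R) := [set z | S (z.1 * z.2)].
have mS' : measurable S'.
  have mm : measurable_fun setT (fun z : R * measurableTypeR R => z.1 * (z.2 : R)).
    have ms : measurable_fun [set: R * measurableTypeR R] (snd : R * measurableTypeR R -> R).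
      exact: measurable_snd.
    by apply: measurable_funM => //; exact: measurable_fst.
  by rewrite -[S']setTI; exact: mm.
have PWE : PW S' = (PX \x nu)%E S'.
  apply/esym; apply: product_measure_unique => // A B mA mB.
  have := ind A B setT mA mB measurableT.
  by rewrite preimage_setT setIT nuT mule1.
rewrite -[P ((fun w => X w * V1 w) @^-1` S)]/(PW S').
(* A null event cannot be conditioned on; both sides are then zero. *)
have [C0|C0] := eqVneq (nu C) 0%E.
  rewrite C0 mule0; apply/eqP; rewrite -measure_le0 -C0 -PC; apply: le_measure.
  - rewrite inE; apply: measurableI => //.
    have mXV : measurable_fun setT (fun w => X w * V1 w) by exact: measurable_funM.
    by rewrite -[_ @^-1` _]setTI; exact: mXV.
  - by rewrite inE.
  - exact: subIsetr.
have Cfin : nu C \is a fin_num by exact: fin_num_measure.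
pose c := fine (nu C).
have c0 : 0 < c by rewrite lt_def fine_ge0// andbT /c fine_eq0.
(* The conditional probability given that [V2] lies in [C]. *)
pose Pc : probability Omega R := mnormalize (mrestr P mV2C) P.
have PcE U : Pc U = (P (U `&` V2 @^-1` C) * (c^-1)%:E)%E.
  rewrite /Pc /= /mnormalize /= /mrestr /= setTI PC (negbTE C0) /=.
  by case: ifP => // /eqP e; move: Cfin; rewrite e.
have : (PX \x nu)%E S' = distribution Pc W S'.
  apply: product_measure_unique => // A B mA mB.
  transitivity (Pc (X @^-1` A `&` V1 @^-1` B)); first by [].
  rewrite PcE (ind A B C mA mB mC) -(fineK Cfin) -/c -!muleA -EFinM mulfV ?gt_eqF// mule1.
  by [].
have -> : distribution Pc W S' = Pc ((fun w => X w * V1 w) @^-1` S) by [].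
rewrite -PWE PcE => ->.
by rewrite -(fineK Cfin) -/c -muleA -EFinM mulVf ?gt_eqF// mule1.
Qed.
End Independence.

(** * Products with an independent normal variable *)

Section NormalIndependence.
Context {R : realType} {d : measure_display} {Omega : measurableType d}.
Variables (P : probability Omega R) (h : R).
Hypothesis h0 : 0 < h.
Local Notation nu := (normal_prob 0 (Num.sqrt h)).
Implicit Types X V : Omega -> R.

Lemma indep_sq_mul X V : measurable_fun setT X -> measurable_fun setT V ->
  indep_law P nu X V -> L1 P (fun w => X w ^+ 2) ->
  L1 P (fun w => (X w * V w) ^+ 2) /\ EX P (fun w => (X w * V w) ^+ 2) = EX P (fun w => X w ^+ 2) * h.
Proof.
move=> mX mV ind iX.
have msq : measurable_fun setT (fun x : R => x ^+ 2).
  by apply: cts_measurable; exact: cts_exp (@cts_id R).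
have e := indep_integral mX mV ind msq msq (@sqr_ge0 R) (@sqr_ge0 R).
rewrite normal_second_moment// (EX_EFin iX) -EFinM in e.
have e' : (\int[P]_w ((X w * V w) ^+ 2)%:E = (EX P (fun w => X w ^+ 2) * h)%:E)%E.
  by rewrite -e; apply: eq_integral => w _; rewrite exprMn.
have iXV : L1 P (fun w => (X w * V w) ^+ 2).
  apply: L1_fin.
  - by apply: (measurableT_comp msq); exact: measurable_funM.
  - by move=> w; exact: sqr_ge0.
  - by rewrite e' ltry.
by split => //; apply: EFin_inj; rewrite -e' EX_EFin.
Qed.

(** [indep_integral] handles nonnegative factors, so both variables are split into positive and
    negative parts; the two parts of [V] have the same mean [c], and the four terms cancel in
    pairs. *)
Lemma indep_mean_mul X V : measurable_fun setT V -> indep_law P nu X V -> L1 P X ->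
  L1 P (fun w => X w * V w) /\ EX P (fun w => X w * V w) = 0.
Proof.
move=> mV ind iX; have mX := L1_meas iX.
have mp := cts_measurable (@cts_rpos R); have mn := cts_measurable (@cts_rneg R).
have [c c0 [ep en]] := normal_first_moment h0.
have part (f g : R -> R) : measurable_fun setT f -> measurable_fun setT g ->
    (forall x, 0 <= f x) -> (forall x, 0 <= g x) -> (forall x, f x <= `|x|) ->
    (\int[nu]_x (g x)%:E = c%:E)%E ->
    L1 P (fun w => f (X w) * g (V w)) /\ EX P (fun w => f (X w) * g (V w)) = EX P (f \o X) * c.
  move=> mf mg f0 g0 fle eg.
  have e := indep_integral mX mV ind mf mg f0 g0.
  have mfX : measurable_fun setT (f \o X) by exact: (measurableT_comp mf mX).
  have ifX : L1 P (f \o X).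
    by apply: (L1_le mfX _ (L1_abs iX)) => w /=; rewrite ger0_norm.
  rewrite eg (EX_EFin ifX) -EFinM in e.
  have i : L1 P (fun w => f (X w) * g (V w)).
    apply: L1_fin.
    - by apply: measurable_funM => //; exact: (measurableT_comp mg mV).
    - by move=> w; rewrite mulr_ge0.
    - by rewrite e ltry.
  by split => //; apply: EFin_inj; rewrite -e EX_EFin.
have [i1 e1] := part _ _ mp mp (@rpos_ge0 R) (@rpos_ge0 R) (@rpos_le R) ep.
have [i2 e2] := part _ _ mp mn (@rpos_ge0 R) (@rneg_ge0 R) (@rpos_le R) en.
have [i3 e3] := part _ _ mn mp (@rneg_ge0 R) (@rpos_ge0 R) (@rneg_le R) ep.
have [i4 e4] := part _ _ mn mn (@rneg_ge0 R) (@rneg_ge0 R) (@rneg_le R) en.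
have XV : (fun w => X w * V w) = (fun w => (rpos (X w) * rpos (V w) - rpos (X w) * rneg (V w)) -
    (rneg (X w) * rpos (V w) - rneg (X w) * rneg (V w))).
  apply/funext => w; rewrite {1}[X w]rposneg {1}[V w]rposneg; ring.
rewrite XV; split; first by apply: L1_sub; apply: L1_sub.
by rewrite EX_sub ?EX_sub ?e1 ?e2 ?e3 ?e4 ?subrr//; apply: L1_sub.
Qed.
End NormalIndependence.

(** * Passage to the limit in a mean-zero sequence *)

Section MeanZeroLimit.
Context {R : realType} {d : measure_display} {Omega : measurableType d}.
Variable P : probability Omega R.

Lemma ae_set (Q : Omega -> Prop) : {ae P, forall w, Q w} ->
  exists G, [/\ measurable G, P (~` G) = 0%E & G `<=` Q].
Proof.
move=> [N [mN PN sN]]; exists (~` N); split; [exact: measurableC|by rewrite setCK|].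
by move=> w Nw; apply: contrapT => h; apply: Nw; exact: sN.
Qed.

Implicit Types X Y : Omega -> R.
Local Notation L1 := (L1 P).
Local Notation EX := (EX P).
Variable G : set Omega.
Hypothesis mG : measurable G.
Hypothesis PG : P (~` G) = 0%E.

Lemma EX_dct (X_ : nat -> Omega -> R) X Y :
  (forall n, measurable_fun setT (X_ n)) -> measurable_fun setT X -> L1 Y ->
  (forall n w, `|X_ n w| <= Y w) -> (forall w, G w -> X_ n w @[n --> \oo] --> X w) ->
  EX (X_ n) @[n --> \oo] --> EX X.
Proof.
move=> mX_ mX iY XY cX.
have aeG (Q : Omega -> Prop) : (forall w, G w -> Q w) -> {ae P, forall w, Q w}.
  move=> GQ; exists (~` G); split => //; first exact: measurableC.
  by move=> w /= nQ Gw; apply: nQ; exact: GQ.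
have iX_ n : L1 (X_ n) by exact: L1_le (mX_ n) (XY n) iY.
have h1 : {ae P, forall w, setT w -> (X_ n w)%:E @[n --> \oo] --> (X w)%:E}.
  by apply: aeG => w Gw _; apply: cvg_EFin; [exact: nearW|exact: cX].
have h2 : {ae P, forall w n, setT w -> (`|(X_ n w)%:E| <= (Y w)%:E)%E}.
  by apply: aeG => w _ n _; rewrite abse_EFin lee_fin.
have mXE n : measurable_fun setT (fun w => (X_ n w)%:E) by exact/measurable_EFinP.
have mXE' : measurable_fun setT (fun w => (X w)%:E) by exact/measurable_EFinP.
have [iX _ cv] := @dominated_convergence _ _ _ P setT measurableT
  (fun n w => (X_ n w)%:E) (fun w => (X w)%:E) (fun w => (Y w)%:E) mXE mXE' h1 iY h2.
apply: fine_cvg; rewrite -/(EX X) -(EX_EFin iX).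
by rewrite (_ : (fun n => _) = fun n => (\int[P]_w (X_ n w)%:E)%E)//; apply/funext => n; rewrite -EX_EFin.
Qed.

Lemma L1_le_ae X Y : measurable_fun setT X -> (forall w, G w -> `|X w| <= Y w) -> L1 Y -> L1 X.
Proof.
move=> mX XY iY; have mI : measurable_fun setT (\1_G : Omega -> R) by exact: measurable_indic.
have i : L1 (fun w => X w * \1_G w).
  apply: (L1_le _ _ (L1_abs iY)); first exact: measurable_funM.
  move=> w; rewrite indicE; have [wG|wG] := boolP (w \in G).
    by rewrite mulr1 (le_trans (XY w (set_mem wG)))// ler_norm.
  by rewrite mulr0 normr0.
have [] // := @EX_ae _ _ _ P G _ X mG PG mX _ i.
by move=> w Gw; rewrite indicE mem_set// mulr1.
Qed.

Lemma EX_le_ae X Y : L1 X -> L1 Y -> (forall w, G w -> X w <= Y w) -> EX X <= EX Y.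
Proof.
move=> iX iY XY; have mI : measurable_fun setT (\1_G : Omega -> R) by exact: measurable_indic.
have cut Z : L1 Z -> L1 (fun w => Z w * \1_G w) /\ EX (fun w => Z w * \1_G w) = EX Z.
  move=> iZ; apply: (EX_ae mG PG) => //.
    by apply: measurable_funM => //; exact: L1_meas iZ.
  by move=> w Gw; rewrite indicE mem_set// mulr1.
have [iX' <-] := cut X iX; have [iY' <-] := cut Y iY.
apply: EX_le => // w; rewrite indicE; have [wG|wG] := boolP (w \in G).
  by rewrite !mulr1 XY//; exact: set_mem.
by rewrite !mulr0.
Qed.

Definition cutoff (K x : R) : R := Num.max (- K) (Num.min K x).

Lemma cutoff_le K x : 0 <= K -> `|cutoff K x| <= K.
Proof.
move=> K0; rewrite /cutoff ler_norml; apply/andP; split.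
  by rewrite le_max lexx.
by rewrite ge_max ge_min lexx/=; lra.
Qed.

Lemma cutoff_le_norm K x : 0 <= K -> `|cutoff K x| <= `|x|.
Proof.
move=> K0; have := ler_norm x; have := ler_norm (- x); rewrite normrN => h1 h2.
rewrite /cutoff ler_norml; case: (leP K x) => h; case: (leP (- K) _) => h'; apply/andP; split; lra.
Qed.

Lemma cutoff_lip K x y : `|cutoff K x - cutoff K y| <= `|x - y|.
Proof.
have := ler_norm (x - y); have := ler_norm (- (x - y)); rewrite normrN => h1 h2.
rewrite /cutoff ler_norml.
by case: (leP K x) => a1; case: (leP K y) => a2; case: (leP (- K) K) => a3;
  case: (leP (- K) x) => a4; case: (leP (- K) y) => a5; apply/andP; split; lra.
Qed.

Lemma cutoff_id K x : `|x| <= K -> cutoff K x = x.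
Proof.
rewrite ler_norml /cutoff => /andP[h1 h2].
by rewrite min_r// max_r.
Qed.

(** The error is zero for [|x| <= K], and otherwise at most [|x|], hence at most [x^2 / K]. *)
Lemma cutoff_err K x : 0 < K -> `|cutoff K x - x| <= K^-1 * x ^+ 2.
Proof.
move=> K0; have [h|h] := leP `|x| K.
  by rewrite cutoff_id// subrr normr0 mulr_ge0 ?sqr_ge0// invr_ge0 ltW.
have e1 : `|cutoff K x - x| <= `|x|.
  move: h; rewrite /cutoff ler_norml; case: (ger0P x) => x0 h; case: (leP K x) => a1;
    case: (leP (- K) K) => a2; case: (leP (- K) x) => a3; apply/andP; split; lra.
apply: le_trans e1 _; rewrite -[x ^+ 2]real_normK ?num_real// expr2 mulrA.
by rewrite ler_peMl// mulrC ler_pdivlMr// mul1r ltW.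
Qed.

Lemma measurable_cutoff K X : measurable_fun setT X -> measurable_fun setT (fun w => cutoff K (X w)).
Proof.
by move=> mX; apply: measurable_maxr => //; apply: measurable_minr.
Qed.

(* The square-integrable mean-zero [J N] are uniformly integrable, so truncating them costs [C / K]. *)
Lemma mean_zero_limit (J D : nat -> Omega -> R) (I : Omega -> R) (C : R) :
  (forall N, measurable_fun setT (J N)) -> (forall N, L1 (fun w => J N w ^+ 2)) ->
  (forall N, EX (fun w => J N w ^+ 2) <= C) -> (forall N, EX (J N) = 0) ->
  (forall N, L1 (D N)) -> (forall N w, 0 <= D N w) -> EX (D N) @[N --> \oo] --> (0 : R) ->
  L1 I ->
  (forall w, G w -> forall eps, 0 < eps -> exists N0, forall N, (N0 <= N)%N ->
     `|J N w - I w| <= D N w + eps) ->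
  EX I = 0.
Proof.
move=> mJ iJ2 JC EJ iD D0 cD iI JI; have mI := L1_meas iI.
have C0 : 0 <= C by apply: le_trans (JC 0%N); apply: EX_ge0 => w; exact: sqr_ge0.
have bounded_L1 (X : Omega -> R) K : measurable_fun setT X -> (forall w, `|X w| <= K) -> L1 X.
  by move=> mX XK; exact: L1_le mX XK (L1_cst P K).
have key K : 0 < K -> `|EX (fun w => cutoff K (I w))| <= K^-1 * C.
  move=> K0; have K0' := ltW K0.
  have iCI : L1 (fun w => cutoff K (I w)).
    by apply: bounded_L1; [exact: measurable_cutoff|move=> w; exact: cutoff_le].
  have iCJ N : L1 (fun w => cutoff K (J N w)).
    by apply: bounded_L1; [exact: measurable_cutoff|move=> w; exact: cutoff_le].
  (* The part of the truncated error not covered by [D N]: it is bounded by [2 K] and tends to 0 on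
     [G], so dominated convergence applies to it, while [D N] converges in mean only. *)
  pose e N w := Num.max (`|cutoff K (I w) - cutoff K (J N w)| - D N w) 0.
  have e0 N w : 0 <= e N w by rewrite /e le_max lexx orbT.
  have eK N w : `|e N w| <= 2 * K.
    rewrite ger0_norm// /e ge_max; apply/andP; split; last by lra.
    have h1 := cutoff_le (I w) K0'; have h2 := cutoff_le (J N w) K0'; have h3 := D0 N w.
    by have := ler_normB (cutoff K (I w)) (cutoff K (J N w)); lra.
  have me N : measurable_fun setT (e N).
    apply: measurable_maxr => //; apply: measurable_funB; last exact: L1_meas (iD N).
    apply: measurableT_comp => //; apply: measurable_funB; exact: measurable_cutoff.
  have ie N : L1 (e N) by exact: bounded_L1 (me N) (eK N).
  have ce : EX (e N) @[N --> \oo] --> EX (fun=> 0).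
    apply: (EX_dct me) (L1_cst P (2 * K)) eK _ => // w Gw.
    apply/cvgrPdist_le => eps eps0; have [N0 hN] := JI w Gw eps eps0.
    exists N0 => // N /= NN; rewrite sub0r normrN ger0_norm// /e ge_max (ltW eps0) andbT.
    have := hN N NN; have := cutoff_lip K (I w) (J N w); rewrite [`|I w - J N w|]distrC; lra.
  rewrite EX_cst in ce.
  have bnd N : `|EX (fun w => cutoff K (I w))| <= K^-1 * C + (EX (e N) + EX (D N)).
    have h1 : `|EX (fun w => cutoff K (J N w))| <= K^-1 * C.
      have iJ : L1 (J N) by exact: L1_of_sq (mJ N) (iJ2 N).
      have -> : EX (fun w => cutoff K (J N w)) = EX (fun w => cutoff K (J N w) - J N w).
        by rewrite EX_sub// EJ subr0.
      have iS : L1 (fun w => cutoff K (J N w) - J N w) by exact: L1_sub.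
      apply: le_trans (EX_norm iS) _.
      apply: (@le_trans _ _ (EX (fun w => K^-1 * J N w ^+ 2))).
        apply: EX_le; [exact: L1_abs|exact: L1_scale|by move=> w; exact: cutoff_err].
      by rewrite EX_scale// ler_wpM2l ?JC// invr_ge0.
    have h2 : `|EX (fun w => cutoff K (I w) - cutoff K (J N w))| <= EX (e N) + EX (D N).
      have iS : L1 (fun w => cutoff K (I w) - cutoff K (J N w)) by exact: L1_sub.
      apply: le_trans (EX_norm iS) _; rewrite -EX_add//.
      apply: EX_le; [exact: L1_abs|exact: L1_add|move=> w].
      by rewrite /e -lerBlDr le_max lexx.
    rewrite EX_sub// in h2.
    have := ler_normD (EX (fun w => cutoff K (I w)) - EX (fun w => cutoff K (J N w))) (EX (fun w => cutoff K (J N w))).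
    by rewrite subrK; lra.
  have cv : (K^-1 * C + (EX (e N) + EX (D N))) @[N --> \oo] --> K^-1 * C + (0 + 0).
    by apply: cvgD; [exact: cvg_cst|exact: cvgD].
  rewrite -[K^-1 * C]addr0 -[X in _ + X](addr0 0).
  apply: ler_cvg_to (cvg_cst _) cv _.
  by apply: nearW => N; exact: bnd.
(* As the level [n + 1] grows, [I] itself dominates its truncations, while the bound [C / (n + 1)]
   tends to 0. *)
have cI : EX (fun w => cutoff n.+1%:R (I w)) @[n --> \oo] --> EX I.
  apply: (EX_dct _ mI (L1_abs iI)).
  - by move=> n; exact: measurable_cutoff.
  - by move=> n w; exact: cutoff_le_norm.
  - move=> w _; apply/cvgrPdist_le => eps eps0.
    exists (Num.trunc `|I w|) => // n /= hn; rewrite cutoff_id ?subrr ?normr0 ?(ltW eps0)//.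
    by apply: ltW; apply: lt_le_trans (truncnS_gt _) _; rewrite ler_nat.
have c0 : (n.+1%:R^-1 * C) @[n --> \oo] --> (0 : R).
  rewrite -[X in _ --> X](mul0r C); apply: cvgM; last exact: cvg_cst.
  exact: cvg_harmonic.
have : `|EX I| <= 0.
  apply: ler_cvg_to (cvg_norm cI) c0 _; apply: nearW => n; exact: key.
by rewrite normr_le0 => /eqP.
Qed.
End MeanZeroLimit.

(** * Random variables measurable for one sigma-algebra of the filtration *)

Section AdaptedVariables.
Context {R : realType} {d : measure_display} {Omega : measurableType d}.
Implicit Types (A : set (set Omega)) (X Y : Omega -> R).

(** The sigma-algebras [F t] change with time over one carrier, so measurability is stated by
    preimages; [FmeasP] relates it to measurability on the generated measurable type. *)
Record Fmeas A X : Prop := {Fmeas_preimage : forall B : set R, measurable B -> A (X @^-1` B)}.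

Lemma FmeasP A X : sigma_algebra setT A ->
  Fmeas A X <-> measurable_fun setT (X : g_sigma_algebraType A -> R).
Proof.
move=> sA; have e : <<s A >> = A by exact: sigma_algebra_id.
split=> [[fX] _ B mB|mX]; first by rewrite setTI; apply: sub_sigma_algebra; exact: fX.
split=> B mB; have := mX measurableT B mB; rewrite setTI => h.
by rewrite -e.
Qed.

Lemma Fmeas_rays A X : sigma_algebra setT A -> (forall c, A [set w | c < X w]) -> Fmeas A X.
Proof.
move=> sA h; apply/FmeasP => // mT.
apply: (measurability _ (RGenOInfty.measurableE R)) => //.
move=> /= _ [_ [c ->] <-]; rewrite setTI preimage_itvoy.
by apply: sub_sigma_algebra; exact: h.
Qed.

Lemma Fmeas_mono A A' X : A `<=` A' -> Fmeas A X -> Fmeas A' X.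
Proof. by move=> AA [fX]; split=> B mB; apply: AA; exact: fX. Qed.

Lemma Fmeas_measurable A X : A `<=` measurable -> Fmeas A X -> measurable_fun setT X.
Proof. by move=> Am [fX] _ B mB; rewrite setTI; apply: Am; exact: fX. Qed.

Section Closure.
Variable A : set (set Omega).
Hypothesis sA : sigma_algebra setT A.

Lemma Fmeas_cst c : Fmeas A (fun=> c).
Proof. by apply/FmeasP => //; exact: measurable_cst. Qed.

Lemma Fmeas_mul X Y : Fmeas A X -> Fmeas A Y -> Fmeas A (fun w => X w * Y w).
Proof. by move=> /(FmeasP _ sA) fX /(FmeasP _ sA) fY; apply/FmeasP => //; exact: measurable_funM. Qed.

Lemma Fmeas_add X Y : Fmeas A X -> Fmeas A Y -> Fmeas A (fun w => X w + Y w).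
Proof. by move=> /(FmeasP _ sA) fX /(FmeasP _ sA) fY; apply/FmeasP => //; exact: measurable_funD. Qed.

Lemma Fmeas_sub X Y : Fmeas A X -> Fmeas A Y -> Fmeas A (fun w => X w - Y w).
Proof. by move=> /(FmeasP _ sA) fX /(FmeasP _ sA) fY; apply/FmeasP => //; exact: measurable_funB. Qed.

Lemma Fmeas_sum n (F : nat -> Omega -> R) : (forall i, Fmeas A (F i)) ->
  Fmeas A (fun w => \sum_(0 <= i < n) F i w).
Proof.
move=> fF; elim: n => [|n ih].
  have -> : (fun w => \sum_(0 <= i < 0) F i w) = fun=> 0 by apply/funext => w; rewrite big_geq.
  exact: Fmeas_cst.
have -> : (fun w => \sum_(0 <= i < n.+1) F i w) = fun w => \sum_(0 <= i < n) F i w + F n w.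
  by apply/funext => w; rewrite big_nat_recr.
exact: Fmeas_add.
Qed.
End Closure.
End AdaptedVariables.

(** * Sums of adapted coefficients times Brownian increments *)

Section BrownianSums.
Context {R : realType} {d : measure_display} {Omega : measurableType d}.
Variables (P : probability Omega R) (F : R -> set (set Omega)) (beta : nat -> R -> Omega -> R).
Hypothesis hF : filtration F.
Hypothesis hW : cylindrical_wiener P F beta.
Implicit Types X J : Omega -> R.
Local Notation L1 := (L1 P).
Local Notation EX := (EX P).

Lemma filtration_sigma t : 0 <= t -> sigma_algebra setT (F t).
Proof. by case: hF => + _ _; apply. Qed.

Lemma Fmeas_meas t X : 0 <= t -> Fmeas (F t) X -> measurable_fun setT X.
Proof. by move=> t0; apply: Fmeas_measurable; case: hF => _ + _; apply. Qed.

Lemma Fmeas_later t1 t2 X : 0 <= t1 -> t1 <= t2 -> Fmeas (F t1) X -> Fmeas (F t2) X.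
Proof. by move=> t0 t12; apply: Fmeas_mono; case: hF => _ _; apply. Qed.

Lemma Fmeas_beta j t : 0 <= t -> Fmeas (F t) (beta j t).
Proof. by case: hW => _ hm _ _ t0; split => B; exact: hm. Qed.

Section Increment.
Variables t1 t2 : R.
Hypothesis t10 : 0 <= t1.
Hypothesis t12 : t1 < t2.
Local Notation h := (t2 - t1).
Local Notation nu := (normal_prob 0 (Num.sqrt h)).
Let V j w := beta j t2 w - beta j t1 w.
Let h0 : 0 < h. Proof. by rewrite subr_gt0. Qed.
Let t20 : 0 <= t2. Proof. exact: le_trans (ltW t12). Qed.

Lemma Fmeas_increment j : Fmeas (F t2) (V j).
Proof.
apply: Fmeas_sub; first exact: filtration_sigma.
  exact: Fmeas_beta.
exact: (Fmeas_later t10 (ltW t12)) (Fmeas_beta _ t10).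
Qed.

Lemma increment_measurable j : measurable_fun setT (V j).
Proof. exact: Fmeas_meas t20 (Fmeas_increment j). Qed.

Lemma increment_indep j X : Fmeas (F t1) X -> indep_law P nu X (V j).
Proof.
move=> fX A B mA mB; case: hW => _ _ hW3 _.
(* The product formula covers the first [j + 1] modes; only the last of them is constrained. *)
pose B' (i : 'I_j.+1) := if i == ord_max then B else setT.
have mB' i : measurable (B' i) by rewrite /B'; case: ifP.
have := hW3 t1 t2 t10 t12 _ (Fmeas_preimage fX mA) j.+1 B' mB'.
rewrite big_ord_recr/= big1 ?mul1e; last first.
  move=> i _; rewrite /B' (_ : (_ == _) = false) ?probability_setT//.
  by apply/negbTE; rewrite -val_eqE /= neq_ltn ltn_ord.
rewrite {2}/B' eqxx => <-; congr (P _); congr (_ `&` _).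
rewrite eqEsubset; split => w /=.
  by move=> hw i; rewrite /B'; case: eqP => [->|].
by move=> /(_ ord_max); rewrite /B' eqxx.
Qed.

(** The product formula, constrained at the modes [j] and [k] only, is the triple factorization that
    [indep_pair_mul] asks for. *)
Lemma increment_indep2 j k X : (j < k)%N -> Fmeas (F t1) X -> indep_law P nu (fun w => X w * V j w) (V k).
Proof.
move=> jk fX; apply: indep_pair_mul; [exact: Fmeas_meas fX|exact: increment_measurable|
  exact: increment_measurable|].
move=> A B C mA mB mC; case: hW => _ _ hW3 _.
have jk' : (j < k.+1)%N by exact: ltnW.
pose J := Ordinal jk'.
have JM : J != ord_max by rewrite -val_eqE /= neq_ltn jk.
pose B' (i : 'I_k.+1) := if i == ord_max then C else if i == J then B else setT.
have mB' i : measurable (B' i) by rewrite /B'; case: ifP => // _; case: ifP.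
have := hW3 t1 t2 t10 t12 _ (Fmeas_preimage fX mA) k.+1 B' mB'.
rewrite (bigD1 J)//= (bigD1 (ord_max : 'I_k.+1)) 1?eq_sym//= big1 ?mule1; last first.
  by move=> i /andP[i1 i2]; rewrite /B' (negbTE i1) (negbTE i2) probability_setT.
rewrite {2 3}/B' (negbTE JM) !eqxx => <-; congr (P _).
rewrite eqEsubset; split => w /=.
  move=> [[Aw Bw] Cw]; split => // i; rewrite /B'; case: eqP => [->//|_].
  by case: eqP => [->|].
move=> [Aw hw]; split; last by have := hw ord_max; rewrite /B' eqxx.
by split => //; have := hw J; rewrite /B' (negbTE JM) eqxx.
Qed.

Lemma increment_sq j X : Fmeas (F t1) X -> L1 (fun w => X w ^+ 2) ->
  L1 (fun w => (X w * V j w) ^+ 2) /\ EX (fun w => (X w * V j w) ^+ 2) = EX (fun w => X w ^+ 2) * h.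
Proof.
move=> fX; apply: (indep_sq_mul h0); [exact: Fmeas_meas fX|exact: increment_measurable|exact: increment_indep].
Qed.

Lemma increment_mean j X : Fmeas (F t1) X -> L1 X ->
  L1 (fun w => X w * V j w) /\ EX (fun w => X w * V j w) = 0.
Proof.
by move=> fX; apply: (indep_mean_mul h0); [exact: increment_measurable|exact: increment_indep].
Qed.

Lemma increment_cross j k X : (j < k)%N -> Fmeas (F t1) X -> L1 X ->
  L1 (fun w => X w * V j w * V k w) /\ EX (fun w => X w * V j w * V k w) = 0.
Proof.
move=> jk fX iX; apply: (indep_mean_mul h0); [exact: increment_measurable|exact: increment_indep2|].
by have [] := increment_mean j fX iX.
Qed.

(** One mode is added at a time. Its cross terms with [J] and with the earlier modes have mean zero
    by independence, so only squares survive. *)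
Lemma increment_sum J (X : nat -> Omega -> R) n : Fmeas (F t1) J -> (forall j, Fmeas (F t1) (X j)) ->
  L1 (fun w => J w ^+ 2) -> (forall j, L1 (fun w => X j w ^+ 2)) -> EX J = 0 ->
  let S w := J w + \sum_(0 <= j < n) X j w * V j w in
  [/\ L1 (fun w => S w ^+ 2), EX S = 0 &
      EX (fun w => S w ^+ 2) = EX (fun w => J w ^+ 2) + h * \sum_(0 <= j < n) EX (fun w => X j w ^+ 2)].
Proof.
move=> fJ fX iJ iX EJ /=; have mJ := Fmeas_meas t10 fJ; have mX j := Fmeas_meas t10 (fX j).
have iJ1 : L1 J by exact: L1_of_sq.
have iX1 j : L1 (X j) by exact: L1_of_sq.
have fXX j k : Fmeas (F t1) (fun w => X j w * X k w).
  by apply: Fmeas_mul => //; exact: filtration_sigma.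
have fJX k : Fmeas (F t1) (fun w => J w * X k w).
  by apply: Fmeas_mul => //; exact: filtration_sigma.
have iXX j k : L1 (fun w => X j w * X k w) by exact: L1_mul.
have iJX k : L1 (fun w => J w * X k w) by exact: L1_mul.
elim: n => [|n [ih1 ih2 ih3]].
  have e0 w : J w + \sum_(0 <= j < 0) X j w * V j w = J w by rewrite big_geq ?addr0.
  split; under eq_fun => w do rewrite e0; [by []|by []|].
  by rewrite [\sum_(0 <= j < 0) EX _]big_geq// mulr0 addr0.
set S := fun w => J w + \sum_(0 <= j < n) X j w * V j w in ih1 ih2 ih3.
have SE w : J w + \sum_(0 <= j < n.+1) X j w * V j w = S w + X n w * V n w.
  by rewrite big_nat_recr//= addrA.
have mS : measurable_fun setT S.
  apply: measurable_funD => //; apply: measurable_sum => j.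
  by apply: measurable_funM => //; exact: increment_measurable.
have iS : L1 S by exact: L1_of_sq.
have [i1 e1] := increment_mean n (fX n) (iX1 n).
have [i2 e2] := increment_sq n (fX n) (iX n).
have [i3 e3] := increment_mean n (fJX n) (iJX n).
(* Set to 0 outside [j < n], because sums of integrable terms are handled for families integrable at
   every index. *)
pose cr j w := if (j < n)%N then X j w * X n w * V j w * V n w else 0.
have icr j : L1 (cr j).
  rewrite /cr; have [jn|jn] := boolP (j < n)%N; last exact: L1_cst.
  by have [] := increment_cross jn (fXX j n) (iXX j n).
have ecr j : EX (cr j) = 0.
  rewrite /cr; have [jn|jn] := boolP (j < n)%N; last exact: EX_cst.
  by have [] := increment_cross jn (fXX j n) (iXX j n).
pose Z w := J w * X n w * V n w + \sum_(0 <= j < n) cr j w.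
have iZ : L1 Z by apply: L1_add => //; exact: L1_sum.
have eZ : EX Z = 0.
  rewrite EX_add//; last exact: L1_sum.
  by rewrite e3 EX_sum// big1 ?addr0// => j _; exact: ecr.
have sqE : (fun w => (J w + \sum_(0 <= j < n.+1) X j w * V j w) ^+ 2) =
    fun w => 2 * Z w + (S w ^+ 2 + (X n w * V n w) ^+ 2).
  apply/funext => w; rewrite SE.
  have -> : Z w = S w * (X n w * V n w).
    rewrite /Z /S mulrDl mulrA; congr (_ + _); rewrite mulr_suml; apply: eq_big_nat => j /andP[_ jn].
    by rewrite /cr jn; ring.
  by ring.
have iT : L1 (fun w => S w ^+ 2 + (X n w * V n w) ^+ 2) by exact: L1_add.
rewrite sqE; split.
- exact: L1_lin.
- by under eq_fun => w do rewrite SE; rewrite EX_add// ih2 e1 addr0.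
- by rewrite EX_lin// eZ EX_add// ih3 e2 [in RHS]big_nat_recr//=; ring.
Qed.
End Increment.

(** A discrete Ito isometry, by induction on time: the sum up to [tt m] is measurable for [F (tt m)]
    and takes the place of [J] in [increment_sum]. *)
Lemma step_sum (tt : nat -> R) (X : nat -> nat -> Omega -> R) n m :
  0 <= tt 0%N -> (forall i, tt i < tt i.+1) ->
  (forall i j, (i < m)%N -> Fmeas (F (tt i)) (X i j)) ->
  (forall i j, (i < m)%N -> L1 (fun w => X i j w ^+ 2)) ->
  let S w := \sum_(0 <= i < m) \sum_(0 <= j < n) X i j w * (beta j (tt i.+1) w - beta j (tt i) w) in
  [/\ Fmeas (F (tt m)) S, L1 (fun w => S w ^+ 2), EX S = 0 &
      EX (fun w => S w ^+ 2) =
      \sum_(0 <= i < m) (tt i.+1 - tt i) * \sum_(0 <= j < n) EX (fun w => X i j w ^+ 2)].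
Proof.
move=> t0 tS /=.
have tt0 i : 0 <= tt i by elim: i => // i ih; exact: le_trans (ltW (tS i)).
elim: m => [|m ih] fX iX.
  have e0 w : \sum_(0 <= i < 0) \sum_(0 <= j < n) X i j w * (beta j (tt i.+1) w - beta j (tt i) w) = 0.
    by rewrite big_geq.
  split; under eq_fun => w do rewrite e0.
  - by apply: (Fmeas_cst (filtration_sigma (tt0 0%N))).
  - by under eq_fun => w do rewrite expr0n; exact: L1_cst.
  - exact: EX_cst.
  - by under eq_fun => w do rewrite expr0n; rewrite [RHS]big_geq// EX_cst.
have [f1 i1 e1 v1] := ih (fun i j im => fX i j (ltnW im)) (fun i j im => iX i j (ltnW im)).
have [i2 e2 v2] := increment_sum (tt0 m) (tS m) n f1 (fun j => fX m j (ltnSn m)) i1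
  (fun j => iX m j (ltnSn m)) e1.
have SE w : \sum_(0 <= i < m.+1) \sum_(0 <= j < n) X i j w * (beta j (tt i.+1) w - beta j (tt i) w) =
   \sum_(0 <= i < m) \sum_(0 <= j < n) X i j w * (beta j (tt i.+1) w - beta j (tt i) w) +
   \sum_(0 <= j < n) X m j w * (beta j (tt m.+1) w - beta j (tt m) w).
  by rewrite big_nat_recr.
have sA := filtration_sigma (tt0 m.+1).
split.
- under eq_fun => w do rewrite SE.
  have later (Y : Omega -> R) : Fmeas (F (tt m)) Y -> Fmeas (F (tt m.+1)) Y.
    exact: Fmeas_later (tt0 m) (ltW (tS m)).
  apply: Fmeas_add => //; first exact: later.
  apply: (Fmeas_sum sA) => j; apply: Fmeas_mul => //; first by apply: later; exact: fX.
  exact: Fmeas_increment (tt0 m) (tS m) j.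
- by under eq_fun => w do rewrite SE.
- by under eq_fun => w do rewrite SE.
- by under eq_fun => w do rewrite SE; rewrite v2 v1 [in RHS]big_nat_recr.
Qed.

(** The Brownian motions start at 0 almost surely, so off a null set their values are increments
    from time 0. The case [t = 0] is separate, since increments require distinct times. *)
Lemma beta_moments t j k : 0 <= t ->
  L1 (fun w => beta j t w * beta k t w) /\
  EX (fun w => beta j t w * beta k t w) = (j == k)%:R * t.
Proof.
move=> t00.
have f1 : Fmeas (F 0) (fun=> 1 : R) by exact: (Fmeas_cst (filtration_sigma (lexx 0))).
have z0 i : {ae P, forall w, beta i 0 w = 0} by case: hW.
have [G1 [mG1 PG1 sG1]] := z0 j; have [G2 [mG2 PG2 sG2]] := z0 k.
have [GE mG PG] : [/\ forall w, (~` (G1 `|` G2)) w -> beta j 0 w = 0 /\ beta k 0 w = 0,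
    measurable (~` (G1 `|` G2)) & P (~` ~` (G1 `|` G2)) = 0%E].
  split.
  - move=> w /not_orP[w1 w2]; split.
      by apply: contrapT => h; apply: w1; apply: sG1.
    by apply: contrapT => h; apply: w2; apply: sG2.
  - by apply: measurableC; exact: measurableU.
  - rewrite setCK; apply/eqP; rewrite -measure_le0; apply: (le_trans (measureU2 P mG1 mG2)).
    by rewrite [X in (X + _)%E]PG1 [X in (_ + X)%E]PG2 adde0.
have mb i : measurable_fun setT (beta i t) by exact: Fmeas_meas t00 (Fmeas_beta i t00).
have [te|tn] := eqVneq t 0.
  rewrite te mulr0; have [] := EX_ae mG PG (measurable_funM (mb j) (mb k)) _ (L1_cst P 0).
    by move=> w /GE[e1 e2]; rewrite /= te e1 mul0r.
  by rewrite te EX_cst.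
have t0 : 0 < t by rewrite lt_def tn.
have main : L1 (fun w => (beta j t w - beta j 0 w) * (beta k t w - beta k 0 w)) /\
   EX (fun w => (beta j t w - beta j 0 w) * (beta k t w - beta k 0 w)) = (j == k)%:R * t.
  have sym j' k' : (j' < k')%N -> L1 (fun w => (beta j' t w - beta j' 0 w) * (beta k' t w - beta k' 0 w)) /\
     EX (fun w => (beta j' t w - beta j' 0 w) * (beta k' t w - beta k' 0 w)) = 0.
    move=> jk; have := increment_cross (lexx 0) t0 jk f1 (L1_cst P 1).
    by under eq_fun => w do rewrite mul1r.
  case: (ltngtP j k) => jk.
  - by rewrite mul0r; exact: sym.
  - by under eq_fun => w do rewrite mulrC; rewrite mul0r; exact: sym.
  - rewrite -jk mul1r; have i1 : L1 (fun _ : Omega => 1 ^+ 2) by rewrite expr1n; exact: L1_cst.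
    have := increment_sq (lexx 0) t0 j f1 i1.
    rewrite expr1n EX_cst mul1r subr0.
    by under eq_fun => w do rewrite mul1r expr2.
case: main => i e.
have [] := EX_ae mG PG (measurable_funM (mb j) (mb k)) _ i.
  by move=> w /GE[-> ->]; rewrite !subr0.
by move=> i' ->.
Qed.
End BrownianSums.

(** * Adaptedness of functionals of H^s-valued processes *)

Section AdaptedFunctionals.
Context {R : realType} {d : measure_display} {Omega : measurableType d}.
Variables a b s : R.
Hypothesis hab : a < b.
Hypothesis hs : 5 / 2 < s.
Local Notation sobolev := (sobolev a b s).
Local Notation Hnorm2 := (Hnorm2 a b s).
Local Notation C2 := (C2 a b).
Local Notation C2le := (C2le a b).
Local Notation hdot := (hdot a b).

(** Lower semicontinuity on H^s: it makes [c < J f] an open condition, and such events generate the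
    Borel sets of the line. *)
Definition lower_continuous (J : (R -> R) -> R) : Prop := forall f c, sobolev f -> c < J f ->
  exists2 eps : R, 0 < eps & forall g, sobolev g -> (Hnorm2 (g \- f)%R < eps%:E)%E -> c < J g.

Lemma lower_continuous_hdot psi : sobolev psi -> lower_continuous (hdot^~ psi).
Proof.
move=> spsi f c sf cf; have [K CK] := sobolev_bounded hab hs spsi.
have Cpsi := C2le_C2 CK; have [Cf _] := sobolev_hdot hab hs sf.
have [M M0 KM] : exists2 M, 0 < M & 2 * K <= M.
  exists (2 * Num.max K 1); first by rewrite mulr_gt0// lt_max ltr01 orbT.
  by rewrite ler_pM2l// le_max lexx.
have e0 : 0 < (hdot f psi - c) / (2 * M).
  by apply: divr_gt0; [rewrite subr_gt0|exact: mulr_gt0].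
have [eta eta0 heta] := sobolev_small hab hs e0; exists eta => // g sg gf.
have [g1 [g2 [Cgf gfe]]] := heta _ (sobolev_sub hab sg sf) gf.
have [Cg _] := sobolev_hdot hab hs sg.
have Cr : C2 (g \- f) by exists g1, g2.
have h1 : `|hdot (g \- f) psi| <= (hdot f psi - c) / (2 * M) * (2 * K).
  by apply: (hdot_bound hab Cr _ CK) => x; case: (gfe x).
have h2 : (hdot f psi - c) / (2 * M) * (2 * K) <= (hdot f psi - c) / (2 * M) * M.
  by rewrite ler_pM2l.
have h3 : (hdot f psi - c) / (2 * M) * M = (hdot f psi - c) / 2.
  by field; rewrite lt0r_neq0.
have h4 : hdot (g \- f) psi = hdot g psi - hdot f psi by exact: (hdot_subl hab Cg Cf Cpsi).
move: h1; rewrite h4 ler_norml => /andP[h1 _].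
move: h1 h2 h3; move: (hdot f psi) (hdot g psi) cf => A B cf; lra.
Qed.

(** From [|g|^2 >= 2 <g, f> - |f|^2]: the square inherits lower semicontinuity at [f] from the
    linear functional given by [f]. *)
Lemma lower_continuous_sq : lower_continuous (fun f => hdot f f).
Proof.
move=> f c sf cf.
have [Cf _] := sobolev_hdot hab hs sf.
have cf2 : (hdot f f + c) / 2 < hdot f f by move: (hdot f f) cf => A; lra.
have [eta eta0 heta] := lower_continuous_hdot sf sf cf2; exists eta => // g sg gf.
have [Cg _] := sobolev_hdot hab hs sg; have h := heta g sg gf.
have Cr : C2 (fun x => (-1) * f x + g x) by exact: C2_lin.
have := hdot_ge0 hab Cr; rewrite (hdot_lin_sq hab (-1) Cf Cg) (hdotC a b f g).
by move: h cf; move: (hdot f f) (hdot g g) (hdot g f) => A B D; lra.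
Qed.

Lemma lower_continuous_cst c : lower_continuous (fun=> c).
Proof. by move=> f c' _ cc; exists 1. Qed.

(* The value [0] is used off the event on which the process is alive and [H^s]-valued. *)
Definition pfunc (tau : Omega -> \bar R) (u : R -> Omega -> R -> R) (J : (R -> R) -> R) (t : R) (w : Omega) : R :=
  if `[< (t%:E < tau w)%E /\ sobolev (u t w) >] then J (u t w) else 0.

Lemma pfuncE tau u J t w : (t%:E < tau w)%E -> sobolev (u t w) -> pfunc tau u J t w = J (u t w).
Proof. by move=> tt su; rewrite /pfunc ifT//; apply/asboolP. Qed.

Lemma pfunc_ge0 tau u J t w : (forall f, sobolev f -> 0 <= J f) -> 0 <= pfunc tau u J t w.
Proof. by move=> J0; rewrite /pfunc; case: asboolP => // -[_ /J0]. Qed.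

Lemma Fmeas_pfunc (F : R -> set (set Omega)) tau u J t : filtration F -> adapted a b F s tau u ->
  0 <= t -> lower_continuous J -> Fmeas (F t) (pfunc tau u J t).
Proof.
move=> hF au t0 lJ; have sA := filtration_sigma hF t0.
have oS : sobolev_open a b s sobolev by split => // f sf; exists 1.
have oU c : sobolev_open a b s [set f | sobolev f /\ c < J f].
  split=> [f []//|f [sf cf]]; have [eps e0 he] := lJ f c sf cf.
  by exists eps => // g sg gf; split => //; exact: he.
apply: Fmeas_rays => // c.
have A1 := au t t0 _ (oU c).
have [c0|c0] := leP 0 c.
  rewrite (_ : [set w | _] = [set w | (t%:E < tau w)%E /\ [set f | sobolev f /\ c < J f] (u t w)])//.
  rewrite eqEsubset; split => w /=; rewrite /pfunc; case: asboolP => //.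
  - by move=> [h1 h2] h3.
  - by move=> _ h; move: (le_lt_trans c0 h); rewrite ltxx.
  - by move=> _ [_ []].
  - by move=> h [h1 [h2 _]]; case: h.
(* For negative [c] the default value 0 exceeds [c], so the event on which the process is dead or
   outside H^s has to be added. *)
have A2 := au t t0 _ oS.
rewrite (_ : [set w | _] = [set w | (t%:E < tau w)%E /\ [set f | sobolev f /\ c < J f] (u t w)] `|`
   ~` [set w | (t%:E < tau w)%E /\ sobolev (u t w)]).
  have sF : <<s F t >> = F t by exact: sigma_algebra_id.
  rewrite -sF; apply: (@measurableU _ (g_sigma_algebraType (F t))).
    by apply: sub_sigma_algebra.
  by apply: (@measurableC _ (g_sigma_algebraType (F t))); apply: sub_sigma_algebra.
rewrite eqEsubset; split => w /=; rewrite /pfunc; case: asboolP => //.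
- by move=> [h1 h2] h3; left.
- by move=> h _; right.
- by move=> h [[_ []]|].
Qed.
End AdaptedFunctionals.

(** * The stochastic integral: mode sums, remainders and second moment *)

Section NoiseMoments.
Context {R : realType} {d : measure_display} {Omega : measurableType d}.
Variables a b s : R.
Hypothesis hab : a < b.
Hypothesis hs : 5 / 2 < s.
Variables (P : probability Omega R) (F : R -> set (set Omega)) (beta : nat -> R -> Omega -> R).
Hypothesis hF : filtration F.
Hypothesis hW : cylindrical_wiener P F beta.
Variables (e : nat -> R -> R) (Phi : (R -> R) -> R -> R) (M : R -> Omega -> R -> R).
Hypothesis he : forall j, L20 a b (e j).
Hypothesis hPhi : hilbert_schmidt a b e (s - 2) Phi.
Hypothesis hM : stochastic_integral a b P F e beta s (Lam a b \o Phi) M.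

Local Notation sobolev := (sobolev a b s).
Local Notation Hnorm2 := (Hnorm2 a b).
Local Notation C2 := (C2 a b).
Local Notation hdot := (hdot a b).
Local Notation L1 := (L1 P).
Local Notation EX := (EX P).

Definition psi j : R -> R := Lam a b (Phi (e j)).

Lemma sobolev_psi j : sobolev (psi j).
Proof. by case: hPhi => h _ _ _; apply: sobolev_Lam => //; case: (h _ (he j)). Qed.

Lemma C2_psi j : C2 (psi j).
Proof. by case: (sobolev_hdot hab hs (sobolev_psi j)). Qed.

Definition noise_rate : R := limn (series (fun j => hdot (psi j) (psi j))).

(** Since [1 <= s], the H^1 norm of [Lam (Phi (e j))] is at most its H^s norm, which is the H^(s-2)
    norm of [Phi (e j)]. *)
Lemma psi_sq_summable : cvgn (series (fun j => hdot (psi j) (psi j))) /\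
  HSnorm2 a b e 1 (Lam a b \o Phi) = noise_rate%:E.
Proof.
have w0 j : 0 <= hdot (psi j) (psi j) by exact: (hdot_ge0 hab (C2_psi j)).
have eN j : (Hnorm2 1 ((Lam a b \o Phi) (e j)) = (hdot (psi j) (psi j))%:E)%E.
  by case: (sobolev_hdot hab hs (sobolev_psi j)).
have -> : (HSnorm2 a b e 1 (Lam a b \o Phi) = \sum_(0 <= j <oo) (hdot (psi j) (psi j))%:E)%E.
  by rewrite /HSnorm2; apply: eq_eseriesr => j _; exact: eN.
apply: nnseries_real => //.
case: hPhi => hS _ _ fin; apply: le_lt_trans fin.
apply: lee_nneseries => [j _|j _]; first by rewrite lee_fin.
have [[pf cf _] _] := hS _ (he j).
rewrite -(eN j) -(Hnorm2_Lam hab _ ((continuousP_cts _).1 cf) pf).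
apply: Hnorm2_le; [exact: hab|by have := hs; lra|].
exact: sobolev_cts (sobolev_psi j).
Qed.

Lemma noise_rate_ge0 : 0 <= noise_rate.
Proof.
have [_ h] := psi_sq_summable; rewrite -lee_fin -h.
by apply: nneseries_ge0 => j _ _; exact: Hnorm2_ge0.
Qed.

Lemma noise_partial_le n : \sum_(0 <= j < n) hdot (psi j) (psi j) <= noise_rate.
Proof.
have [cv _] := psi_sq_summable.
apply: (nondecreasing_cvgn_le _ cv n).
by apply: nondecreasing_series => j _ _; exact: (hdot_ge0 hab (C2_psi j)).
Qed.

Definition Sn n (t : R) (w : Omega) : R -> R := fun x => \sum_(0 <= j < n) beta j t w * psi j x.

Lemma C2_Sn n t w : C2 (Sn n t w).
Proof.
elim: n => [|n ih].
  have := C2_lin (-1) (C2_psi 0) (C2_psi 0); congr C2.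
  by apply/funext => x; rewrite /Sn big_geq// mulN1r addrC subrr.
have := C2_lin (beta n t w) (C2_psi n) ih; congr C2.
by apply/funext => x; rewrite /Sn big_nat_recr//= addrC.
Qed.

Lemma hdot_Sn n t w f : C2 f -> hdot (Sn n t w) f = \sum_(0 <= j < n) beta j t w * hdot (psi j) f.
Proof.
move=> Cf; elim: n => [|n ih].
  have h := hdot_subl hab (C2_psi 0) (C2_psi 0) Cf; rewrite subrr in h; rewrite big_geq// -h.
  by congr hdot; apply/funext => x; rewrite /Sn big_geq// subrr.
have h := hdot_linl hab (beta n t w) (C2_psi n) (C2_Sn n t w) Cf.
rewrite big_nat_recr//= -ih addrC -h.
by congr hdot; apply/funext => x; rewrite /Sn big_nat_recr//= addrC.
Qed.

(** The square norm of [Sn], expanded as a polynomial in the Brownian values, whose moments are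
    known. *)
Definition Sq n t w := \sum_(0 <= j < n) beta j t w * \sum_(0 <= k < n) beta k t w * hdot (psi k) (psi j).

Lemma SqE n t w : hdot (Sn n t w) (Sn n t w) = Sq n t w.
Proof.
rewrite (hdot_Sn n t w (C2_Sn n t w)); apply: eq_bigr => j _; congr (_ * _).
by rewrite hdotC (hdot_Sn n t w (C2_psi j)).
Qed.

Lemma Sq_moment n t : 0 <= t ->
  L1 (Sq n t) /\ EX (Sq n t) = t * \sum_(0 <= j < n) hdot (psi j) (psi j).
Proof.
move=> t0.
have E : Sq n t = fun w => \sum_(0 <= j < n) \sum_(0 <= k < n)
    hdot (psi k) (psi j) * (beta j t w * beta k t w).
  apply/funext => w; apply: eq_bigr => j _; rewrite mulr_sumr; apply: eq_bigr => k _; ring.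
have i1 j k : L1 (fun w => hdot (psi k) (psi j) * (beta j t w * beta k t w)).
  by apply: L1_scale; case: (beta_moments hF hW j k t0).
have i2 j : L1 (fun w => \sum_(0 <= k < n) hdot (psi k) (psi j) * (beta j t w * beta k t w)).
  by apply: L1_sum.
rewrite E; split; first exact: L1_sum.
rewrite EX_sum// mulr_sumr; apply: eq_big_nat => j /andP[_ jn].
rewrite EX_sum// (bigD1_seq j) /=; [|by rewrite mem_index_iota|exact: iota_uniq].
rewrite big1 => [|k kj].
  by have [h1 h2] := beta_moments hF hW j j t0; rewrite EX_scale// h2 eqxx /= mulr1n; ring.
by have [h1 h2] := beta_moments hF hW j k t0; rewrite EX_scale// h2 eq_sym (negbTE kj) /= mulr0n; ring.
Qed.

(* Adaptedness only makes such functionals of [M] measurable; this is why the remainder [QR n] of [M] after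
   [n] modes is defined as a polynomial in them (its meaning is [QRE]). *)
Definition Qm := pfunc a b s (fun=> +oo%E) M (fun f => hdot f f).
Definition Mm j := pfunc a b s (fun=> +oo%E) M (hdot^~ (psi j)).
Definition On := pfunc a b s (fun=> +oo%E) M (fun=> 1).
Definition QR n t w := On t w * (Qm t w - 2 * \sum_(0 <= j < n) beta j t w * Mm j t w + Sq n t w).

Lemma QmE t w : sobolev (M t w) -> Qm t w = hdot (M t w) (M t w).
Proof. by move=> sM; rewrite /Qm pfuncE// ltry. Qed.

Lemma MmE j t w : sobolev (M t w) -> Mm j t w = hdot (M t w) (psi j).
Proof. by move=> sM; rewrite /Mm pfuncE// ltry. Qed.

Lemma OnE t w : sobolev (M t w) -> On t w = 1.
Proof. by move=> sM; rewrite /On pfuncE// ltry. Qed.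

Lemma On0 t w : ~ sobolev (M t w) -> On t w = 0.
Proof. by move=> sM; rewrite /On /pfunc; case: asboolP => // -[]. Qed.

Let adM : adapted a b F s (fun=> +oo%E) M. Proof. by case: hM. Qed.

Lemma Fmeas_Qm t : 0 <= t -> Fmeas (F t) (Qm t).
Proof. move=> t0; apply: (Fmeas_pfunc hF adM t0); exact: lower_continuous_sq. Qed.

Lemma Fmeas_Mm j t : 0 <= t -> Fmeas (F t) (Mm j t).
Proof. move=> t0; apply: (Fmeas_pfunc hF adM t0); apply: lower_continuous_hdot => //; exact: sobolev_psi. Qed.

Lemma Fmeas_On t : 0 <= t -> Fmeas (F t) (On t).
Proof. move=> t0; apply: (Fmeas_pfunc hF adM t0); exact: lower_continuous_cst. Qed.

Lemma Qm_ge0 t w : 0 <= Qm t w.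
Proof. by apply: pfunc_ge0 => f sf; apply: hdot_ge0 => //; case: (sobolev_hdot hab hs sf). Qed.

Lemma QRE n t w : sobolev (M t w) ->
  QR n t w = hdot (fun x => M t w x - Sn n t w x) (fun x => M t w x - Sn n t w x).
Proof.
move=> sM; have [Cm _] := sobolev_hdot hab hs sM; have Cs := C2_Sn n t w; have Cd := C2_sub Cm Cs.
rewrite /QR (OnE sM) (QmE sM) mul1r.
have -> : \sum_(0 <= j < n) beta j t w * Mm j t w = hdot (M t w) (Sn n t w).
  rewrite hdotC (hdot_Sn n t w Cm); apply: eq_bigr => j _.
  by rewrite (MmE _ sM) hdotC.
rewrite -(SqE n t w) (hdot_subl hab Cm Cs Cd) (hdot_subr hab Cm Cs Cm) (hdot_subr hab Cm Cs Cs).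
rewrite (hdotC a b (Sn n t w) (M t w)); ring.
Qed.

Lemma QR_ge0 n t w : 0 <= QR n t w.
Proof.
have [sM|nM] := pselect (sobolev (M t w)); last by rewrite /QR On0// mul0r.
rewrite QRE//; apply: (hdot_ge0 hab); apply: C2_sub; last exact: C2_Sn.
by case: (sobolev_hdot hab hs sM).
Qed.

Lemma Fmeas_QR n t : 0 <= t -> Fmeas (F t) (QR n t).
Proof.
move=> t0; have sA := filtration_sigma hF t0; have fb j := Fmeas_beta hW j t0.
have fs : Fmeas (F t) (Sq n t).
  apply: (Fmeas_sum sA) => j; apply: (Fmeas_mul sA (fb j)); apply: (Fmeas_sum sA) => k.
  by apply: (Fmeas_mul sA (fb k)); exact: Fmeas_cst.
apply: (Fmeas_mul sA); first exact: Fmeas_On.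
apply: (Fmeas_add sA) => //; apply: (Fmeas_sub sA); first exact: Fmeas_Qm.
apply: (Fmeas_mul sA); first exact: Fmeas_cst.
by apply: (Fmeas_sum sA) => j; apply: (Fmeas_mul sA (fb j)); exact: Fmeas_Mm.
Qed.

Lemma sobolev_Sn n t w : sobolev (Sn n t w).
Proof.
elim: n => [|n ih].
  have := sobolev_lin hab (-1) (sobolev_psi 0) (sobolev_psi 0); congr (sobolev).
  by apply/funext => x; rewrite /Sn big_geq// mulN1r addrC subrr.
have := sobolev_lin hab (beta n t w) (sobolev_psi n) ih; congr (sobolev).
by apply/funext => x; rewrite /Sn big_nat_recr//= addrC.
Qed.

Lemma QR_le_Hnorm2 n t w : ((QR n t w)%:E <= Hnorm2 s (fun x =>
   M t w x - \sum_(j < n) beta j t w * (Lam a b \o Phi) (e j) x)%R)%E.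
Proof.
have [sM|nM] := pselect (sobolev (M t w)); last by rewrite /QR On0// mul0r Hnorm2_ge0.
have eS : (fun x => M t w x - \sum_(j < n) beta j t w * (Lam a b \o Phi) (e j) x) =
    (fun x => M t w x - Sn n t w x).
  by apply/funext => x; rewrite /Sn big_mkord.
have sR : sobolev (fun x => M t w x - Sn n t w x) by exact: (sobolev_sub hab sM (sobolev_Sn n t w)).
by rewrite eS (sobolev_fin sR) lee_fin QRE// sobolev_hdot_le.
Qed.

(** Squeezed between 0 and the H^s error in the definition of the stochastic integral, whose
    integrand need not be measurable for this. *)
Lemma QR_integral_cvg t : 0 <= t -> (fun n => \int[P]_w (QR n t w)%:E)%E @ \oo --> 0%E.
Proof.
move=> t0; case: hM => _ _ /(_ t t0) cv.
apply: (squeeze_cvge _ (cvg_cst _) cv); apply: nearW => n; apply/andP; split.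
  by apply: integral_ge0 => w _; rewrite lee_fin QR_ge0.
by apply: ge0_le_integral_nomeas => w; [rewrite lee_fin QR_ge0|exact: QR_le_Hnorm2].
Qed.

Lemma Qm_le n t w : sobolev (M t w) -> Qm t w <= 2 * QR n t w + 2 * Sq n t w.
Proof.
move=> sM; have [Cm _] := sobolev_hdot hab hs sM; have Cs := C2_Sn n t w; have Cd := C2_sub Cm Cs.
have Ca := C2_add Cm Cs.
rewrite (QmE sM) (QRE n sM) -(SqE n t w).
have := hdot_ge0 hab (C2_sub Cd Cs).
rewrite (hdot_subl hab Cd Cs (C2_sub Cd Cs)) (hdot_subr hab Cd Cs Cd) (hdot_subr hab Cd Cs Cs).
rewrite (hdotC a b (Sn n t w) (fun x => M t w x - Sn n t w x)).
rewrite (hdot_subl hab Cm Cs Cd) (hdot_subl hab Cm Cs Cs) (hdot_subr hab Cm Cs Cm) (hdot_subr hab Cm Cs Cs).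
rewrite (hdotC a b (Sn n t w) (M t w)).
by move: (hdot (M t w) (M t w)) (hdot (M t w) (Sn n t w)) (hdot (Sn n t w) (Sn n t w)) => A B D; lra.
Qed.

(** With remainder [r = M - Sn], one has [|M|^2 - |Sn|^2 = 2 <M, r> - |r|^2], and Young's inequality
    bounds the pairing. *)
Lemma Qm_diff n t w lam : 0 < lam -> sobolev (M t w) ->
  `|Qm t w - Sq n t w| <= 2 * lam * Qm t w + (2 * lam^-1 + 1) * QR n t w.
Proof.
move=> l0 sM; have [Cm _] := sobolev_hdot hab hs sM; have Cs := C2_Sn n t w; have Cd := C2_sub Cm Cs.
have q0 := QR_ge0 n t w; have := hdot_amgm hab l0 Cm Cd; rewrite -(QRE n sM) -(QmE sM).
have -> : hdot (M t w) (fun x => M t w x - Sn n t w x) = 2^-1 * (Qm t w - Sq n t w + QR n t w).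
  rewrite (QRE n sM) (QmE sM) -(SqE n t w).
  rewrite (hdot_subl hab Cm Cs Cd) (hdot_subr hab Cm Cs Cm) (hdot_subr hab Cm Cs Cs).
  rewrite (hdotC a b (Sn n t w) (M t w)).
  by move: (hdot (M t w) (M t w)) (hdot (M t w) (Sn n t w)) (hdot (Sn n t w) (Sn n t w)) => A B D; lra.
rewrite !ler_norml => /andP[]; move: (Qm t w) (Sq n t w) (QR n t w) q0 (lam^-1) => A B D D0 l.
by move=> h1 h2; apply/andP; split; lra.
Qed.

Lemma QR_le n t w : sobolev (M t w) -> QR n t w <= 2 * Qm t w + 2 * Sq n t w.
Proof.
move=> sM; have [Cm _] := sobolev_hdot hab hs sM; have Cs := C2_Sn n t w; have Cd := C2_sub Cm Cs.
have Ca := C2_add Cm Cs.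
rewrite (QmE sM) (QRE n sM) -(SqE n t w).
rewrite (hdot_subl hab Cm Cs Cd) (hdot_subr hab Cm Cs Cm) (hdot_subr hab Cm Cs Cs).
have := hdot_ge0 hab Ca.
rewrite (hdot_addl hab Cm Cs Ca) (hdot_addr hab Cm Cs Cm) (hdot_addr hab Cm Cs Cs).
rewrite (hdotC a b (Sn n t w) (M t w)).
by move: (hdot (M t w) (M t w)) (hdot (M t w) (Sn n t w)) (hdot (Sn n t w) (Sn n t w)) => A B D; lra.
Qed.

Lemma noise_regular : exists G, [/\ measurable G, P (~` G) = 0%E &
  forall w, G w -> forall t, 0 <= t -> sobolev (M t w)].
Proof.
case: hM => _ aeM _; have [G [mG PG sG]] := ae_set aeM.
by exists G; split => // w /sG h t t0; case: (h t t0 (ltry _)).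
Qed.

(** One [n] whose remainder has finite mean is enough, because
    [|M|^2 <= 2 |M - Sn|^2 + 2 |Sn|^2]. *)
Lemma L1_Qm t : 0 <= t -> L1 (Qm t).
Proof.
move=> t0; have [G [mG PG sG]] := noise_regular.
have [n hn] : exists n, (\int[P]_w (QR n t w)%:E < 1)%E.
  have h0 : nbhs (0 : \bar R)%E [set x | (x < 1)%E].
    by apply: open_nbhs_nbhs; split; [exact: open_ereal_lt_ereal|rewrite /= lte01].
  by have [n _ hn] := QR_integral_cvg t0 h0; exists n; apply: (hn n) => /=.
have iQR : L1 (QR n t).
  apply: L1_fin; [exact: (Fmeas_meas hF t0 (Fmeas_QR n t0))|exact: QR_ge0|].
  by apply: lt_trans hn _; rewrite ltry.
have [iS _] := Sq_moment n t0.
apply: (L1_le_ae mG PG) (L1_add (L1_scale 2 iQR) (L1_scale 2 iS)).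
  exact: (Fmeas_meas hF t0 (Fmeas_Qm t0)).
by move=> w Gw; rewrite (ger0_norm (Qm_ge0 t w)); apply: Qm_le; exact: sG.
Qed.

(** Convergence gives finite means for large [n] only; integrability of [Qm] gives it for every
    [n]. *)
Lemma L1_QR n t : 0 <= t -> L1 (QR n t).
Proof.
move=> t0; have [G [mG PG sG]] := noise_regular; have [iS _] := Sq_moment n t0.
apply: (L1_le_ae mG PG) (L1_add (L1_scale 2 (L1_Qm t0)) (L1_scale 2 iS)).
  exact: (Fmeas_meas hF t0 (Fmeas_QR n t0)).
by move=> w Gw; rewrite (ger0_norm (QR_ge0 n t w)); apply: QR_le; exact: sG.
Qed.

Lemma EX_QR_cvg t : 0 <= t -> EX (QR n t) @[n --> \oo] --> (0 : R).
Proof.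
move=> t0; have := QR_integral_cvg t0.
rewrite (_ : (fun n => _) = fun n => (EX (QR n t))%:E); last first.
  by apply/funext => n; rewrite EX_EFin//; exact: L1_QR.
exact: fine_cvg.
Qed.

(** In [Qm_diff] the limit in [n] is taken at fixed [lam], which removes the remainder whatever its
    coefficient; then [lam] tends to 0. *)
Lemma EX_Qm t : 0 <= t -> EX (Qm t) = t * noise_rate.
Proof.
move=> t0; have [G [mG PG sG]] := noise_regular; have iQ := L1_Qm t0.
have B0 : 0 <= EX (Qm t) by apply: EX_ge0; exact: Qm_ge0.
have [cv _] := psi_sq_summable.
have cS : EX (Sq n t) @[n --> \oo] --> t * noise_rate.
  rewrite (_ : (fun n => _) = fun n => t * series (fun j => hdot (psi j) (psi j)) n).
    by apply: cvgM; [exact: cvg_cst|exact: cv].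
  by apply/funext => n; have [_ ->] := Sq_moment n t0; rewrite seriesEnat.
have key lam : 0 < lam -> `|EX (Qm t) - t * noise_rate| <= 2 * lam * EX (Qm t).
  move=> l0; have h n : `|EX (Qm t) - EX (Sq n t)| <= 2 * lam * EX (Qm t) + (2 * lam^-1 + 1) * EX (QR n t).
    have [iS _] := Sq_moment n t0; have iR := L1_QR n t0; rewrite -EX_sub//.
    apply: le_trans (EX_norm (L1_sub iQ iS)) _.
    rewrite -!EX_scale// -EX_add; [|exact: L1_scale|exact: L1_scale].
    apply: (EX_le_ae mG PG); [exact: L1_abs (L1_sub iQ iS)|by apply: L1_add; exact: L1_scale|].
    by move=> w Gw; apply: Qm_diff => //; exact: sG.
  have c1 : `|EX (Qm t) - EX (Sq n t)| @[n --> \oo] --> `|EX (Qm t) - t * noise_rate|.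
    by apply: cvg_norm; apply: cvgB => //; exact: cvg_cst.
  have c2 : 2 * lam * EX (Qm t) + (2 * lam^-1 + 1) * EX (QR n t) @[n --> \oo] -->
      2 * lam * EX (Qm t) + (2 * lam^-1 + 1) * 0.
    by apply: cvgD; [exact: cvg_cst|apply: cvgM; [exact: cvg_cst|exact: EX_QR_cvg]].
  have : `|EX (Qm t) - t * noise_rate| <= 2 * lam * EX (Qm t) + (2 * lam^-1 + 1) * 0.
    by apply: ler_cvg_to c1 c2 _; apply: nearW.
  by rewrite mulr0 addr0.
apply/eqP; rewrite -subr_eq0 -normr_le0; apply/ler_addgt0Pl => eps e0; rewrite addr0.
have B1 : 0 < 2 * (EX (Qm t) + 1) by lra.
(* The denominator is enlarged by 1 so that it stays positive when [EX (Qm t)] is zero. *)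
apply: le_trans (key (eps / (2 * (EX (Qm t) + 1))) (divr_gt0 e0 B1)) _.
have -> : 2 * (eps / (2 * (EX (Qm t) + 1))) * EX (Qm t) = eps * (EX (Qm t) / (EX (Qm t) + 1)).
  by field; apply/lt0r_neq0; lra.
apply: ler_piMr; first exact: ltW.
by rewrite ler_pdivrMr; lra.
Qed.
End NoiseMoments.

(** * Mean energy at a positive time *)

Section EnergyIdentity.
Context {R : realType} {d : measure_display} {Omega : measurableType d}.
Variables a b s T : R.
Hypothesis hab : a < b.
Hypothesis hs : 5 / 2 < s.
Variables (P : probability Omega R) (F : R -> set (set Omega)) (beta : nat -> R -> Omega -> R).
Hypothesis hF : filtration F.
Hypothesis hW : cylindrical_wiener P F beta.
Variables (e : nat -> R -> R) (Phi : (R -> R) -> R -> R) (M : R -> Omega -> R -> R).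
Hypothesis he : forall j, L20 a b (e j).
Hypothesis hPhi : hilbert_schmidt a b e (s - 2) Phi.
Hypothesis hM : stochastic_integral a b P F e beta s (Lam a b \o Phi) M.
Variables (u0 : R -> R) (u : R -> Omega -> R -> R) (tau : Omega -> \bar R).
Hypothesis su0 : sobolev a b s u0.
Hypothesis au : adapted a b F s tau u.
Hypothesis hsup : (\int[P]_w ereal_sup [set Hnorm2 a b s (u t w) | t in `[0%R, T]] < +oo)%E.
(** One event of full probability on which all pathwise properties below hold at once. *)
Variable G : set Omega.
Hypothesis mG : measurable G.
Hypothesis PG : P (~` G) = 0%E.
Hypothesis Gtau : forall w, G w -> (T%:E < tau w)%E.
Hypothesis Gu : forall w, G w -> sobolev_path a b s (tau w) (fun t => u t w).
Hypothesis GM : forall w, G w -> sobolev_path a b s +oo%E (fun t => M t w).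
Hypothesis Geq : forall w, G w -> forall t, 0 <= t -> (t%:E < tau w)%E -> forall x,
  u t w x = u0 x + RI 0 t (fun t' => drift a b (u t' w) x) + M t w x.

Local Notation sobolev := (sobolev a b s).
Local Notation Hnorm2 := (Hnorm2 a b).
Local Notation C2 := (C2 a b).
Local Notation hdot := (hdot a b).
Local Notation L1 := (L1 P).
Local Notation EX := (EX P).
Local Notation psi := (psi a b e Phi).
Local Notation rate := (noise_rate a b e Phi).
Local Notation Sn := (Sn a b beta e Phi).
Local Notation Qm := (Qm a b s M).
Local Notation Mm := (Mm a b s e Phi M).
Local Notation QR := (QR a b s beta e Phi M).

Hypothesis G0 : forall w, G w -> Qm 0 w = 0.

Let Cpsi j : C2 (psi j). Proof. exact: (C2_psi hab hs he hPhi j). Qed.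
Let spsi j : sobolev (psi j). Proof. exact: (sobolev_psi hab he hPhi j). Qed.
Let rate0 : 0 <= rate. Proof. exact: (noise_rate_ge0 hab hs he hPhi). Qed.
Let partial n : \sum_(0 <= j < n) hdot (psi j) (psi j) <= rate.
Proof. exact: (noise_partial_le hab hs he hPhi n). Qed.
Let Qm0 t w : 0 <= Qm t w. Proof. exact: (Qm_ge0 hab hs M t w). Qed.
Let QR0 n t w : 0 <= QR n t w. Proof. exact: (QR_ge0 hab hs beta M he hPhi n t w). Qed.
Let iQm t : 0 <= t -> L1 (Qm t). Proof. exact: (@L1_Qm _ _ _ _ _ _ hab hs _ _ _ hF hW _ _ _ he hPhi hM t). Qed.
Let iQR n t : 0 <= t -> L1 (QR n t). Proof. exact: (@L1_QR _ _ _ _ _ _ hab hs _ _ _ hF hW _ _ _ he hPhi hM n t). Qed.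
Let EQm t : 0 <= t -> EX (Qm t) = t * rate. Proof. exact: (@EX_Qm _ _ _ _ _ _ hab hs _ _ _ hF hW _ _ _ he hPhi hM t). Qed.
Let cQR t : 0 <= t -> EX (QR n t) @[n --> \oo] --> (0 : R).
Proof. exact: (@EX_QR_cvg _ _ _ _ _ _ hab hs _ _ _ hF hW _ _ _ he hPhi hM t). Qed.

Definition Qu := pfunc a b s tau u (fun f => hdot f f).
Definition Um j := pfunc a b s tau u (hdot^~ (psi j)).

Let alive t w : G w -> 0 <= t <= T -> [/\ (t%:E < tau w)%E, sobolev (u t w) & sobolev (M t w)].
Proof.
move=> Gw /andP[t0 tT]; have h : (t%:E < tau w)%E.
  by apply: le_lt_trans (Gtau Gw); rewrite lee_fin.
split => //; first by case: (Gu Gw t0 h).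
by case: (GM Gw t0 (ltry _)).
Qed.

Lemma Qu_ge0 t w : 0 <= Qu t w.
Proof. by apply: pfunc_ge0 => f sf; apply: hdot_ge0 => //; case: (sobolev_hdot hab hs sf). Qed.

Lemma QuE t w : G w -> 0 <= t <= T -> Qu t w = hdot (u t w) (u t w).
Proof. by move=> Gw tT; have [h1 h2 _] := alive Gw tT; exact: pfuncE. Qed.

Definition sup_bound : R := fine (\int[P]_w ereal_sup [set Hnorm2 s (u t w) | t in `[0%R, T]])%E.

Lemma Qu_measurable t : 0 <= t -> measurable_fun setT (Qu t).
Proof.
move=> t0; apply: (Fmeas_meas hF t0); apply: (Fmeas_pfunc hF au t0); exact: lower_continuous_sq.
Qed.

Lemma Qu_L1 t : 0 <= t <= T -> L1 (Qu t) /\ EX (Qu t) <= sup_bound.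
Proof.
move=> tT; have [t0 _] := andP tT.
have h : (\int[P]_w (Qu t w)%:E <= \int[P]_w ereal_sup [set Hnorm2 s (u t w) | t in `[0%R, T]])%E.
  apply: ge0_le_integral_nomeas => w; first by rewrite lee_fin Qu_ge0.
  have h1 : (Hnorm2 s (u t w) <= ereal_sup [set Hnorm2 s (u t w) | t in `[0%R, T]])%E.
    by apply: ereal_sup_ubound; exists t => //=; rewrite in_itv.
  apply: le_trans h1; rewrite /Qu /pfunc; case: asboolP => [[_ su]|_]; last exact: Hnorm2_ge0.
  by rewrite (sobolev_fin su) lee_fin sobolev_hdot_le.
have i : L1 (Qu t).
  by apply: L1_fin (Qu_measurable t0) (Qu_ge0 t) _; exact: le_lt_trans hsup.
split => //; rewrite -lee_fin -EX_EFin// /sup_bound fineK// ge0_fin_numE//.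
by apply: le_trans h; apply: integral_ge0 => w _; rewrite lee_fin Qu_ge0.
Qed.

Lemma pfunc_CS (sigma : Omega -> \bar R) (v : R -> Omega -> R -> R) j t w :
  pfunc a b s sigma v (hdot^~ (psi j)) t w ^+ 2 <=
  pfunc a b s sigma v (fun f => hdot f f) t w * hdot (psi j) (psi j).
Proof.
rewrite /pfunc; case: asboolP => [[_ sv]|_]; last by rewrite expr0n mul0r.
by apply: hdot_CS => //; case: (sobolev_hdot hab hs sv).
Qed.

(** On [G], for [t] in [[0, T]], this is [<Y(t), psi j>]; it is written through [Um] and [Mm], which
    are adapted. *)
Definition Xc j t w := Um j t w - Mm j t w.

Lemma Fmeas_Xc j t : 0 <= t -> Fmeas (F t) (Xc j t).
Proof.
move=> t0; apply: (Fmeas_sub (filtration_sigma hF t0)); last exact: (Fmeas_Mm hab hs hF he hPhi hM j t0).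
by apply: (Fmeas_pfunc hF au t0); apply: lower_continuous_hdot.
Qed.

(** Bounds [E (|u|^2 + |M|^2)] at every time up to [T]: the first term comes from the assumed
    moment, the second from [EX_Qm]. *)
Definition moment_bound : R := sup_bound + T * rate.

Lemma Xc_sq j t : 0 <= t <= T -> L1 (fun w => Xc j t w ^+ 2) /\
  EX (fun w => Xc j t w ^+ 2) <= 2 * moment_bound * hdot (psi j) (psi j).
Proof.
move=> tT; have [t0 tT'] := andP tT; have [iQ EQ] := Qu_L1 tT; have p0 := hdot_ge0 hab (Cpsi j).
have le1 w : Xc j t w ^+ 2 <= 2 * hdot (psi j) (psi j) * (Qu t w + Qm t w).
  have h1 : Um j t w ^+ 2 <= Qu t w * hdot (psi j) (psi j) by exact: pfunc_CS.
  have h2 : Mm j t w ^+ 2 <= Qm t w * hdot (psi j) (psi j) by exact: pfunc_CS.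
  have h3 : Xc j t w ^+ 2 <= 2 * Um j t w ^+ 2 + 2 * Mm j t w ^+ 2.
    by rewrite /Xc; have := sqr_ge0 (Um j t w + Mm j t w); nra.
  apply: le_trans h3 _; move: h1 h2.
  move: (Um j t w ^+ 2) (Mm j t w ^+ 2) (Qu t w) (Qm t w) (hdot (psi j) (psi j)) => A B C D E h1 h2.
  have -> : 2 * E * (C + D) = 2 * (C * E) + 2 * (D * E) by ring.
  lra.
have iS : L1 (fun w => Qu t w + Qm t w) by apply: L1_add => //; exact: iQm.
have iX : L1 (fun w => Xc j t w ^+ 2).
  apply: (L1_le _ _ (L1_scale (2 * hdot (psi j) (psi j)) iS)).
    by apply: measurable_funX; exact: (Fmeas_meas hF t0 (Fmeas_Xc j t0)).
  by move=> w; rewrite ger0_norm ?sqr_ge0.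
split => //; apply: le_trans (EX_le iX (L1_scale (2 * hdot (psi j) (psi j)) iS) le1) _.
rewrite EX_scale// EX_add//; last exact: iQm.
rewrite (EQm t0) -mulrA [X in 2 * X]mulrC mulrA ler_wpM2r// ler_pM2l// lerD// ler_wpM2r//.
Qed.

Section Partition.
Variable t : R.
Hypothesis t0 : 0 < t.
Hypothesis tT : t <= T.
Local Notation tt := (tpart t).

Let tt0 N i : 0 <= tt N i. Proof. by rewrite /tpart mulr_ge0// divr_ge0// ltW. Qed.

Let ttS N i : tt N i.+1 - tt N i = t / N.+1%:R.
Proof. by rewrite /tpart -mulrBl -natrB// subSnn mul1r. Qed.

Let tt_lt N i : tt N i < tt N i.+1.
Proof. by rewrite -subr_gt0 ttS divr_gt0. Qed.

Let tt_in N i : (i <= N.+1)%N -> 0 <= tt N i <= T.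
Proof.
move=> iN; rewrite tt0/=; apply: le_trans tT; rewrite /tpart mulrCA ler_piMr ?(ltW t0)//.
by rewrite ler_pdivrMr ?ltr0n// mul1r ler_nat.
Qed.

Definition Jsum n N w := \sum_(0 <= i < N.+1) \sum_(0 <= j < n)
  Xc j (tt N i) w * (beta j (tt N i.+1) w - beta j (tt N i) w).

(** By [step_sum], the second moment is a sum of step lengths times the squared coefficients.
    Cauchy-Schwarz gives each coefficient a factor [|psi j|^2], whose sum stays below the rate:
    hence a bound independent of [n] and [N]. *)
Lemma Jsum_moments n N : [/\ measurable_fun setT (Jsum n N), L1 (fun w => Jsum n N w ^+ 2),
  EX (Jsum n N) = 0 & EX (fun w => Jsum n N w ^+ 2) <= t * (2 * moment_bound * rate)].
Proof.
have fX i j : (i < N.+1)%N -> Fmeas (F (tt N i)) (Xc j (tt N i)) by move=> _; exact: Fmeas_Xc.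
have iX i j : (i < N.+1)%N -> L1 (fun w => Xc j (tt N i) w ^+ 2).
  by move=> iN; case: (Xc_sq j (tt_in (ltnW iN))).
have [f1 i1 e1 v1] := step_sum hF hW n (tt0 N 0) (tt_lt N) fX iX.
split => //; first exact: (Fmeas_meas hF (tt0 N _) f1).
rewrite [leLHS]v1.
have K0 : 0 <= moment_bound.
  have Tin : 0 <= T <= T by rewrite lexx andbT; exact: le_trans (ltW t0) tT.
  have [Tge _] := andP Tin; have [_ h] := Qu_L1 Tin.
  apply: addr_ge0; last exact: mulr_ge0.
  by apply: le_trans h; apply: EX_ge0; exact: Qu_ge0.
have -> : t * (2 * moment_bound * rate) = \sum_(0 <= i < N.+1) t / N.+1%:R * (2 * moment_bound * rate).
  rewrite sumr_const_nat subn0 -[RHS]mulr_natl; field.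
  by rewrite addrC natr1 pnatr_eq0.
apply: ler_sum_nat => i /andP[_ iN]; rewrite ttS; apply: ler_wpM2l; first by rewrite divr_ge0// ltW.
apply: (@le_trans _ _ (\sum_(0 <= j < n) 2 * moment_bound * hdot (psi j) (psi j))).
  by apply: ler_sum => j _; case: (Xc_sq j (tt_in (ltnW iN))).
by rewrite -mulr_sumr; apply: ler_wpM2l => //; apply: mulr_ge0.
Qed.

(** Bounds the cost of keeping [n] modes: Young's inequality puts [lam] on [Y = u - M] and [lam^-1]
    on the increment of the remainder, and the factors 2 come from squares of differences. *)
Definition Derr lam n N w := \sum_(i < N.+1)
  (2 * lam * (Qu (tt N i) w + Qm (tt N i) w) + 2 * lam^-1 * (QR n (tt N i.+1) w + QR n (tt N i) w)).

Lemma Derr_ge0 lam n N w : 0 < lam -> 0 <= Derr lam n N w.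
Proof.
move=> l0; apply: sumr_ge0 => i _; have l1 : 0 <= 2 * lam^-1 by rewrite mulr_ge0// invr_ge0 ltW.
have l2 : 0 <= 2 * lam by rewrite mulr_ge0// ltW.
apply: addr_ge0; apply: mulr_ge0 => //; apply: addr_ge0 => //; exact: Qu_ge0.
Qed.

Lemma Derr_L1 lam n N : L1 (Derr lam n N).
Proof.
apply: L1_sum => i; have h : 0 <= tt N i <= T by apply: tt_in; apply: ltnW.
have [iQ _] := Qu_L1 h.
apply: L1_add; apply: L1_scale; apply: L1_add => //; [exact: iQm|exact: iQR|exact: iQR].
Qed.

Lemma Derr_EX lam n N rho : 0 < lam -> (forall i, (i <= N.+1)%N -> EX (QR n (tt N i)) <= rho) ->
  EX (Derr lam n N) <= N.+1%:R * (2 * lam * moment_bound + 4 * lam^-1 * rho).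
Proof.
move=> l0 hR; have l1 : 0 <= 2 * lam^-1 by rewrite mulr_ge0// invr_ge0 ltW.
have l2 : 0 <= 2 * lam by rewrite mulr_ge0// ltW.
have -> : N.+1%:R * (2 * lam * moment_bound + 4 * lam^-1 * rho) =
    \sum_(i < N.+1) (2 * lam * moment_bound + 2 * lam^-1 * (rho + rho)).
  by rewrite sumr_const card_ord -[RHS]mulr_natl; congr (_ * _); ring.
have tin (i : 'I_N.+1) : 0 <= tt N i <= T by apply: tt_in; apply: ltnW.
have iA (i : 'I_N.+1) : L1 (fun w => Qu (tt N i) w + Qm (tt N i) w).
  by apply: L1_add; [case: (Qu_L1 (tin i))|exact: iQm].
have iB (i : 'I_N.+1) : L1 (fun w => QR n (tt N i.+1) w + QR n (tt N i) w).
  by apply: L1_add; exact: iQR.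
rewrite EX_sum => [|i]; last by apply: L1_add; apply: L1_scale.
apply: ler_sum => i _; rewrite EX_add; [|exact: L1_scale|exact: L1_scale].
rewrite !EX_scale//; apply: lerD; apply: ler_wpM2l => //.
  have [iQ EQ] := Qu_L1 (tin i); rewrite EX_add//; last exact: iQm.
  apply: lerD => //; rewrite EQm//; apply: ler_wpM2r => //.
  by case/andP: (tin i).
rewrite EX_add; [|exact: iQR|exact: iQR]; apply: lerD; apply: hR => //.
exact: ltnW.
Qed.

Lemma hdot_sub_le f g : C2 f -> C2 g ->
  hdot (fun x => f x - g x) (fun x => f x - g x) <= 2 * hdot f f + 2 * hdot g g.
Proof.
move=> Cf Cg; have Cs := C2_sub Cf Cg; have Ca := C2_add Cf Cg.
have := hdot_ge0 hab Ca.
rewrite (hdot_addl hab Cf Cg Ca) (hdot_addr hab Cf Cg Cf) (hdot_addr hab Cf Cg Cg).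
rewrite (hdot_subl hab Cf Cg Cs) (hdot_subr hab Cf Cg Cf) (hdot_subr hab Cf Cg Cg) (hdotC a b g f).
by move: (hdot f f) (hdot f g) (hdot g g) => A B D; lra.
Qed.

(** Step by step the difference is [<Y, r' - r>], where [r] and [r'] are the remainders of [M] after
    [n] modes at the two ends of the step. *)
Lemma Jsum_close lam n N w : 0 < lam -> G w ->
  `|\sum_(0 <= i < N.+1) hdot (fun x => u (tt N i) w x - M (tt N i) w x)
       (fun x => M (tt N i.+1) w x - M (tt N i) w x) - Jsum n N w| <= Derr lam n N w.
Proof.
move=> l0 Gw; rewrite /Jsum !big_mkord -sumrB; apply: le_trans (ler_norm_sum _ _ _) _.
apply: ler_sum => i _.
have in1 : 0 <= tt N i <= T by apply: tt_in; apply: ltnW.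
have in2 : 0 <= tt N i.+1 <= T by exact: tt_in.
have [ta su sm] := alive Gw in1; have [_ _ sm'] := alive Gw in2.
have [Cu _] := sobolev_hdot hab hs su; have [Cm _] := sobolev_hdot hab hs sm.
have [Cm' _] := sobolev_hdot hab hs sm'.
have Cs := C2_Sn hab hs beta he hPhi n (tt N i) w.
have Cs' := C2_Sn hab hs beta he hPhi n (tt N i.+1) w.
have Cy := C2_sub Cu Cm; have Cr := C2_sub Cm Cs; have Cr' := C2_sub Cm' Cs'.
set y := (fun x => u (tt N i) w x - M (tt N i) w x) in Cy *.
set r := (fun x => M (tt N i) w x - Sn n (tt N i) w x) in Cr.
set r' := (fun x => M (tt N i.+1) w x - Sn n (tt N i.+1) w x) in Cr'.
have eJ : \sum_(0 <= j < n) Xc j (tt N i) w * (beta j (tt N i.+1) w - beta j (tt N i) w) =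
    hdot y (Sn n (tt N i.+1) w) - hdot y (Sn n (tt N i) w).
  rewrite ![hdot y _]hdotC (hdot_Sn hab hs beta he hPhi n (tt N i.+1) w Cy)
    (hdot_Sn hab hs beta he hPhi n (tt N i) w Cy) -sumrB; apply: eq_bigr => j _.
  rewrite -mulrBl mulrC; congr (_ * _); rewrite /Xc /Um (pfuncE _ ta su) (MmE e Phi j sm).
  by rewrite [RHS]hdotC /y (hdot_subl hab Cu Cm (Cpsi j)).
rewrite eJ (hdot_subr hab Cm' Cm Cy).
have -> : hdot y (M (tt N i.+1) w) - hdot y (M (tt N i) w) -
    (hdot y (Sn n (tt N i.+1) w) - hdot y (Sn n (tt N i) w)) = hdot y (fun x => r' x - r x).
  rewrite (hdot_subr hab Cr' Cr Cy) (hdot_subr hab Cm' Cs' Cy) (hdot_subr hab Cm Cs Cy).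
  move: (hdot y (M (tt N i.+1) w)) (hdot y (M (tt N i) w)) (hdot y (Sn n (tt N i.+1) w)) (hdot y (Sn n (tt N i) w)) => A B D E.
  lra.
apply: le_trans (hdot_amgm hab l0 Cy (C2_sub Cr' Cr)) _.
have l1 : 0 <= lam^-1 by rewrite invr_ge0 ltW.
have q1 := ler_wpM2l (ltW l0) (hdot_sub_le Cu Cm); have q2 := ler_wpM2l l1 (hdot_sub_le Cr' Cr).
rewrite (QuE Gw in1) (QmE sm) (QRE hab hs beta he hPhi n sm') (QRE hab hs beta he hPhi n sm).
rewrite -/r -/r'; move: q1 q2; rewrite -/y.
move: (hdot y y) (hdot (u (tt N i) w) _) (hdot (M (tt N i) w) (M (tt N i) w)) (hdot r' r') (hdot r r)
  (hdot (fun x => r' x - r x) _) => A B D E H K.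
have -> : lam * (2 * B + 2 * D) = 2 * lam * (B + D) by ring.
have -> : lam^-1 * (2 * E + 2 * H) = 2 * lam^-1 * (E + H) by ring.
by move: (lam * A) (lam^-1 * K) (2 * lam * (B + D)) (2 * lam^-1 * (E + H)) => A' B' D' E'; lra.
Qed.

Lemma path_energy w (eps : R) : G w -> 0 < eps -> exists N0, forall N, (N0 <= N)%N ->
  `|Qu t w - Qm t w - hdot u0 u0 - 2 * \sum_(0 <= i < N.+1)
     hdot (fun x => u (tt N i) w x - M (tt N i) w x) (fun x => M (tt N i.+1) w x - M (tt N i) w x)| <= eps.
Proof.
move=> Gw eps0; have tlt : (t%:E < tau w)%E by apply: le_lt_trans (Gtau Gw); rewrite lee_fin.
have onu := sobolev_path_on tlt (Gu Gw).
have onm := sobolev_path_on (ltry t) (GM Gw).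
have veq : forall r, 0 <= r <= t -> forall x,
    u r w x = u0 x + RI 0 r (fun t' => drift a b (u t' w) x) + M r w x.
  move=> r /andP[r0 rt] x; apply: (Geq Gw r0); apply: le_lt_trans tlt; by rewrite lee_fin.
have [N0 hN0] := energy_balance hab hs t0 onu onm veq eps0; exists N0 => N NN.
have := hN0 N NN; cbv beta.
have tin : 0 <= t <= T by rewrite (ltW t0).
have zin : 0 <= (0 : R) <= T by rewrite lexx (le_trans (ltW t0)).
have [_ su sm] := alive Gw tin; have [_ su' sm'] := alive Gw zin.
have [Cu _] := sobolev_hdot hab hs su; have [Cm _] := sobolev_hdot hab hs sm.
have [Cu' _] := sobolev_hdot hab hs su'; have [Cm' _] := sobolev_hdot hab hs sm'.
have [C0 _] := sobolev_hdot hab hs su0.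
have y0 : (u 0 w \- M 0 w) = u0.
  apply/funext => x; have := veq 0 (andb_true_intro (conj (lexx 0) (ltW t0))) x.
  have -> : RI 0 0 (fun t' => drift a b (u t' w) x) = 0 by rewrite /RI set_itv1 Rintegral_set1.
  by move=> /= ->; rewrite addr0 addrK.
rewrite y0.
(* The H^1 norm of [M 0] is zero on [G], so Cauchy-Schwarz kills the initial pairing. *)
have m0 : hdot u0 (M 0 w) = 0.
  have := hdot_CS hab C0 Cm'; rewrite -(QmE sm') (G0 Gw) mulr0 => h.
  by apply/eqP; rewrite -(sqrf_eq0 (hdot u0 (M 0 w))) -[_ == 0]/(_ == _); apply/eqP/le_anti; rewrite h sqr_ge0.
have e1 : hdot (u t w \- M t w) (u t w \- M t w) + 2 * hdot (u t w \- M t w) (M t w) = Qu t w - Qm t w.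
  rewrite (QuE Gw tin) (QmE sm) (hdot_subl hab Cu Cm (C2_sub Cu Cm)) (hdot_subr hab Cu Cm Cu) (hdot_subr hab Cu Cm Cm)
    (hdot_subl hab Cu Cm Cm) (hdotC a b (M t w) (u t w)).
  by move: (hdot (u t w) (u t w)) (hdot (u t w) (M t w)) (hdot (M t w) (M t w)) => A B D; ring.
by rewrite e1 m0 mulr0 addr0.
Qed.

Lemma EX_Qu_pos : EX (Qu t) = hdot u0 u0 + t * rate.
Proof.
(* The [N + 1] steps cost [O(lam + lam^-1 rho)] each, with [rho = lam ^ 2] bounding the remainders. *)
pose lam N : R := (N.+1%:R ^+ 2)^-1.
have l0 N : 0 < lam N by rewrite invr_gt0 exprn_gt0.
have [n hn] : {n : nat -> nat & forall N i, (i <= N.+1)%N -> EX (QR (n N) (tt N i)) <= lam N ^+ 2}.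
  apply: (@choice _ _ (fun N n => forall i, (i <= N.+1)%N -> EX (QR n (tt N i)) <= lam N ^+ 2)) => N.
  (* The remainders tend to 0 in mean at each time separately; for fixed [N] only finitely many
     times occur, so one [n] serves them all. *)
  have ev m : \forall n \near \oo, forall i, (i < m)%N -> EX (QR n (tt N i)) <= lam N ^+ 2.
    elim: m => [|m ih]; first by apply: nearW.
    have /cvgrPdist_le/(_ _ (exprn_gt0 2 (l0 N))) hm := cQR (tt0 N m).
    apply: filterS2 ih hm => n h1 h2 i; rewrite ltnS leq_eqVlt => /predU1P[->|]; last exact: h1.
    by apply: le_trans h2; rewrite sub0r normrN ler_norm.
  by have [n _ h] := ev N.+2; exists n => i iN; apply: (h n) => /=.
pose J N w := Jsum (n N) N w.
pose D N w := Derr (lam N) (n N) N w.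
pose I w := 2^-1 * (Qu t w - Qm t w - hdot u0 u0).
have tin : 0 <= t <= T by rewrite (ltW t0).
have [iQu _] := Qu_L1 tin; have iQmt := iQm (ltW t0).
have iI : L1 I.
  by apply: L1_scale; apply: L1_sub; [exact: L1_sub|exact: L1_cst].
have EI : EX I = 0.
  apply: (@mean_zero_limit _ _ _ P G mG PG J D I (t * (2 * moment_bound * rate))).
  - by move=> N; case: (Jsum_moments (n N) N).
  - by move=> N; case: (Jsum_moments (n N) N).
  - by move=> N; case: (Jsum_moments (n N) N).
  - by move=> N; case: (Jsum_moments (n N) N).
  - by move=> N; exact: Derr_L1.
  - by move=> N w; exact: Derr_ge0.
  (* With [rho = lam^2] and [lam = (N + 1)^-2], the total [(N + 1) (2 lam moment_bound + 4 lam)] is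
     exactly [K / (N + 1)]. *)
  - pose K := 2 * moment_bound + 4.
    have bd N : EX (D N) <= K * N.+1%:R^-1.
      apply: le_trans (Derr_EX (l0 N) (hn N)) _.
      have -> : 4 * (lam N)^-1 * lam N ^+ 2 = 4 * lam N.
        by field; apply/lt0r_neq0; exact: l0.
      rewrite /lam /K le_eqVlt; apply/orP; left; apply/eqP; field.
      by rewrite addrC natr1 pnatr_eq0.
    have cv : K * N.+1%:R^-1 @[N --> \oo] --> K * 0.
      by apply: cvgM; [exact: cvg_cst|exact: cvg_harmonic].
    rewrite mulr0 in cv; apply: (squeeze_cvgr _ (cvg_cst _) cv).
    apply: nearW => N; rewrite bd andbT; apply: EX_ge0 => w; exact: Derr_ge0.
  - exact: iI.
  - move=> w Gw eps eps0; have e2 : 0 < 2 * eps by rewrite mulr_gt0.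
    have [N0 hN0] := path_energy Gw e2; exists N0 => N NN.
    have := hN0 N NN; have := Jsum_close (n N) N (l0 N) Gw; rewrite -/(J N w) -/(D N w) /I.
    move: (\sum_(0 <= i < N.+1) _) (J N w) (D N w) (Qu t w - Qm t w - hdot u0 u0) => A B E H.
    rewrite !ler_norml => /andP[h1 h2] /andP[h3 h4]; apply/andP; split; lra.
have : EX I = 2^-1 * (EX (Qu t) - t * rate - hdot u0 u0).
  rewrite EX_scale; last by apply: L1_sub; [exact: L1_sub|exact: L1_cst].
  by rewrite EX_sub; [|exact: L1_sub|exact: L1_cst]; rewrite EX_sub// EX_cst EQm// ltW.
rewrite EI => h; move: h; move: (EX (Qu t)) (t * rate) (hdot u0 u0) => A B C; lra.
Qed.
End Partition.
End EnergyIdentity.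

(** * From the hypotheses to a single event of full probability *)

Lemma EX_eq0_ae {R : realType} {d : measure_display} {Omega : measurableType d}
  (P : probability Omega R) (X : Omega -> R) :
  L1 P X -> (forall w, 0 <= X w) -> EX P X = 0 -> {ae P, forall w, X w = 0}.
Proof.
move=> iX X0 E0; have mX : measurable_fun setT (EFin \o X) by apply/measurable_EFinP; exact: L1_meas iX.
have [h _] := ae_eq_integral_abs P measurableT mX.
have : (\int[P]_w `|(EFin \o X) w| = 0)%E.
  rewrite (_ : (fun w => _) = fun w => (X w)%:E); first by rewrite EX_EFin// E0.
  by apply/funext => w /=; rewrite ger0_norm.
move=> /h; apply: filterS => w /= /(_ I) [].
by [].
Qed.

Local Open Scope ereal_scope.

Theorem mainTheorem3 (R : realType) (a b : R) (hab : (a < b)%R)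
  (d : measure_display) (Omega : measurableType d) (P : probability Omega R)
  (F : R -> set (set Omega)) (hF : filtration F)
  (e : nat -> R -> R) (he : orthonormal_basis a b e)
  (beta : nat -> R -> Omega -> R) (hW : cylindrical_wiener P F beta)
  (s : R) (hs : (5 / 2 < s)%R)
  (u0 : R -> R) (hu0 : sobolev0 a b s u0)
  (Phi : (R -> R) -> R -> R) (hPhi : hilbert_schmidt a b e (s - 2)%R Phi)
  (u : R -> Omega -> R -> R) (tau : Omega -> \bar R)
  (hu : maximal_solution a b P F e beta s Phi u0 u tau)
  (T : R) (hT : (0 < T)%R)
  (htau : P [set w | T%:E < tau w] = 1)
  (hsup : \int[P]_w ereal_sup [set Hnorm2 a b s (u t w) | t in `[0%R, T]]
          < +oo) :
  forall t : R, (0 <= t <= T)%R ->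
    \int[P]_w energy a b u t w =
    (2^-1)%:E * Hnorm2 a b 1 u0
    + (2^-1)%:E * HSnorm2 a b e 1 (Lam a b \o Phi) * t%:E.
Proof.
have [[hstop htau0 au pu [M hM eqn]] _] := hu.
have [he0 _ _] := he.
have hs' := hs.
have su0 : sobolev a b s u0 by case: hu0.
(* The stopping time property makes the complementary event measurable, so its probability can be
   computed from [htau]. *)
have aeT : {ae P, forall w, T%:E < tau w}.
  have Tm : measurable [set w | tau w <= T%:E].
    by case: hF => _ hm _; apply: (hm T (ltW hT)); exact: (hstop T (ltW hT)).
  exists [set w | tau w <= T%:E]; split => //.
    have -> : [set w | tau w <= T%:E] = ~` [set w | T%:E < tau w].
      by apply/seteqP; split => w /=; [move=> h; apply/negP; rewrite -leNgt|move=> /negP; rewrite -leNgt].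
    rewrite probability_setC ?htau ?subee//.
    rewrite (_ : [set w | T%:E < tau w] = ~` [set w | tau w <= T%:E]); first exact: measurableC.
    by apply/seteqP; split => w /=; [move=> h; apply/negP; rewrite -ltNge|move=> /negP; rewrite -ltNge].
  by move=> w /= /negP; rewrite -leNgt.
have aeM : {ae P, forall w, sobolev_path a b s +oo (fun t => M t w)} by case: hM.
(* The second moment formula at time 0 says that the noise starts at 0 almost surely. *)
have ae0 : {ae P, forall w, Qm a b s M 0 w = 0%R}.
  apply: EX_eq0_ae.
  - exact: (L1_Qm hab hs hF hW he0 hPhi hM (lexx 0%R)).
  - by move=> w; exact: (Qm_ge0 hab hs M 0 w).
  - by rewrite (EX_Qm hab hs hF hW he0 hPhi hM (lexx 0%R)) mul0r.
have [G [mG PG sG]] : exists G, [/\ measurable G, P (~` G) = 0 & forall w, G w ->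
    [/\ T%:E < tau w, sobolev_path a b s (tau w) (fun t => u t w), sobolev_path a b s +oo (fun t => M t w),
      (forall t, (0 <= t)%R -> t%:E < tau w -> forall x,
        u t w x = (u0 x + RI 0 t (fun t' => drift a b (u t' w) x) + M t w x)%R) &
      Qm a b s M 0 w = 0%R]].
  have [G [mG PG sG]] := ae_set (filterI aeT (filterI pu (filterI aeM (filterI eqn ae0)))).
  by exists G; split => // w /sG[h1 [h2 [h3 [h4 h5]]]]; split.
have Gtau w (Gw : G w) : T%:E < tau w by case: (sG w Gw).
have Gu w (Gw : G w) : sobolev_path a b s (tau w) (fun t => u t w) by case: (sG w Gw).
have GM w (Gw : G w) : sobolev_path a b s +oo (fun t => M t w) by case: (sG w Gw).
have Geq w (Gw : G w) : forall t, (0 <= t)%R -> t%:E < tau w -> forall x,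
    u t w x = (u0 x + RI 0 t (fun t' => drift a b (u t' w) x) + M t w x)%R by case: (sG w Gw).
have G0 w (Gw : G w) : Qm a b s M 0 w = 0%R by case: (sG w Gw).
have [Cu0 Hu0] := sobolev_hdot hab hs su0.
have [_ Hrate] := psi_sq_summable hab hs he0 hPhi.
move=> t /andP[t0 tT]; rewrite Hu0 Hrate -!EFinM -EFinD.
have tin : (0 <= t <= T)%R by rewrite t0.
have energyE w : G w -> energy a b u t w = (2^-1 * Qu a b s u tau t w)%:E.
  move=> Gw; have tlt : t%:E < tau w by apply: le_lt_trans (Gtau w Gw); rewrite lee_fin.
  have [su _] := Gu w Gw t t0 tlt; have [_ h] := sobolev_hdot hab hs su.
  by rewrite /energy h /Qu pfuncE.
have E0 w : 0 <= energy a b u t w by rewrite /energy mule_ge0// Hnorm2_ge0.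
have q0 w : (0 <= 2^-1 * Qu a b s u tau t w)%R by rewrite mulr_ge0// Qu_ge0.
(* Partitions need a positive time; at 0 the equation reads [u 0 = u0 + M 0] with [M 0] of zero
   norm. *)
have [t_eq0|t_neq0] := eqVneq t 0%R.
  rewrite (@integral_ae_nomeas _ _ _ P G _ (fun=> 2^-1 * hdot a b u0 u0)%R mG PG E0).
  - by rewrite EX_cst t_eq0 mulr0 addr0.
  - exact: L1_cst.
  - by move=> w; rewrite mulr_ge0// hdot_ge0.
  move=> w Gw; rewrite (energyE w Gw); congr (_ * _)%:E.
  have tlt : t%:E < tau w by apply: le_lt_trans (Gtau w Gw); rewrite lee_fin.
  have [su _] := Gu w Gw t t0 tlt; have [sm _] := GM w Gw t t0 (ltry _).
  have [Cm _] := sobolev_hdot hab hs sm.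
  rewrite /Qu pfuncE//; have uE : u t w = (fun x => 1 * u0 x + M t w x)%R.
    apply/funext => x; rewrite (Geq w Gw t t0 tlt x) t_eq0.
    by rewrite (_ : RI 0%R 0%R _ = 0%R) ?addr0 ?mul1r// /RI set_itv1 Rintegral_set1.
  have m0 : hdot a b (M t w) (M t w) = 0%R by rewrite -(QmE sm) t_eq0; exact: G0.
  have c0 : hdot a b u0 (M t w) = 0%R.
    have := hdot_CS hab Cu0 Cm; rewrite m0 mulr0 => h.
    by apply/eqP; rewrite -sqrf_eq0; apply/eqP/le_anti; rewrite h sqr_ge0.
  rewrite uE (hdot_lin_sq hab 1 Cu0 Cm) m0 c0.
  by rewrite mulr0 !addr0 expr1n mul1r.
have tp : (0 < t)%R by rewrite lt_def t_neq0.
have [iQ _] := Qu_L1 hab hs hF au hsup tin.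
(* The energy equals the adapted variable [2^-1 * Qu] on [G] only, hence the version without
   measurability. *)
rewrite (integral_ae_nomeas mG PG E0 (L1_scale 2^-1 iQ) q0 energyE).
rewrite (EX_scale _ iQ) (EX_Qu_pos hab hs hF hW he0 hPhi hM su0 au hsup mG PG Gtau Gu GM Geq G0 tp tT).
congr EFin; move: (hdot a b u0 u0) (noise_rate a b e Phi) => A B; ring.
Qed.
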